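(* Let $V$ be a real locally convex topological vector space, $H$ a real Hilbert space and $j:V\to H$ a linear, weak-to-weak continuous operator. Let $\varphi:V\to\mathbb{R}\cup\{+\infty\}$ be proper, lower semicontinuous and $j$-elliptic. Then for every initial value $u_0\in\overline{D(\varphi^H)}=\overline{j(D(\varphi))}$ (closures in $H$) the gradient system $$\begin{cases}\dot u+\partial_j\varphi(u)\ni 0 & \text{on }(0,\infty),\\ u(0)=u_0\end{cases}$$ admits a unique solution $u\in C(\mathbb{R}_+;H)\cap W^{1,\infty}_{loc}((0,\infty);H)$ satisfying the differential inclusion for almost every $t\in(0,\infty)$. In particular, $u(t)\in D(\partial_j\varphi)$ for almost every $t\in(0,\infty)$. Moreover, denoting by $u$ the unique solution corresponding to the initial value $u_0$, setting $S(\cdot)u_0:=u$ defines a strongly continuous semigroup $S=(S(t))_{t\ge 0}$ of nonlinear Lipschitz continuous mappings on $\overline{D(\varphi^H)}$.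
   Context: The effective domain of $\varphi$ is $D(\varphi)=\{\varphi<+\infty\}$; $\varphi$ is proper if $D(\varphi)\neq\emptyset$, and lower semicontinuous if all sublevels $\{\varphi\le c\}$, $c\in\mathbb{R}$, are closed in the topology of $V$. A functional on $V$ is coercive if all its sublevels are relatively weakly compact. For $\omega\in\mathbb{R}$ put $\varphi_\omega(\hat u)=\varphi(\hat u)+\frac{\omega}{2}\|j(\hat u)\|_H^2$. The functional $\varphi$ is $j$-elliptic if there exists $\omega\ge 0$ such that $\varphi_\omega$ is convex and coercive; a functional on $H$ is called elliptic if this holds with $V=H$, $j=I$. The $j$-subgradient of $\varphi$ is the relation $$\partial_j\varphi=\Big\{(u,f)\in H\times H \;:\; \exists\,\hat u\in D(\varphi)\text{ with } j(\hat u)=u \text{ and, for every }\hat v\in V,\ \liminf_{t\searrow 0}\frac{\varphi(\hat u+t\hat v)-\varphi(\hat u)}{t}\ge\langle f,j(\hat v)\rangle_H\Big\},$$ with $\partial_j\varphi(u)=\{f:(u,f)\in\partial_j\varphi\}$ and $D(\partial_j\varphi)=\{u\in H:\partial_j\varphi(u)\ne\emptyset\}$. For a functional $\psi$ on $H$, $\partial\psi$ denotes its classical subgradient ($V=H$, $j=I$). $\varphi^H:H\to\mathbb{R}\cup\{+\infty\}$ denotes a proper, lower semicontinuous, elliptic functional with $\partial_j\varphi=\partial\varphi^H$ (such a functional exists). A strongly continuous semigroup on a set $C\subseteq H$ is a family of maps $S(t):C\to C$ with $S(0)=I$, $S(t+s)=S(t)S(s)$ and $t\mapsto S(t)u$ continuous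 on $[0,\infty)$ for each $u\in C$. *)

(* Defs.v *)
From HB Require Import structures.
From mathcomp Require Import all_boot all_order all_algebra sesquilinear.
From mathcomp Require Import all_classical all_reals all_analysis.

Set Implicit Arguments.
Unset Strict Implicit.
Unset Printing Implicit Defensive.

Import Order.TTheory GRing.Theory Num.Theory.
Import numFieldNormedType.Exports.

Local Open Scope classical_set_scope.
Local Open Scope ring_scope.

HB.mixin Record CompleteNormedModule_isHilbert (R : realType) H
    & CompleteNormedModule R H := {
  inner : {dot H for idfun};
  inner_norm : forall x : H, inner x x = `|x| ^+ 2
}.

#[short(type="hilbertType")]
HB.structure Definition Hilbert (R : realType) :=
  {H of CompleteNormedModule R H & CompleteNormedModule_isHilbert R H}.

Definition dotp (R : realType) (H : hilbertType R) (x y : H) : R :=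
  @inner R H x y.

Definition topdual (R : realType) (E : tvsType R) :=
  {f : {linear E -> R^o} | continuous f}.

(* E with its weak topology sigma(E, E'). *)
Definition weak (R : realType) (E : tvsType R) : Type :=
  sup_topology (fun f : topdual E =>
    Topological.on (initial_topology (sval f : E -> R^o))).

HB.instance Definition _ (R : realType) (E : tvsType R) :=
  Topological.on (weak E).

Definition effdom (R : realType) (V : Type) (phi : V -> \bar R) : set V :=
  [set v | (phi v < +oo)%E].

(* The codomain of phi is R u {+oo}: the value -oo is excluded. *)
Definition proper_fun (R : realType) (V : Type) (phi : V -> \bar R) :=
  (forall v, phi v != -oo%E) /\ effdom phi !=set0.

Definition coercive (R : realType) (V : tvsType R) (phi : V -> \bar R) :=
  forall c : R, precompact ([set v | (phi v <= c%:E)%E] : set (weak V)).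

(* The library's [convex_function] is for real-valued functions only. The
   weights are taken in ]0, 1[ so that no product 0 * +oo occurs. *)
Definition econvex (R : realType) (V : lmodType R) (phi : V -> \bar R) :=
  forall (u v : V) (t : R), 0 < t < 1 ->
    (phi (t *: u + (1 - t) *: v)%R <= t%:E * phi u + (1 - t)%:E * phi v)%E.

Definition jshift (R : realType) (V : Type) (H : hilbertType R)
    (j : V -> H) (phi : V -> \bar R) (w : R) (v : V) : \bar R :=
  (phi v + (w / 2 * `|j v| ^+ 2)%:E)%E.

Definition jelliptic (R : realType) (V : tvsType R) (H : hilbertType R)
    (j : V -> H) (phi : V -> \bar R) :=
  exists w : R, [/\ 0 <= w, econvex (jshift j phi w) & coercive (jshift j phi w)].

Definition elliptic (R : realType) (H : hilbertType R) (psi : H -> \bar R) :=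
  jelliptic (idfun : H -> H) psi.

(* [jsubgradient j phi u] is the set of all f with (u, f) in the relation. *)
Definition jsubgradient (R : realType) (V : lmodType R) (H : hilbertType R)
    (j : V -> H) (phi : V -> \bar R) (u : H) : set H :=
  [set f | exists2 u' : V, effdom phi u' & j u' = u /\
    forall v : V,
      ((dotp f (j v))%:E <=
       limf_einf (fun t : R => (phi (u' + t *: v)%R - phi u') * (t^-1)%:E)
                 (0%R : R)^'+)%E].

Definition subgradient (R : realType) (H : hilbertType R) (psi : H -> \bar R) :=
  jsubgradient (idfun : H -> H) psi.

Definition reldom (T U : Type) (A : T -> set U) : set T :=
  [set u | A u !=set0].

Section sobolev.
Context {R : realType} {H : hilbertType R}.
Notation mu := (@lebesgue_measure R).

(* Bochner measurability on ]0, +oo[ *)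
Definition strongly_measurable (g : R -> H) :=
  exists s : nat -> R -> H,
    (forall n, finite_set (range (s n)) /\
               forall y, measurable (s n @^-1` [set y])) /\
    {ae mu, forall t, 0 < t -> s n t @[n --> \oo] --> g t}.

(* L^oo_loc(]0, +oo[; H) *)
Definition Loo_loc (g : R -> H) :=
  strongly_measurable g /\
  forall a b : R, 0 < a -> a <= b ->
    exists M : R, {ae mu, forall t, a <= t <= b -> `|g t| <= M}.

(* C_c^oo(]0, +oo[) *)
Definition test_function (eta : R -> R) :=
  (forall n t, derivable (derive1n n eta) t 1) /\
  exists a b : R, 0 < a /\ forall t, eta t != 0 -> a <= t <= b.

(* The identity int u eta' = - int g eta between Bochner integrals in H,
   paired with an arbitrary vector h of H. *)
Definition weak_derivative (u g : R -> H) :=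
  forall (eta : R -> R) (h : H), test_function eta ->
    \int[mu]_(t in `]0, +oo[) (dotp (u t) h * derive1 eta t) =
    - \int[mu]_(t in `]0, +oo[) (dotp (g t) h * eta t).

(* u is in W^{1,oo}_loc(]0, +oo[; H) and g represents its derivative. *)
Definition W1oo_loc (u g : R -> H) :=
  [/\ Loo_loc u, Loo_loc g & weak_derivative u g].

End sobolev.

(* Only the values of u on [0, +oo[ are relevant. *)
Definition gradient_solution (R : realType) (V : lmodType R)
    (H : hilbertType R) (j : V -> H) (phi : V -> \bar R) (u0 : H)
    (u : R -> H) :=
  [/\ {within `[0, +oo[, continuous u}, u 0 = u0 &
      exists2 du : R -> H, W1oo_loc u du &
        {ae (@lebesgue_measure R), forall t, 0 < t ->
          [set du t + f | f in jsubgradient j phi (u t)] 0}].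

Definition sc_semigroup (R : realType) (H : hilbertType R) (C : set H)
    (S : R -> H -> H) :=
  [/\ forall t u, 0 <= t -> C u -> C (S t u),
      forall u, C u -> S 0 u = u,
      forall t s u, 0 <= t -> 0 <= s -> C u -> S (t + s) u = S t (S s u) &
      forall u, C u -> {within `[0, +oo[, continuous (S ^~ u)}].

(* Main.v *)
(** The [j]-subgradient [A] is reduced to an operator on [H] with two properties:
    a potential [psi] satisfies the semiconvex subgradient inequality
    [psi x + <f, y - x> - w/2 |y - x|^2 <= psi y] along [A], and [I + l A] is onto
    for small [l]. Surjectivity is a minimisation of
    [phi v + |j v - y|^2 / (2 l)] over [V]: by Hahn-Banach its sublevels are
    weakly closed, and by ellipticity relatively weakly compact.
    The implicit Euler scheme for [A] then converges (Kobayashi) to a semigroup.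
    On [D(A)] its right derivative is minus the minimal section [A0], which is
    right-continuous along orbits. The potential yields an energy estimate that
    bounds [t |A0 (u t)|] independently of [A0 (u 0)], so orbits starting in
    the closure of [D(A)] enter [D(A)] immediately. Right-continuous bounded right derivatives
    are weak derivatives, whence existence. For uniqueness an arbitrary solution
    [v] is compared with the orbit [u]: [exp(-2 w t) |v - u|^2] has a nonpositive
    upper right Dini derivative. *)

Require Import Defs.
From HB Require Import structures.
From mathcomp Require Import all_boot all_order all_algebra sesquilinear.
From mathcomp Require Import all_classical all_reals all_analysis.
From mathcomp Require Import measurable_realfun ssrAC ring lra.

Set Implicit Arguments.
Unset Strict Implicit.
Unset Printing Implicit Defensive.

Import Order.TTheory GRing.Theory Num.Theory.
Import numFieldNormedType.Exports.

Local Open Scope classical_set_scope.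
Local Open Scope ring_scope.

(** * Geometry of Hilbert spaces *)

Section norm_closure.
Context {R : realType} {H : normedModType R}.

Lemma closure_normP (D : set H) x :
  closure D x <-> forall e, 0 < e -> exists2 y, D y & `|x - y| < e.
Proof.
split=> [xD e e0|xD B].
  have [y [Dy]] := xD _ (nbhsx_ballx x e e0).
  by rewrite -ball_normE/=; exists y.
rewrite -nbhs_ballE => -[e/= e0 xB]; have [y Dy xy] := xD _ e0.
by exists y; split=> //; apply: xB; rewrite -ball_normE.
Qed.

Lemma ler_dist3 (a b c d : H) : `|a - d| <= `|a - b| + `|b - c| + `|c - d|.
Proof.
by apply: le_trans (ler_distD c _ _) _; rewrite lerD2r; exact: ler_distD.
Qed.

Lemma cvg_sqnorm {I : Type} {F : set_system I} {FF : Filter F} (f : I -> H) a :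
  f @ F --> a -> `|f i| ^+ 2 @[i --> F] --> `|a| ^+ 2.
Proof.
move=> fa; have nf : `|f i| @[i --> F] --> `|a| by exact: cvg_norm.
exact: (cvgM nf nf).
Qed.

End norm_closure.

Section inner_product.
Context {R : realType} {H : hilbertType R}.
Implicit Types x y z : H.

Lemma dotpC x y : dotp x y = dotp y x.
Proof. by rewrite /dotp hermC/= expr0 mul1r. Qed.

Lemma dotpDl x y z : dotp (x + y) z = dotp x z + dotp y z.
Proof. by rewrite /dotp linearDl. Qed.

Lemma dotpNl x z : dotp (- x) z = - dotp x z.
Proof. by rewrite /dotp linearNl. Qed.

Lemma dotpZl a x z : dotp (a *: x) z = a * dotp x z.
Proof. by rewrite /dotp linearZl_LR. Qed.

Lemma dotpDr x y z : dotp z (x + y) = dotp z x + dotp z y.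
Proof. by rewrite dotpC dotpDl !(dotpC z). Qed.

Lemma dotpNr x z : dotp z (- x) = - dotp z x.
Proof. by rewrite dotpC dotpNl !(dotpC z). Qed.

Lemma dotpZr a x z : dotp z (a *: x) = a * dotp z x.
Proof. by rewrite dotpC dotpZl !(dotpC z). Qed.

Lemma dotp0l x : dotp 0 x = 0.
Proof. by rewrite -(scale0r 0) dotpZl mul0r. Qed.

Lemma dotp0r x : dotp x 0 = 0.
Proof. by rewrite dotpC dotp0l. Qed.

Definition dotpE :=
  (dotpDl, dotpDr, dotpNl, dotpNr, dotpZl, dotpZr, dotp0l, dotp0r).

Lemma dotpp x : dotp x x = `|x| ^+ 2.
Proof. exact: inner_norm. Qed.

Lemma sqnormD x y : `|x + y| ^+ 2 = `|x| ^+ 2 + 2 * dotp x y + `|y| ^+ 2.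
Proof. by rewrite -!dotpp !dotpE (dotpC y x); ring. Qed.

Lemma sqnormB x y : `|x - y| ^+ 2 = `|x| ^+ 2 - 2 * dotp x y + `|y| ^+ 2.
Proof. by rewrite sqnormD normrN dotpNr; ring. Qed.

Lemma dotp_le x y : dotp x y <= `|x| * `|y|.
Proof.
have [->|x0] := eqVneq x 0; first by rewrite dotp0l normr0 mul0r.
have [->|y0] := eqVneq y 0; first by rewrite dotp0r normr0 mulr0.
have xy : 0 < `|x| * `|y| by rewrite mulr_gt0// normr_gt0.
have := sqr_ge0 `| (`|y| *: x - `|x| *: y)|.
rewrite sqnormB !normrZ !normr_id !dotpE => h.
by rewrite -(ler_pM2l xy); nra.
Qed.

Lemma dotp_norm x y : `|dotp x y| <= `|x| * `|y|.
Proof. by rewrite ler_norml dotp_le andbT lerNl -dotpNl -(normrN x) dotp_le. Qed.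

Lemma ler_norm_sqr x (c : R) : 0 <= c -> `|x| ^+ 2 <= c ^+ 2 -> `|x| <= c.
Proof. by move=> c0; rewrite ler_sqr ?nnegrE. Qed.

Lemma dotpl_continuous y : continuous (fun x => dotp x y).
Proof.
move=> x; apply/cvgrPdist_le => e e0.
near=> z; rewrite -dotpNl -dotpDl (le_trans (dotp_norm _ _))//.
apply: (@le_trans _ _ ((e / (`|y| + 1)) * (`|y| + 1))); last first.
  by rewrite divfK// lt0r_neq0// ltr_wpDl.
rewrite ler_pM// ?lerDl//.
near: z; apply: cvgr_dist_le; first exact: cvg_id.
by rewrite divr_gt0// ltr_wpDl.
Unshelve. all: by end_near. Qed.

End inner_product.

(** * The semigroup of a semiconvex gradient operator *)

Section exponential_bounds.
Context {R : realType}.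
Implicit Types x : R.

Lemma inv_onem_le_expR x : 0 <= x -> x <= 1 / 2 -> (1 - x)^-1 <= expR (2 * x).
Proof.
move=> x0 x2; rewrite -[leLHS]div1r ler_pdivrMr; last by lra.
by have := expR_ge1Dx (2 * x); nra.
Qed.

Lemma inv_onem_exp_le x n (c : R) : 0 <= x -> x <= 1 / 2 -> 2 * x * n%:R <= c ->
  (1 - x)^-1 ^+ n <= expR c.
Proof.
move=> x0 x2 h; apply: (@le_trans _ _ (expR (2 * x) ^+ n)).
  by rewrite lerXn2r ?nnegrE ?expR_ge0 ?invr_ge0 ?inv_onem_le_expR//; lra.
by rewrite -expRM_natr ler_expR.
Qed.

End exponential_bounds.

Section time_grid.
Context {R : realType}.
Implicit Types t d : R.

Definition grid_step n : R := n.+1%:R^-1.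
Definition grid_index t n := Num.truncn (t * n.+1%:R).
Local Notation h := grid_step.
Local Notation k := grid_index.

Lemma grid_approx t n : 0 <= t ->
  [/\ 0 < h n, (k t n)%:R * h n <= t & `|(k t n)%:R * h n - t| <= h n].
Proof.
move=> t0; have n0 : 0 < n.+1%:R :> R by rewrite ltr0n.
have tn : 0 <= t * n.+1%:R by rewrite mulr_ge0// ltW.
have /andP[k1 k2] := truncn_itv tn.
have h0 : 0 < h n by rewrite invr_gt0.
have le1 : (k t n)%:R * h n <= t by rewrite /h ler_pdivrMr.
split=> //; rewrite ler_norml; apply/andP; split; last by lra.
have : t < (k t n).+1%:R * h n by rewrite /h ltr_pdivlMr.
by rewrite -natr1; lra.
Qed.

Lemma grid_step_lt d : 0 < d -> \forall n \near \oo, h n < d.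
Proof.
move=> d0; have /cvgrPdist_lt/(_ _ d0) := @cvg_harmonic R.
apply: filterS => n /=.
by rewrite sub0r normrN ger0_norm// /harmonic/= invr_ge0.
Qed.

End time_grid.

Section gradient_flow.
Context {R : realType} {H : hilbertType R}.
Variables (A : H -> set H) (psi : H -> R) (w : R).
Hypothesis w_ge0 : 0 <= w.
Hypothesis subgradP : forall x f y g, A x f -> A y g ->
  psi x + dotp f (y - x) - w / 2 * `|y - x| ^+ 2 <= psi y.
Hypothesis range_condition : forall l : R, 0 < l -> l * w < 1 ->
  forall y, exists x, A x (l^-1 *: (y - x)).

Lemma quasi_monotone x f y g : A x f -> A y g ->
  - (w * `|x - y| ^+ 2) <= dotp (f - g) (x - y).
Proof.
move=> xf yg; have := subgradP xf yg; have := subgradP yg xf.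
rewrite -(opprB x y) normrN !dotpE.
by lra.
Qed.

Definition resolvent (l : R) y : H := xget 0 [set x | A x (l^-1 *: (y - x))].
Local Notation J := resolvent.

Lemma resolventP l y : 0 < l -> l * w < 1 -> A (J l y) (l^-1 *: (y - J l y)).
Proof.
move=> l0 lw; have [x xP] := range_condition l0 lw y.
exact: (xgetPex 0 (ex_intro [set x | A x (l^-1 *: (y - x))] x xP)).
Qed.

Lemma resolvent_two_steps x f y g (l m : R) : 0 < l -> 0 < m -> A x f -> A y g ->
  (l + m - 2 * (l * m * w)) * `|x - y| ^+ 2 <=
    m * `|x + l *: f - y| ^+ 2 + l * `|x - (y + m *: g)| ^+ 2.
Proof.
move=> l0 m0 xf yg; have := quasi_monotone xf yg.
have -> : x + l *: f - y = (x - y) + l *: f by rewrite addrAC.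
have -> : x - (y + m *: g) = (x - y) - m *: g by rewrite opprD addrA.
set u := x - y; rewrite sqnormD sqnormB !normrZ !dotpZr dotpDl dotpNl.
rewrite !(dotpC u) !exprMn.
rewrite !(gtr0_norm l0, gtr0_norm m0) => h.
have lm0 : 0 < l * m by rewrite mulr_gt0.
have := ler_wpM2l (ltW lm0) h.
have : 0 <= m * (l ^+ 2 * `|f| ^+ 2) by rewrite !mulr_ge0 ?sqr_ge0// ltW.
have : 0 <= l * (m ^+ 2 * `|g| ^+ 2) by rewrite !mulr_ge0 ?sqr_ge0// ltW.
set d := `|u| ^+ 2; set F := `|f| ^+ 2; set G := `|g| ^+ 2.
by nra.
Qed.

Lemma resolvent_le x f y g l : 0 < l -> A x f -> A y g ->
  (1 - l * w) * `|x - y| <= `|(x + l *: f) - (y + l *: g)|.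
Proof.
move=> l0 xf yg; have := quasi_monotone xf yg => h.
have -> : x + l *: f - (y + l *: g) = (x - y) + l *: (f - g).
  by rewrite opprD addrACA scalerBr.
have [->|xy0] := eqVneq (x - y) 0; first by rewrite normr0 mulr0.
have p0 : 0 < `|x - y| by rewrite normr_gt0.
rewrite -(ler_pM2r p0).
apply: le_trans (dotp_le _ _); rewrite dotpDl dotpZl dotpp.
by nra.
Qed.

Lemma resolvent_lipschitz l x y : 0 < l -> l * w < 1 ->
  `|J l x - J l y| <= (1 - l * w)^-1 * `|x - y|.
Proof.
move=> l0 lw; have := resolvent_le l0 (resolventP x l0 lw) (resolventP y l0 lw).
rewrite !scalerA !mulfV ?lt0r_neq0// !scale1r !(addrC (J _ _)) !subrK => h.
by rewrite -[leRHS]mulrC ler_pdivlMr ?subr_gt0// mulrC.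
Qed.

Lemma resolvent_id x f l : 0 < l -> l * w < 1 -> A x f -> J l (x + l *: f) = x.
Proof.
move=> l0 lw xf; apply/eqP; rewrite -subr_eq0 -normr_le0.
have := resolvent_le l0 (resolventP (x + l *: f) l0 lw) xf.
rewrite scalerA mulfV ?lt0r_neq0// scale1r [_ + (_ - _)]addrC subrK subrr normr0.
by rewrite pmulr_rle0// subr_gt0.
Qed.

Local Notation E l k := (iter k (J l)).

Lemma euler_lipschitz l k x y : 0 < l -> l * w < 1 ->
  `|E l k x - E l k y| <= (1 - l * w)^-1 ^+ k * `|x - y|.
Proof.
move=> l0 lw; elim: k => [|k IH] /=; first by rewrite expr0 mul1r.
apply: le_trans (resolvent_lipschitz _ _ l0 lw) _.
by rewrite exprS -mulrA ler_pM2l// invr_gt0 subr_gt0.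
Qed.

Lemma resolvent_increment l x f : 0 < l -> l * w < 1 -> A x f ->
  `|J l x - x| <= (1 - l * w)^-1 * (l * `|f|).
Proof.
move=> l0 lw xf; rewrite -{2}(resolvent_id l0 lw xf).
apply: le_trans (resolvent_lipschitz _ _ l0 lw) _.
by rewrite opprD addrA subrr sub0r normrN normrZ gtr0_norm.
Qed.

Lemma euler_increment l k x f : 0 < l -> l * w < 1 -> A x f ->
  `|E l k.+1 x - E l k x| <= (1 - l * w)^-1 ^+ k.+1 * (l * `|f|).
Proof.
move=> l0 lw xf; rewrite iterSr.
apply: le_trans (euler_lipschitz k _ _ l0 lw) _.
rewrite exprSr -mulrA; apply: ler_wpM2l; last exact: resolvent_increment.
by rewrite exprn_ge0// invr_ge0 subr_ge0 ltW.
Qed.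

Lemma growth_le l k t : 0 < l -> l * w <= 1 / 2 -> k%:R * l <= t ->
  (1 - l * w)^-1 ^+ k <= expR (2 * w * t).
Proof.
move=> l0 lw kt; apply: inv_onem_exp_le => //; first by rewrite mulr_ge0// ltW.
have -> : 2 * (l * w) * k%:R = 2 * w * (k%:R * l) by ring.
by rewrite ler_wpM2l// mulr_ge0.
Qed.

Lemma euler_dist l k x f t : 0 < l -> l * w <= 1 / 2 -> A x f -> k%:R * l <= t ->
  `|E l k x - x| <= expR (2 * w * t) * (k%:R * l * `|f|).
Proof.
move=> l0 lw xf; have lw1 : l * w < 1 by lra.
elim: k => [|k IH] kt; first by rewrite /= subrr normr0 !mul0r mulr0.
have kt' : k%:R * l <= t by move: kt; rewrite -natr1; lra.
have -> : E l k.+1 x - x = (E l k.+1 x - E l k x) + (E l k x - x).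
  by rewrite addrA subrK.
apply: le_trans (ler_normD _ _) _.
have h := euler_increment k l0 lw1 xf.
have : (1 - l * w)^-1 ^+ k.+1 * (l * `|f|) <= expR (2 * w * t) * (l * `|f|).
  by rewrite ler_wpM2r ?mulr_ge0 ?(ltW l0)// growth_le.
have := IH kt'; rewrite -natr1.
by lra.
Qed.


Lemma resolvent_two_stepsJ u v (l m : R) : 0 < l -> 0 < m -> l * w < 1 -> m * w < 1 ->
  (l + m - 2 * (l * m * w)) * `|J l u - J m v| ^+ 2 <=
    m * `|u - J m v| ^+ 2 + l * `|J l u - v| ^+ 2.
Proof.
move=> l0 m0 lw mw.
have := resolvent_two_steps l0 m0 (resolventP u l0 lw) (resolventP v m0 mw).
by rewrite !scalerA !mulfV ?lt0r_neq0// !scale1r !(addrC (J _ _)) !subrK.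
Qed.

(* The bound solves the recurrence
   [(l + m) b i j = m b (i - 1) j + l b i (j - 1)] exactly; dividing by
   [1 - q] at each step accounts for the failure of monotonicity. *)
Lemma kobayashi_recurrence (l m : R) x f t i j : 0 < l -> 0 < m ->
  l * w <= 1 / 4 -> m * w <= 1 / 4 -> A x f -> i%:R * l <= t -> j%:R * m <= t ->
  `|E l i x - E m j x| ^+ 2 <=
    (expR (2 * w * t) * `|f|) ^+ 2 * (1 - 2 * (l * m * w) / (l + m))^-1 ^+ (i + j)
    * ((i%:R * l - j%:R * m) ^+ 2 + i%:R * l ^+ 2 + j%:R * m ^+ 2).
Proof.
move=> l0 m0 lw mw xf.
have lw1 : l * w <= 1 / 2 by lra.
have mw1 : m * w <= 1 / 2 by lra.
have lw2 : l * w < 1 by lra.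
have mw2 : m * w < 1 by lra.
have lm0 : 0 < l + m by rewrite addr_gt0.
set q := 2 * (l * m * w) / (l + m); set K := expR _ * _.
have qE : (l + m) * q = 2 * (l * m * w) by rewrite /q mulrC divfK ?lt0r_neq0.
have q0 : 0 <= q.
  by rewrite /q !mulr_ge0 ?invr_ge0// ltW.
have q1 : 0 < 1 - q.
  have : 2 * (l * m * w) < 1 * (l + m) by nra.
  by rewrite -ltr_pdivrMr// -/q subr_gt0.
have th1 n : 1 <= (1 - q)^-1 ^+ n.
  by rewrite exprn_ege1// invf_ge1//; lra.
have K0 : 0 <= K ^+ 2 by rewrite sqr_ge0.
have base (h : R) k : 0 < h -> h * w <= 1 / 2 -> k%:R * h <= t ->
    `|E h k x - x| ^+ 2 <=
    K ^+ 2 * (1 - q)^-1 ^+ k * ((k%:R * h) ^+ 2 + k%:R * h ^+ 2).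
  move=> h0 hw kt; have := euler_dist h0 hw xf kt => hh.
  have h1 : `|E h k x - x| ^+ 2 <= K ^+ 2 * (k%:R * h) ^+ 2.
    rewrite -exprMn ler_sqr ?nnegrE// /K; last by rewrite mulr_ge0 ?mulr_ge0 ?expR_ge0// ltW.
    by rewrite [_ * `|f| * _]mulrAC -[leRHS]mulrA.
  apply: le_trans h1 _; rewrite -[leRHS]mulrA ler_wpM2l//.
  have a0 : 0 <= (k%:R * h) ^+ 2 by rewrite sqr_ge0.
  have b0 : 0 <= k%:R * h ^+ 2 by rewrite mulr_ge0 ?sqr_ge0.
  by have := th1 k; nra.
elim: i j => [|i IHi] j.
  move=> _ jt; rewrite /= distrC; apply: le_trans (base m j m0 mw1 jt) _.
  by rewrite add0n mul0r mul0r sub0r sqrrN addr0.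
elim: j => [|j IHj].
  move=> it _; apply: le_trans (base l i.+1 l0 lw1 it) _.
  by rewrite addn0 mul0r subr0 mul0r addr0.
move=> it jt.
have it' : i%:R * l <= t by move: it; rewrite -natr1; lra.
have jt' : j%:R * m <= t by move: jt; rewrite -natr1; lra.
have h1 := IHi j.+1 it' jt; have h2 := IHj it jt'.
have h3 := resolvent_two_stepsJ (E l i x) (E m j x) l0 m0 lw2 mw2.
have hm := ler_wpM2l (ltW m0) h1; have hl := ler_wpM2l (ltW l0) h2.
have {h1 h2 hm hl}h3 := le_trans h3 (lerD hm hl).
move: h3; rewrite -[J l _]/(E l i.+1 x) -[J m _]/(E m j.+1 x).
have -> : (i + j.+1 = i + j + 1)%N by rewrite addn1 addnS.
have -> : (i.+1 + j = i + j + 1)%N by rewrite addn1 addSn.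
have -> : (i.+1 + j.+1 = i + j + 1 + 1)%N by rewrite !addn1 addSn addnS.
rewrite [_ ^+ (i + j + 1 + 1)]exprD expr1.
set th := _ ^+ (i + j + 1); set D := `| _ | ^+ 2; rewrite -!(natr1 i) -!(natr1 j) => h3.
rewrite -(ler_pM2l (mulr_gt0 lm0 q1)).
have -> : (l + m) * (1 - q) * D = (l + m - 2 * (l * m * w)) * D.
  by rewrite mulrBr qE mulr1.
apply: le_trans h3 _; rewrite [leRHS](_ : _ = (l + m) * (K ^+ 2 * th *
  (((i%:R + 1) * l - (j%:R + 1) * m) ^+ 2 + (i%:R + 1) * l ^+ 2 +
   (j%:R + 1) * m ^+ 2))); last by field; rewrite lt0r_neq0.
by rewrite le_eqVlt; apply/orP; left; apply/eqP; ring.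
Qed.

Lemma kobayashi (l m : R) x f t i j : 0 < l -> 0 < m ->
  l * w <= 1 / 4 -> m * w <= 1 / 4 -> A x f -> i%:R * l <= t -> j%:R * m <= t ->
  `|E l i x - E m j x| ^+ 2 <=
    (expR (4 * w * t) * `|f|) ^+ 2 * ((i%:R * l - j%:R * m) ^+ 2 + t * (l + m)).
Proof.
move=> l0 m0 lw mw xf it jt.
apply: le_trans (kobayashi_recurrence l0 m0 lw mw xf it jt) _.
have lm0 : 0 < l + m by rewrite addr_gt0.
set q := 2 * (l * m * w) / (l + m).
have qE : (l + m) * q = 2 * (l * m * w) by rewrite /q mulrC divfK ?lt0r_neq0.
have q0 : 0 <= q by rewrite /q !mulr_ge0 ?invr_ge0// ltW.
have q2 : q <= 1 / 2 by rewrite /q ler_pdivrMr//; nra.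
have hq : (1 - q)^-1 ^+ (i + j) <= expR (4 * w * t).
  apply: inv_onem_exp_le => //; rewrite -(ler_pM2l lm0).
  have -> : (l + m) * (2 * q * (i + j)%:R) =
      4 * w * (m * (i%:R * l) + l * (j%:R * m)).
    by transitivity (2 * ((l + m) * q) * (i + j)%:R); [ring|rewrite qE natrD; ring].
  have -> : (l + m) * (4 * w * t) = 4 * w * (m * t + l * t) by ring.
  by rewrite ler_wpM2l ?mulr_ge0// lerD// ler_pM2l.
have eE : expR (4 * w * t) = expR (2 * w * t) ^+ 2.
  by rewrite -expRM_natr; congr expR; ring.
have e0 := expR_ge0 (2 * w * t).
have b0 : 0 <= (i%:R * l - j%:R * m) ^+ 2 by rewrite sqr_ge0.
have il0 : 0 <= i%:R * l by rewrite mulr_ge0// ltW.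
have jm0 : 0 <= j%:R * m by rewrite mulr_ge0// ltW.
rewrite !exprMn eE -exprM; apply: ler_pM.
- by rewrite mulr_ge0 ?mulr_ge0 ?sqr_ge0 ?exprn_ge0// invr_ge0; lra.
- by rewrite !addr_ge0// mulr_ge0// sqr_ge0.
- rewrite mulrAC ler_wpM2r ?sqr_ge0//.
  have -> : expR (2 * w * t) ^+ (2 * 2) = expR (2 * w * t) ^+ 2 * expR (4 * w * t).
    by rewrite eE -exprD.
  by rewrite ler_wpM2l ?sqr_ge0.
- rewrite -addrA lerD2l mulrDr; nra.
Qed.

Local Notation h := grid_step.
Local Notation k := grid_index.
Local Notation D := (closure (reldom A)).
Local Notation step_bound := ((4 * (w + 1))^-1).

Lemma step_bound_gt0 : 0 < step_bound.
Proof. by rewrite invr_gt0 mulr_gt0// ltr_wpDl. Qed.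

Lemma lt_step_bound l : 0 < l -> l < step_bound -> l * w <= 1 / 4.
Proof.
move=> l0; rewrite -[ltRHS]mul1r ltr_pdivlMr; last by rewrite mulr_gt0// ltr_wpDl.
by move=> h; nra.
Qed.

Lemma euler_close x t e : D x -> 0 <= t -> 0 < e ->
  exists2 d, 0 < d & forall l m i j, 0 < l -> l < d -> 0 < m -> m < d ->
    `|i%:R * l - t| < d -> `|j%:R * m - t| < d -> `|E l i x - E m j x| < e.
Proof.
move=> xD t0 e0; set K := expR (2 * w * (t + 1)).
have K0 : 0 < K by rewrite expR_gt0.
have e4 : 0 < e / (4 * K) by rewrite divr_gt0// mulr_gt0.
have [y [f yf] xy] := (closure_normP _ _).1 xD _ e4.
set C := (expR (4 * w * (t + 1)) * `|f|) ^+ 2.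
have C0 : 0 <= C by rewrite sqr_ge0.
have den0 : 0 < (C + 1) * (2 * t + 6) by rewrite mulr_gt0 ?ltr_wpDl// mulr_ge0.
pose d := Num.min 1 (Num.min step_bound ((e / 2) ^+ 2 / ((C + 1) * (2 * t + 6)))).
have d0 : 0 < d.
  by rewrite !lt_min ltr01 step_bound_gt0 divr_gt0// exprn_gt0// divr_gt0.
exists d => // l m i j l0 ld m0 md it jt.
have d1 : d <= 1 by rewrite ge_min lexx.
have ds : d <= step_bound by rewrite !ge_min lexx !orbT.
have de : d <= (e / 2) ^+ 2 / ((C + 1) * (2 * t + 6)) by rewrite !ge_min lexx !orbT.
have lw := lt_step_bound l0 (lt_le_trans ld ds).
have mw := lt_step_bound m0 (lt_le_trans md ds).
have it1 : i%:R * l <= t + 1.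
  by move: it; rewrite ltr_norml => /andP[_]; lra.
have jt1 : j%:R * m <= t + 1.
  by move: jt; rewrite ltr_norml => /andP[_]; lra.
have h1 : `|E l i x - E l i y| < e / 4.
  apply: le_lt_trans (euler_lipschitz i _ _ l0 _) _; first by lra.
  apply: (@le_lt_trans _ _ (K * `|x - y|)).
    by rewrite ler_wpM2r// growth_le//; lra.
  by rewrite mulrC -ltr_pdivlMr// -mulrA -invfM.
have h2 : `|E m j x - E m j y| < e / 4.
  apply: le_lt_trans (euler_lipschitz j _ _ m0 _) _; first by lra.
  apply: (@le_lt_trans _ _ (K * `|x - y|)).
    by rewrite ler_wpM2r// growth_le//; lra.
  by rewrite mulrC -ltr_pdivlMr// -mulrA -invfM.
have h3 : `|E l i y - E m j y| < e / 2.
  have e2 : 0 <= e / 2 by rewrite divr_ge0// ltW.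
  rewrite -ltr_sqr ?nnegrE//.
  apply: le_lt_trans (kobayashi l0 m0 lw mw yf it1 jt1) _; rewrite -/C.
  have b1 : (i%:R * l - j%:R * m) ^+ 2 <= 4 * d.
    set a := _ - _.
    have : 0 <= (2 * d - a) * (2 * d + a).
      move: it jt; rewrite !ltr_norml /a => /andP[? ?] /andP[? ?].
      by rewrite mulr_ge0//; lra.
    by nra.
  have b2 : (t + 1) * (l + m) <= (t + 1) * (2 * d).
    by rewrite ler_wpM2l//; lra.
  apply: (@le_lt_trans _ _ (C * (d * (2 * t + 6)))).
    by apply: ler_wpM2l => //; lra.
  move: de; rewrite ler_pdivlMr// => de.
  apply: lt_le_trans de.
  have : 0 < d * (2 * t + 6) by rewrite mulr_gt0// ltr_wpDl// mulr_ge0.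
  by lra.
apply: le_lt_trans (ler_dist3 _ (E l i y) (E m j y) _) _.
by rewrite (distrC (E m j y)); lra.
Qed.

Definition flow (t : R) x : H := limn (fun n => E (h n) (k t n) x).
Local Notation T := flow.

Lemma flow_is_cvg t x : D x -> 0 <= t -> E (h n) (k t n) x @[n --> \oo] --> T t x.
Proof.
move=> xD t0; suff : cvgn (fun n => E (h n) (k t n) x) by [].
apply/cauchy_cvgP; apply: cauchy_exP => e e0.
have [d d0 hd] := euler_close xD t0 e0.
have [N _ NP] := grid_step_lt d0.
exists (E (h N) (k t N) x); exists N => // n /= Nn.
have [h0 _ ht] := grid_approx n t0; have [h0' _ ht'] := grid_approx N t0.
have hN := NP N (leqnn N); have hn := NP n Nn; rewrite /= in hN hn.
rewrite -ball_normE/=; apply: hd => //; first exact: le_lt_trans ht' _.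
exact: le_lt_trans ht _.
Qed.

Lemma flow_approx x t e : D x -> 0 <= t -> 0 < e ->
  exists2 d, 0 < d & forall l i, 0 < l -> l < d -> `|i%:R * l - t| < d ->
    `|E l i x - T t x| <= e.
Proof.
move=> xD t0 e0; have e2 : 0 < e / 2 by rewrite divr_gt0.
have [d d0 hd] := euler_close xD t0 e2.
exists d => // l i l0 ld it.
have /cvgrPdist_lt/(_ _ e2) nT := flow_is_cvg xD t0.
have [n [/= hn hT]] := filter_ex (filterI (grid_step_lt d0) nT).
have [h0 _ ht] := grid_approx n t0.
have := hd _ _ _ _ l0 ld h0 hn it (le_lt_trans ht hn).
move: hT; rewrite distrC => hT hE.
by apply: le_trans (ler_distD (E (h n) (k t n) x) _ _) _; lra.
Qed.

Lemma flow_pick (t d : R) : 0 <= t -> 0 < d ->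
  exists l i, [/\ 0 < l, l < d, i%:R * l <= t & `|i%:R * l - t| < d].
Proof.
move=> t0 d0; have [n /= hn] := filter_ex (grid_step_lt d0).
have [h0 ht1 ht] := grid_approx n t0.
by exists (h n), (k t n); split=> //; exact: le_lt_trans ht _.
Qed.

Lemma flow_lipschitz t x y : 0 <= t -> D x -> D y ->
  `|T t x - T t y| <= expR (2 * w * t) * `|x - y|.
Proof.
move=> t0 xD yD; apply/ler_addgt0Pr => e e0.
have e2 : 0 < e / 2 by rewrite divr_gt0.
have [d1 d10 h1] := flow_approx xD t0 e2.
have [d2 d20 h2] := flow_approx yD t0 e2.
have d0 : 0 < Num.min step_bound (Num.min d1 d2).
  by rewrite !lt_min step_bound_gt0 d10.
have [l [i [l0]]] := flow_pick t0 d0; rewrite !lt_min.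
move=> /and3P[ls ld1 ld2] it /and3P[_ it1 it2].
have lw := lt_step_bound l0 ls.
have {}h1 := h1 l i l0 ld1 it1; have {}h2 := h2 l i l0 ld2 it2.
have h3 : `|E l i x - E l i y| <= expR (2 * w * t) * `|x - y|.
  apply: le_trans (euler_lipschitz i _ _ l0 _) _; first by lra.
  by rewrite ler_wpM2r// growth_le//; lra.
apply: le_trans (ler_dist3 _ (E l i x) (E l i y) _) _.
by rewrite (distrC (T t x)); lra.
Qed.

Lemma euler_mem l i x : 0 < l -> l * w < 1 -> D x -> D (E l i x).
Proof.
move=> l0 lw xD; case: i => [//|i] /=; apply: subset_closure.
by exists (l^-1 *: (E l i x - J l (E l i x))); exact: resolventP.
Qed.

Lemma flow_mem t x : 0 <= t -> D x -> D (T t x).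
Proof.
move=> t0 xD; rewrite (closure_id D).1; last exact: closed_closure.
apply/closure_normP => e e0; have e2 : 0 < e / 2 by rewrite divr_gt0.
have [d d0 h1] := flow_approx xD t0 e2.
have d10 : 0 < Num.min step_bound d by rewrite !lt_min step_bound_gt0 d0.
have [l [i [l0]]] := flow_pick t0 d10; rewrite !lt_min.
move=> /andP[ls ld] it /andP[_ it1]; have lw := lt_step_bound l0 ls.
exists (E l i x); first by apply: euler_mem => //; lra.
by rewrite distrC; have := h1 l i l0 ld it1; lra.
Qed.

Lemma flow0 x : D x -> T 0 x = x.
Proof.
move=> xD; apply/eqP; rewrite -subr_eq0 -normr_le0; apply/ler_addgt0Pr => e e0.
have [d d0 h1] := flow_approx xD (lexx 0) e0.
have := h1 (d / 2) 0%N; rewrite mul0r subrr normr0 /= distrC add0r.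
by apply=> //; lra.
Qed.

Lemma flow_add t s x : 0 <= t -> 0 <= s -> D x -> T (t + s) x = T t (T s x).
Proof.
move=> t0 s0 xD; apply/eqP; rewrite -subr_eq0 -normr_le0; apply/ler_addgt0Pr => e e0.
rewrite add0r; have e2 : 0 < e / 4 by rewrite divr_gt0.
have K0 : 0 < expR (2 * w * t) by exact: expR_gt0.
have eK : 0 < e / 4 / expR (2 * w * t) by rewrite divr_gt0.
have ts0 : 0 <= t + s by rewrite addr_ge0.
have [d1 d10 h1] := flow_approx xD ts0 e2.
have [d2 d20 h2] := flow_approx xD s0 eK.
have [d3 d30 h3] := flow_approx (flow_mem s0 xD) t0 e2.
pose d := Num.min step_bound (Num.min (d1 / 2) (Num.min d2 d3)).
have d0 : 0 < d by rewrite !lt_min step_bound_gt0 d20 d30 divr_gt0.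
have [n /= hn] := filter_ex (grid_step_lt d0).
have [hn0 ht1 ht] := grid_approx n t0; have [_ hs1 hs] := grid_approx n s0.
have := hn; rewrite !lt_min => /and4P[hns hn1 hn2 hn3].
have lw := lt_step_bound hn0 hns.
have {}h1 : `|E (h n) (k t n + k s n) x - T (t + s) x| <= e / 4.
  apply: h1 => //; first by lra.
  have -> : (k t n + k s n)%:R * h n - (t + s) =
    ((k t n)%:R * h n - t) + ((k s n)%:R * h n - s) by rewrite natrD; ring.
  by apply: le_lt_trans (ler_normD _ _) _; lra.
have {}h2 : `|E (h n) (k s n) x - T s x| <= e / 4 / expR (2 * w * t).
  by apply: h2 => //; exact: le_lt_trans hs _.
have {}h3 : `|E (h n) (k t n) (T s x) - T t (T s x)| <= e / 4.
  by apply: h3 => //; exact: le_lt_trans ht _.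
have h4 : `|E (h n) (k t n + k s n) x - E (h n) (k t n) (T s x)| <= e / 4.
  rewrite iterD; apply: le_trans (euler_lipschitz _ _ _ hn0 _) _; first by lra.
  apply: (@le_trans _ _ (expR (2 * w * t) * (e / 4 / expR (2 * w * t)))).
    rewrite ler_pM ?exprn_ge0 ?invr_ge0 ?growth_le//; lra.
  by rewrite mulrC divfK// lt0r_neq0.
apply: le_trans (ler_dist3 _ (E (h n) (k t n + k s n) x)
  (E (h n) (k t n) (T s x)) _) _.
by rewrite (distrC (T (t + s) x)); lra.
Qed.

Lemma flow_time x f t s b : A x f -> 0 <= t <= b -> 0 <= s <= b ->
  `|T t x - T s x| <= expR (4 * w * b) * `|f| * `|t - s|.
Proof.
move=> xf /andP[t0 tb] /andP[s0 sb].
have xD : D x by apply: subset_closure; exists f.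
set K := expR _ * _; have K0 : 0 <= K by rewrite mulr_ge0 ?expR_ge0.
have b0 : 0 <= b by exact: le_trans tb.
apply/ler_addgt0Pr => e e0; have e4 : 0 < e / 4 by rewrite divr_gt0.
pose q := e / (2 * (K + 1)).
have q0 : 0 < q by rewrite divr_gt0// mulr_gt0// ltr_wpDl.
have qK : K * q <= e / 2.
  rewrite /q mulrA ler_pdivrMr ?mulr_gt0 ?ltr_wpDl//.
  by nra.
have [d1 d10 h1] := flow_approx xD t0 e4.
have [d2 d20 h2] := flow_approx xD s0 e4.
pose d3 := q ^+ 2 / (4 * (b + 1)).
have d30 : 0 < d3 by rewrite divr_gt0 ?exprn_gt0// mulr_gt0// ltr_wpDl.
pose d := Num.min step_bound (Num.min d1 (Num.min d2 (Num.min (q / 4) d3))).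
have d0 : 0 < d by rewrite !lt_min step_bound_gt0 d10 d20 d30 divr_gt0.
have [n /= hn] := filter_ex (grid_step_lt d0).
have [hn0 ht1 ht] := grid_approx n t0; have [_ hs1 hs] := grid_approx n s0.
have := hn; rewrite !lt_min => /and5P[hns hn1 hn2 hnq hn3].
have lw := lt_step_bound hn0 hns.
have {}h1 := h1 _ _ hn0 hn1 (le_lt_trans ht hn1).
have {}h2 := h2 _ _ hn0 hn2 (le_lt_trans hs hn2).
have h3 : `|E (h n) (k t n) x - E (h n) (k s n) x| <= K * (`|t - s| + q).
  have := kobayashi hn0 hn0 lw lw xf (le_trans ht1 tb) (le_trans hs1 sb).
  rewrite -/K => hk; apply: ler_norm_sqr.
    by rewrite mulr_ge0// addr_ge0// ltW.
  apply: le_trans hk _; rewrite [leRHS]exprMn ler_wpM2l ?sqr_ge0//.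
  set a := (k t n)%:R * h n - (k s n)%:R * h n.
  have ha : `|a| <= `|t - s| + q / 2.
    have -> : a = (t - s) + (((k t n)%:R * h n - t) - ((k s n)%:R * h n - s)).
      by rewrite /a; ring.
    apply: le_trans (ler_normD _ _) _; rewrite lerD2l.
    by apply: le_trans (ler_normB _ _) _; lra.
  have ha2 : a ^+ 2 <= (`|t - s| + q / 2) ^+ 2.
    by rewrite -[a ^+ 2]real_normK ?num_real// ler_sqr ?nnegrE// addr_ge0// divr_ge0// ltW.
  have hb : b * (h n + h n) <= q ^+ 2 / 2.
    move: hn3; rewrite /d3 ltr_pdivlMr; last by rewrite mulr_gt0// ltr_wpDl.
    by nra.
  have n0 := normr_ge0 (t - s).
  by nra.
apply: le_trans (ler_dist3 _ (E (h n) (k t n) x) (E (h n) (k s n) x) _) _.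
rewrite (distrC (T t x)).
by nra.
Qed.

(* The Yosida regularisation, at the point [y] itself, of the monotone operator
   [A + w (id - y)]. *)
Definition yosida (r : R) y : H := r^-1 *: (y - J (r / (1 + r * w)) y).
Local Notation P := yosida.

Lemma yosidaP r y : 0 < r -> A (y - r *: P r y) ((1 + r * w) *: P r y).
Proof.
move=> r0; have d0 : 0 < 1 + r * w by rewrite ltr_pwDl// mulr_ge0// ltW.
have l0 : 0 < r / (1 + r * w) by rewrite divr_gt0.
have lw : r / (1 + r * w) * w < 1 by rewrite mulrAC ltr_pdivrMr// mul1r ltrDr.
have := resolventP y l0 lw.
rewrite /yosida !scalerA mulfV ?lt0r_neq0// scale1r subKr.
by rewrite invf_div.
Qed.

Lemma yosida_le_dotp r y f : 0 < r -> A y f -> `|P r y| ^+ 2 <= dotp f (P r y).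
Proof.
move=> r0 yf; have := quasi_monotone yf (yosidaP y r0).
move: (P r y) => p; rewrite subKr normrZ gtr0_norm// exprMn.
rewrite dotpDl dotpNl dotpZl !dotpZr dotpp => h.
by rewrite -(ler_pM2l r0); nra.
Qed.

Lemma yosida_le r y f : 0 < r -> A y f -> `|P r y| <= `|f|.
Proof.
move=> r0 yf; have [->|p0] := eqVneq (P r y) 0; first by rewrite normr0.
have pp : 0 < `|P r y| by rewrite normr_gt0.
rewrite -(ler_pM2r pp) -expr2.
exact: le_trans (yosida_le_dotp r0 yf) (dotp_le _ _).
Qed.

Lemma yosida_dist r s y : 0 < s -> s <= r ->
  `|P s y - P r y| ^+ 2 <= `|P s y| ^+ 2 - `|P r y| ^+ 2.
Proof.
move=> s0 sr; have r0 : 0 < r by exact: lt_le_trans sr.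
have [->|sr'] := eqVneq s r; first by rewrite !subrr normr0 expr0n.
have lsr : 0 < r - s by rewrite subr_gt0 lt_neqAle sr' sr.
have := quasi_monotone (yosidaP y s0) (yosidaP y r0).
have := sqr_ge0 `|P s y - P r y|.
move: (P s y) (P r y) => p q.
have -> : y - s *: p - (y - r *: q) = r *: q - s *: p.
  by rewrite opprB addrC addrA subrK.
rewrite !sqnormB !normrZ (gtr0_norm s0) (gtr0_norm r0) !exprMn.
rewrite !dotpE !dotpp (dotpC q p) => hc h.
rewrite -(ler_pM2l lsr).
by nra.
Qed.

Lemma yosida_lipschitz r y z : 0 < r ->
  `|P r y - P r z| <= r^-1 * (2 + r * w) * `|y - z|.
Proof.
move=> r0; have d0 : 0 < 1 + r * w by rewrite ltr_pwDl// mulr_ge0// ltW.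
have l0 : 0 < r / (1 + r * w) by rewrite divr_gt0.
have lw : r / (1 + r * w) * w < 1 by rewrite mulrAC ltr_pdivrMr// mul1r ltrDr.
have := resolvent_lipschitz y z l0 lw.
have -> : (1 - r / (1 + r * w) * w)^-1 = 1 + r * w.
  by rewrite -[RHS]invrK; congr (_^-1); field; rewrite lt0r_neq0.
move=> h; rewrite /yosida -scalerBr normrZ gtr0_norm ?invr_gt0// -mulrA.
rewrite ler_pM2l ?invr_gt0//.
have -> : y - J (r / (1 + r * w)) y - (z - J (r / (1 + r * w)) z) =
    (y - z) - (J (r / (1 + r * w)) y - J (r / (1 + r * w)) z).
  by rewrite !opprB addrACA [in RHS]addrACA; congr (_ + _); exact: addrC.
by apply: le_trans (ler_normB _ _) _; lra.
Qed.

Lemma graph_closed x f :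
  (forall e, 0 < e -> exists z g, [/\ A z g, `|z - x| <= e & `|g - f| <= e]) ->
  A x f.
Proof.
move=> xf; set l := step_bound; have l0 : 0 < l by exact: step_bound_gt0.
have lw : l * w <= 1 / 4.
  rewrite /l mulrC ler_pdivrMr; last by rewrite mulr_gt0// ltr_wpDl.
  by lra.
have lw1 : l * w < 1 by lra.
have rP := resolventP (x + l *: f) l0 lw1.
have Jx : J l (x + l *: f) = x.
  apply/eqP; rewrite -subr_eq0 -normr_le0; apply/ler_addgt0Pr => e e0.
  have q0 : 0 < e / (2 * l + 3) by rewrite divr_gt0// ltr_wpDl// mulr_ge0// ltW.
  have [z [g [zg zx gf]]] := xf _ q0.
  have := resolvent_le l0 rP zg.
  rewrite scalerA mulfV ?lt0r_neq0// scale1r [_ + (_ - _)]addrC subrK => hr.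
  have hr2 : `|x + l *: f - (z + l *: g)| <= (1 + l) * (e / (2 * l + 3)).
    rewrite [X in `|X|](_ : _ = (x - z) + l *: (f - g)); last first.
      by rewrite scalerBr opprD addrACA.
    apply: le_trans (ler_normD _ _) _.
    rewrite normrZ gtr0_norm// mulrDl mul1r distrC lerD// ler_pM2l//.
    by rewrite distrC.
  have hq : e / (2 * l + 3) * (2 * l + 3) = e.
    by rewrite divfK// lt0r_neq0// ltr_wpDl// mulr_ge0// ltW.
  apply: le_trans (ler_distD z _ _) _; rewrite add0r.
  have n0 := normr_ge0 (J l (x + l *: f) - z).
  by nra.
by move: rP; rewrite Jx addrC addKr scalerA mulVf ?lt0r_neq0// scale1r.
Qed.

Definition minsec y : H := limn (fun n => P (h n) y).
Local Notation A0 := minsec.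

Lemma grid_step_gt0 n : 0 < h n :> R.
Proof. by rewrite /grid_step invr_gt0. Qed.

Lemma yosida_is_cvg y (K : R) : (forall r, 0 < r -> `|P r y| <= K) ->
  P (h n) y @[n --> \oo] --> A0 y.
Proof.
move=> PK; suff : cvgn (fun n => P (h n) y) by [].
pose a n := `|P (h n) y| ^+ 2.
have hle m n : (m <= n)%N -> h n <= h m :> R.
  by move=> mn; rewrite /grid_step lef_pV2 ?posrE// ler_nat.
have nda : nondecreasing_seq a.
  move=> m n mn; have := yosida_dist y (grid_step_gt0 n) (hle _ _ mn).
  by move/(le_trans (sqr_ge0 _)); rewrite subr_ge0.
have uba : has_ubound (range a).
  exists (K ^+ 2) => _ [n _ <-]; rewrite /a ler_sqr ?nnegrE ?PK ?grid_step_gt0//.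
  exact: le_trans (PK 1 ltr01).
have ca := nondecreasing_is_cvgn nda uba.
apply/cauchy_cvgP; apply: cauchy_exP => e e0.
have e20 : 0 < e ^+ 2 by rewrite exprn_gt0.
have /cvgrPdist_lt/(_ _ e20)[N _ NP] := ca.
exists (P (h N) y); exists N => // n /= Nn; rewrite -ball_normE/= distrC.
rewrite -ltr_sqr ?nnegrE ?(ltW e0)//.
apply: le_lt_trans (yosida_dist y (grid_step_gt0 n) (hle _ _ Nn)) _.
have := NP N (leqnn N); rewrite /= ltr_norml => /andP[_].
by have := nondecreasing_cvgn_le nda ca n; rewrite /a; lra.
Qed.

Lemma minsecP y (K : R) : (forall r, 0 < r -> `|P r y| <= K) ->
  [/\ A y (A0 y), `|A0 y| <= K &
      forall r, 0 < r -> `|P r y - A0 y| ^+ 2 <= `|A0 y| ^+ 2 - `|P r y| ^+ 2].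
Proof.
move=> PK; have cP := yosida_is_cvg PK.
have K0 : 0 <= K by exact: le_trans (PK 1 ltr01).
split.
- apply: graph_closed => e e0.
  have q0 : 0 < e / (2 * (K * w + K + 1)).
    by rewrite divr_gt0// mulr_gt0// ltr_wpDl// addr_ge0// mulr_ge0.
  have e2 : 0 < e / 2 by rewrite divr_gt0.
  have /cvgrPdist_lt/(_ _ e2) cP2 := cP.
  have [n [/= hn hP]] := filter_ex (filterI (grid_step_lt q0) cP2).
  have hn0 := grid_step_gt0 n.
  exists (y - h n *: P (h n) y), ((1 + h n * w) *: P (h n) y); split.
  + exact: yosidaP.
  + rewrite addrC addKr normrN normrZ gtr0_norm//.
    have := PK _ hn0; move: hn; rewrite ltr_pdivlMr; last first.
      by rewrite mulr_gt0// ltr_wpDl// addr_ge0// mulr_ge0.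
    have Kw : 0 <= K * w by rewrite mulr_ge0.
    move=> h1 h2; have := ler_wpM2l (ltW hn0) h2.
    by have : 0 <= h n * (K * w) by [rewrite mulr_ge0// ltW]; lra.
  + rewrite scalerDl scale1r addrAC; apply: le_trans (ler_normD _ _) _.
    have hw0 : 0 <= h n * w by rewrite mulr_ge0// ltW.
    rewrite distrC normrZ (ger0_norm hw0).
    have := ler_wpM2l hw0 (PK _ hn0); move: hn; rewrite ltr_pdivlMr; last first.
      by rewrite mulr_gt0// ltr_wpDl// addr_ge0// mulr_ge0.
    by have : 0 <= h n * K by [rewrite mulr_ge0// ltW]; lra.
- by apply: (cvgr_to_le (cvg_norm cP)); near=> n; rewrite PK// grid_step_gt0.
- move=> r r0; rewrite distrC.
  have c1 : `|P (h n) y - P r y| ^+ 2 @[n --> \oo] --> `|A0 y - P r y| ^+ 2.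
    by apply: cvg_sqnorm; apply: cvgB => //; exact: cvg_cst.
  have c2 : `|P (h n) y| ^+ 2 - `|P r y| ^+ 2 @[n --> \oo] -->
      `|A0 y| ^+ 2 - `|P r y| ^+ 2.
    by apply: cvgB; [exact: cvg_sqnorm|exact: cvg_cst].
  apply: (ler_cvg_to c1 c2).
  near=> n => /=; apply: yosida_dist; first exact: grid_step_gt0.
  by apply: ltW; near: n; exact: grid_step_lt.
Unshelve. all: by end_near. Qed.

Lemma minsec_min y f : A y f -> [/\ A y (A0 y), `|A0 y| <= `|f| &
  forall r, 0 < r -> `|P r y - A0 y| ^+ 2 <= `|A0 y| ^+ 2 - `|P r y| ^+ 2].
Proof. by move=> yf; apply: minsecP => r r0; exact: yosida_le. Qed.

Lemma minsec_bound y (K : R) : (forall e, 0 < e ->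
    exists z f, [/\ A z f, `|z - y| <= e & `|f| <= K + e]) ->
  A y (A0 y) /\ `|A0 y| <= K.
Proof.
move=> yK; suff PK r : 0 < r -> `|P r y| <= K by have [] := minsecP PK.
move=> r0; apply/ler_addgt0Pr => e e0.
pose c := r^-1 * (2 + r * w).
have c0 : 0 <= c by rewrite mulr_ge0 ?addr_ge0 ?invr_ge0 ?mulr_ge0// ltW.
have q0 : 0 < e / (c + 1) by rewrite divr_gt0// ltr_wpDl.
have [z [f [zf zy fK]]] := yK _ q0.
have h1 := yosida_le r0 zf; have := yosida_lipschitz y z r0; rewrite -/c => h2.
have h3 : (c + 1) * (e / (c + 1)) = e by rewrite mulrC divfK// lt0r_neq0// ltr_wpDl.
have := ler_normD (P r y - P r z) (P r z); rewrite subrK.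
move: zy; rewrite distrC => zy.
have := ler_wpM2l c0 zy.
by lra.
Qed.

(* The minimal section is continuous along points of the graph whose norm does
   not exceed the minimal one in the limit: testing monotonicity at the Yosida
   point [y - r P] shows that [P], close to [A0 y], is nearly a lower bound. *)
Lemma minsec_cont y f e : A y f -> 0 < e -> exists2 d, 0 < d &
  forall z x, A z x -> `|z - y| <= d -> `|x| <= `|A0 y| + d -> `|x - A0 y| <= e.
Proof.
move=> yf e0; have [yA _ hP] := minsec_min yf.
set M := `|A0 y|; have M0 : 0 <= M := normr_ge0 _.
have [r r0 Pr] : exists2 r, 0 < r & M ^+ 2 - `|P r y| ^+ 2 <= (e / 4) ^+ 2.
  have cP : P (h n) y @[n --> \oo] --> A0 y.
    by apply: (@yosida_is_cvg _ `|f|) => r r0; exact: yosida_le.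
  have q0 : 0 < (e / 4) ^+ 2 by rewrite exprn_gt0// divr_gt0.
  have c3 : `|P (h n) y| ^+ 2 @[n --> \oo] --> M ^+ 2 by exact: cvg_sqnorm.
  have /cvgrPdist_le/(_ _ q0) c4 := c3.
  have [n hn] := filter_ex c4.
  exists (h n); first exact: (grid_step_gt0 n).
  by move: hn => /= /(le_trans (ler_norm _)).
have PM : `|P r y| <= M by exact: yosida_le.
have rw0 : 0 <= r * w by rewrite mulr_ge0// ltW.
pose C := M + 1 + (1 + r * w) * M + w.
have C0 : 0 <= C by rewrite !addr_ge0// mulr_ge0// addr_ge0.
pose B := 2 * M + 1 + 2 * (C / r).
have Cr : 0 <= C / r by rewrite divr_ge0// ltW.
have B0 : 0 < B by rewrite /B; lra.
pose d := Num.min 1 ((e / 4) ^+ 2 / B).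
have d0 : 0 < d by rewrite lt_min ltr01 divr_gt0// exprn_gt0// divr_gt0.
have d1 : d <= 1 by rewrite ge_min lexx.
have dB : d * B <= (e / 4) ^+ 2.
  by rewrite -ler_pdivlMr// ge_min lexx orbT.
exists d => // z x zx zy xM.
have x1 : `|x| <= M + 1 by lra.
have key : `|P r y| ^+ 2 - d * (C / r) <= dotp x (P r y).
  have := quasi_monotone zx (yosidaP y r0).
  move: PM Pr; move: (P r y) => p PM Pr.
  have -> : z - (y - r *: p) = (z - y) + r *: p by rewrite opprB addrA addrAC.
  move: (z - y) zy => v vd.
  rewrite sqnormD !normrZ (gtr0_norm r0) exprMn !dotpE !dotpp (dotpC v p) => h.
  have v0 := normr_ge0 v.
  have h1 : dotp x v <= d * (M + 1).
    by apply: le_trans (dotp_le _ _) _; rewrite mulrC; apply: ler_pM.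
  have h2 : `|dotp p v| <= d * M.
    by apply: le_trans (dotp_norm _ _) _; rewrite mulrC; apply: ler_pM.
  have h3 : `|v| ^+ 2 <= d.
    apply: (@le_trans _ _ (d ^+ 2)); first by rewrite ler_sqr ?nnegrE// ltW.
    by rewrite expr2 ger_pMl.
  have h4 : `|(1 - r * w) * dotp p v| <= (1 + r * w) * (d * M).
    rewrite normrM ler_pM//; apply: le_trans (ler_normB _ _) _.
    by rewrite normr1 ger0_norm.
  move: h4; rewrite ler_norml => /andP[h4 _].
  have h5 : w * `|v| ^+ 2 <= w * d by rewrite ler_wpM2l.
  rewrite -(ler_pM2l r0).
  have -> : r * (`|p| ^+ 2 - d * (C / r)) = r * `|p| ^+ 2 - d * C.
    by field; rewrite lt0r_neq0.
  rewrite /C; lra.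
have h1 : `|x - P r y| <= e / 2.
  apply: ler_norm_sqr; first by rewrite divr_ge0// ltW.
  rewrite sqnormB.
  have : `|x| ^+ 2 <= (M + d) ^+ 2 by rewrite ler_sqr ?nnegrE// addr_ge0// ltW.
  have : d ^+ 2 <= d by rewrite expr2 ger_pMl.
  move: dB Pr; rewrite /B; nra.
have h2 : `|P r y - A0 y| <= e / 4.
  apply: ler_norm_sqr; first by rewrite divr_ge0// ltW.
  by apply: le_trans (hP r r0) _.
by apply: le_trans (ler_distD (P r y) _ _) _; lra.
Qed.

Lemma euler_step_mem l k x : 0 < l -> l * w < 1 ->
  A (E l k.+1 x) (l^-1 *: (E l k x - E l k.+1 x)).
Proof. by move=> l0 lw; exact: resolventP. Qed.

Lemma euler_step_le l k x f t : 0 < l -> l * w <= 1 / 2 -> A x f ->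
  k.+1%:R * l <= t ->
  `|l^-1 *: (E l k x - E l k.+1 x)| <= expR (2 * w * t) * `|f|.
Proof.
move=> l0 lw xf kt; have lw1 : l * w < 1 by lra.
rewrite normrZ gtr0_norm ?invr_gt0// ler_pdivrMl// distrC mulrCA.
apply: le_trans (euler_increment k l0 lw1 xf) _.
by rewrite ler_wpM2r ?mulr_ge0 ?(ltW l0)// growth_le.
Qed.

Lemma minsec_flow y f t : A y f -> 0 <= t ->
  A (T t y) (A0 (T t y)) /\ `|A0 (T t y)| <= expR (2 * w * t) * `|A0 y|.
Proof.
move=> yf t0; have [yA _ _] := minsec_min yf.
have yD : D y by apply: subset_closure; exists f.
apply: minsec_bound => e e0; have [->|t1] := eqVneq t 0.
  exists y, (A0 y); split=> //; first by rewrite flow0// subrr normr0 ltW.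
  by rewrite mulr0 expR0 mul1r lerDl ltW.
have {}t1 : 0 < t by rewrite lt_neqAle eq_sym t1.
have [d d0 h1] := flow_approx yD t0 e0.
have d10 : 0 < Num.min step_bound (Num.min t d) by rewrite !lt_min step_bound_gt0 d0 t1.
have [l [i [l0]]] := flow_pick t0 d10; rewrite !lt_min.
move=> /and3P[ls _ ld] it /and3P[_ it1 it2]; have lw := lt_step_bound l0 ls.
case: i it it1 it2 => [|i] it it1 it2.
  by move: it1; rewrite mul0r sub0r normrN gtr0_norm// ltxx.
exists (E l i.+1 y), (l^-1 *: (E l i y - E l i.+1 y)); split.
- by apply: euler_step_mem => //; lra.
- exact: h1.
- apply: (@le_trans _ _ (expR (2 * w * t) * `|A0 y|)); last by rewrite lerDl ltW.
  by apply: euler_step_le => //; lra.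
Qed.

Lemma expR_le1D2x (x : R) : 0 <= x -> x <= 1 / 2 -> expR x <= 1 + 2 * x.
Proof.
move=> x0 x1; have := expR_ge1Dx (- x); rewrite expRN => h.
have p := expR_gt0 x; move: h; rewrite -(ler_pM2r p) mulVf ?lt0r_neq0// => h.
by nra.
Qed.

Lemma flow_derivative0 y f e : A y f -> 0 < e -> exists2 d, 0 < d &
  forall s, 0 < s -> s < d -> `|T s y - y + s *: A0 y| <= e * s.
Proof.
move=> yf e0; have [yA _ _] := minsec_min yf.
have yD : D y by apply: subset_closure; exists f.
have e2 : 0 < e / 2 by rewrite divr_gt0.
have [d1 d10 hd1] := minsec_cont yf e2.
set M := `|A0 y| in hd1; have M0 : 0 <= M := normr_ge0 _.
pose q := d1 / ((4 * w + 2) * (M + 1)).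
have w42 : 0 < (4 * w + 2) * (M + 1).
  by rewrite mulr_gt0// ltr_wpDl// mulr_ge0.
have q0 : 0 < q by rewrite divr_gt0.
pose d := Num.min step_bound q.
have d0 : 0 < d by rewrite lt_min step_bound_gt0.
exists d => // s s0; rewrite lt_min => /andP[sb sq].
have sw := lt_step_bound s0 sb.
have sw0 : 0 <= s * w by rewrite mulr_ge0// ltW.
have sd1 : s * ((4 * w + 2) * (M + 1)) <= d1.
  by move: sq; rewrite /q ltr_pdivlMr// => /ltW.
have K1 : expR (2 * w * s) <= 1 + 4 * (s * w).
  by have := @expR_le1D2x (2 * w * s); rewrite (_ : 2 * w * s = 2 * (s * w)); [lra|ring].
have sM0 : 0 <= s * M by rewrite mulr_ge0// ltW.
have swM0 : 0 <= s * w * M by rewrite mulr_ge0.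
have KM : expR (2 * w * s) * M <= M + d1.
  by have := ler_wpM2r M0 K1; lra.
have KsM : expR (2 * w * s) * (s * M) <= d1.
  by have := ler_wpM2r sM0 K1; nra.
have euler l i : 0 < l -> l < step_bound -> i%:R * l <= s ->
    `|E l i y - y + (i%:R * l) *: A0 y| <= i%:R * l * (e / 2).
  move=> l0 lb; have lw := lt_step_bound l0 lb.
  elim: i => [|i IH] il; first by rewrite /= subrr mul0r scale0r addr0 normr0 mul0r.
  have il' : i%:R * l <= s by move: il; rewrite -natr1; lra.
  have -> : E l i.+1 y - y + (i.+1%:R * l) *: A0 y =
      (E l i y - y + (i%:R * l) *: A0 y) -
      l *: (l^-1 *: (E l i y - E l i.+1 y) - A0 y).
    rewrite scalerBr scalerA mulfV ?lt0r_neq0// scale1r -natr1 mulrDl mul1r scalerDl.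
    rewrite !opprB [RHS](AC (3*(1*2)) ((5*2)*(3*4)*(1*6)))/=.
    by rewrite subrr addr0.
  apply: le_trans (ler_normB _ _) _; rewrite -natr1 mulrDl mulrDl mul1r.
  apply: lerD; first exact: IH.
  rewrite normrZ gtr0_norm// ler_pM2l//; apply: (hd1 (E l i.+1 y)).
  - by apply: euler_step_mem => //; lra.
  - apply: le_trans (euler_dist l0 _ yA il) _; first by lra.
    apply: le_trans KsM; rewrite ler_wpM2l ?expR_ge0// ler_wpM2r//.
  - by apply: le_trans KM; apply: euler_step_le => //; lra.
pose p := e * s / (4 * (M + 1)).
have p0 : 0 < p by rewrite divr_gt0 ?mulr_gt0// ltr_wpDl.
have es0 : 0 < e * s / 4 by rewrite divr_gt0// mulr_gt0.
have [d2 d20 hd2] := flow_approx yD (ltW s0) es0.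
have d30 : 0 < Num.min step_bound (Num.min p d2) by rewrite !lt_min step_bound_gt0 p0.
have [l [i [l0]]] := flow_pick (ltW s0) d30; rewrite !lt_min.
move=> /and3P[ls lp ld] it /and3P[_ itp it2].
have {}hd2 := hd2 l i l0 ld it2; have {}euler := euler l i l0 ls it.
have pM : p * M <= e * s / 4.
  by have : p * (4 * (M + 1)) = e * s by [rewrite divfK// lt0r_neq0// mulr_gt0// ltr_wpDl]; lra.
have -> : T s y - y + s *: A0 y =
    (E l i y - y + (i%:R * l) *: A0 y) - ((E l i y - T s y) + (i%:R * l - s) *: A0 y).
  rewrite scalerBl !opprD !opprK [RHS](AC (3*(2*2)) ((5*2)*7*(1*4)*(3*6)))/=.
  by rewrite !subrr !addr0.
apply: le_trans (ler_normB _ _) _.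
have := ler_normD (E l i y - T s y) ((i%:R * l - s) *: A0 y).
have : `|(i%:R * l - s) *: A0 y| <= p * M.
  by rewrite normrZ ler_wpM2r// ltW.
have : i%:R * l * (e / 2) <= s * (e / 2) by rewrite ler_wpM2r// ltW.
by lra.
Qed.

Lemma minsec_right_continuous0 y f e : A y f -> 0 < e -> exists2 d, 0 < d &
  forall s, 0 <= s -> s < d -> `|A0 (T s y) - A0 y| <= e.
Proof.
move=> yf e0; have [yA _ _] := minsec_min yf.
have [d1 d10 hd1] := minsec_cont yf e0.
set M := `|A0 y| in hd1; have M0 : 0 <= M := normr_ge0 _.
pose K := expR (4 * w * step_bound).
have w42 : 0 < (4 * w + 2) * (M + 1).
  by rewrite mulr_gt0// ltr_wpDl// mulr_ge0.
have KM0 : 0 < K * (M + 1) by rewrite mulr_gt0 ?expR_gt0// ltr_wpDl.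
have K0 : 0 < K by exact: expR_gt0.
pose d := Num.min step_bound (Num.min (d1 / (K * (M + 1))) (d1 / ((4 * w + 2) * (M + 1)))).
have d0 : 0 < d.
  by rewrite !lt_min step_bound_gt0 !divr_gt0.
exists d => // s s0; rewrite !lt_min !ltr_pdivlMr//.
move=> /and3P[sb sK sw].
have [yTA yTM] := minsec_flow yA s0.
have yD : D y by apply: subset_closure; exists f.
apply: (hd1 (T s y)) => //.
  have sb1 : 0 <= s <= step_bound by rewrite s0 ltW.
  have := flow_time yA sb1 (_ : 0 <= 0 <= step_bound).
  rewrite flow0// subr0 (ger0_norm s0) -/K -/M lexx (ltW step_bound_gt0) => /(_ isT).
  have : 0 <= K * s by rewrite mulr_ge0// ltW.
  by lra.
apply: le_trans yTM _; rewrite -/M.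
have sw0 : 0 <= s * w by rewrite mulr_ge0.
have sw1 : s * w <= 1 / 4.
  have [->|s1] := eqVneq s 0; first by rewrite mul0r; lra.
  by apply: lt_step_bound => //; rewrite lt_neqAle eq_sym s1.
have K1 : expR (2 * w * s) <= 1 + 4 * (s * w).
  by have := @expR_le1D2x (2 * w * s); rewrite (_ : 2 * w * s = 2 * (s * w)); [lra|ring].
have := ler_wpM2r M0 K1.
have : 0 <= s * M by rewrite mulr_ge0.
have : 0 <= s * w * M by rewrite mulr_ge0.
by lra.
Qed.

Lemma euler_energy l (F rho : R) v g x i : 0 < l -> l * w <= 1 / 4 -> A v g ->
  (forall k, (k < i)%N -> F <= `|l^-1 *: (E l k x - E l k.+1 x)| ^+ 2) ->
  (forall k, (k < i)%N -> `|E l k.+1 x - v| <= rho) ->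
  i%:R * l * (psi (E l i x) - psi v) + i%:R * (i%:R - 1) * l ^+ 2 * (F / 4) <=
  `|x - v| ^+ 2 / 2 - `|E l i x - v| ^+ 2 / 2 + i%:R * l * (w / 2 * rho ^+ 2).
Proof.
move=> l0 lw vg; have lw1 : l * w < 1 by lra.
elim: i => [|i IH] FP rP; first by rewrite !mul0r !addr0 subrr.
have {}IH := IH (fun k ki => FP k (ltnW ki)) (fun k ki => rP k (ltnW ki)).
have Fi := FP i (ltnSn i); have ri := rP i (ltnSn i).
have fA := euler_step_mem i x l0 lw1.
set f := l^-1 *: (E l i x - E l i.+1 x) in Fi fA.
have lf : l *: f = E l i x - E l i.+1 x.
  by rewrite /f scalerA mulfV ?lt0r_neq0// scale1r.
have dec : l * (psi (E l i.+1 x) - psi v) <= `|E l i x - v| ^+ 2 / 2 -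
    `|E l i.+1 x - v| ^+ 2 / 2 + l * (w / 2 * rho ^+ 2).
  have := subgradP fA vg; rewrite distrC -(opprB (E l i.+1 x) v) dotpNr => h.
  have -> : E l i x - v = l *: f + (E l i.+1 x - v) by rewrite lf addrA subrK.
  move: h ri; move: (E l i.+1 x - v) => b h ri.
  rewrite sqnormD dotpZl.
  have r2 : `|b| ^+ 2 <= rho ^+ 2.
    by rewrite ler_sqr ?nnegrE// (le_trans _ ri).
  have := ler_wpM2l (ltW l0) h.
  have := ler_wpM2l w_ge0 r2; move/(ler_wpM2l (ltW l0)).
  by have := sqr_ge0 `|l *: f|; lra.
have mono : i%:R * (psi (E l i.+1 x) + l * (F / 2)) <= i%:R * psi (E l i x).
  have [i0|i0] := posnP i; first by rewrite i0 !mul0r.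
  have xi : A (E l i x) (l^-1 *: (E l i.-1 x - E l i x)).
    by rewrite -{1 3}(prednK i0); exact: euler_step_mem.
  rewrite ler_wpM2l//; have := subgradP fA xi.
  rewrite -lf normrZ gtr0_norm// exprMn dotpZr dotpp => h.
  have : l * w * `|f| ^+ 2 <= 1 / 4 * `|f| ^+ 2 by rewrite ler_wpM2r ?sqr_ge0.
  move/(ler_wpM2l (ltW l0)).
  have := ler_wpM2l (ltW l0) Fi.
  have : 0 <= l * `|f| ^+ 2 by rewrite mulr_ge0 ?sqr_ge0// ltW.
  by lra.
by have := ler_wpM2l (ltW l0) mono; rewrite -(natr1 i); lra.
Qed.

(* The energy inequality is summed with weights growing linearly in the step
   number; the increments, nearly nonincreasing, are all bounded below by the
   last one. The bound involves [x] only through its distance to [v]. *)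
Lemma euler_smoothing l t v g x i (rho : R) : 0 < l -> l * w <= 1 / 4 -> A v g ->
  i%:R * l <= t -> (0 < i)%N ->
  rho = expR (2 * w * t) * (`|x - v| + t * `|g|) ->
  i%:R * (i%:R - 1) * l ^+ 2 * `|l^-1 *: (E l i.-1 x - E l i x)| ^+ 2 <=
  4 * expR (2 * w * t) ^+ 2 * (rho ^+ 2 / 2 + t * (`|g| * rho + w * rho ^+ 2)).
Proof.
move=> l0 lw vg it i0 rhoE; have lw1 : l * w < 1 by lra.
have lw2 : l * w <= 1 / 2 by lra.
have t0 : 0 <= t by apply: le_trans it; rewrite mulr_ge0// ltW.
set G := expR _ in rhoE *; have G0 : 0 < G by exact: expR_gt0.
have G1 : 1 <= G.
  by apply: le_trans (expR_ge1Dx _); rewrite lerDl !mulr_ge0.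
set N := `|l^-1 *: _|; have N0 : 0 <= N := normr_ge0 _.
have kt k : (k <= i)%N -> k%:R * l <= t.
  by move=> ki; apply: le_trans it; rewrite ler_pM2r// ler_nat.
have tg0 : 0 <= t * `|g| by rewrite mulr_ge0.
have rho0 : 0 <= rho by rewrite rhoE mulr_ge0 ?addr_ge0// ltW.
have rP k : (k <= i)%N -> `|E l k x - v| <= rho.
  move=> ki; apply: le_trans (ler_distD (E l k v) _ _) _; rewrite rhoE mulrDr.
  apply: lerD.
    apply: le_trans (euler_lipschitz k x v l0 lw1) _.
    by rewrite ler_wpM2r// growth_le// kt.
  apply: le_trans (euler_dist l0 lw2 vg (kt k ki)) _.
  by rewrite ler_pM2l// ler_wpM2r// kt.
have FP k : (k < i)%N ->
    (N / G) ^+ 2 <= `|l^-1 *: (E l k x - E l k.+1 x)| ^+ 2.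
  move=> ki; rewrite ler_sqr ?nnegrE ?divr_ge0 ?(ltW G0)//.
  rewrite ler_pdivrMr// /N !normrZ -mulrA ler_wpM2l//.
  have e1 : i.-1 = (i.-1 - k + k)%N by rewrite subnK// -ltnS prednK.
  have e2 : i = (i.-1 - k + k.+1)%N by rewrite addnS -e1 prednK.
  rewrite {1}e1 {2}e2 !iterD.
  apply: le_trans (euler_lipschitz _ _ _ l0 lw1) _.
  rewrite mulrC ler_wpM2l// growth_le// kt//.
  by rewrite (leq_trans (leq_subr _ _))// leq_pred.
have := euler_energy l0 lw vg FP (fun k ki => rP k.+1 ki).
have xi : A (E l i x) (l^-1 *: (E l i.-1 x - E l i x)).
  by rewrite -{1 3}(prednK i0); exact: euler_step_mem.
have := subgradP vg xi.
have h1 : - (`|g| * rho) <= dotp g (E l i x - v).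
  rewrite lerNl -dotpNl (le_trans (dotp_le _ _))// normrN ler_wpM2l//.
  by rewrite rP.
have h2 : `|E l i x - v| ^+ 2 <= rho ^+ 2 by rewrite ler_sqr ?nnegrE// rP.
have h3 : `|x - v| ^+ 2 <= rho ^+ 2 by rewrite ler_sqr ?nnegrE// (rP 0%N).
move=> h4; set c := i%:R * l.
have c0 : 0 <= c by rewrite mulr_ge0// ltW.
have h5 : - (`|g| * rho + w / 2 * rho ^+ 2) <= psi (E l i x) - psi v.
  by have := ler_wpM2l w_ge0 h2; lra.
have h6 := ler_wpM2l c0 h5.
have wr0 : 0 <= w * rho ^+ 2 by rewrite mulr_ge0 ?sqr_ge0.
have gr0 : 0 <= `|g| * rho by rewrite mulr_ge0.
have h7 : c * (`|g| * rho + w * rho ^+ 2) <= t * (`|g| * rho + w * rho ^+ 2).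
  by rewrite ler_wpM2r// addr_ge0.
rewrite exprMn => h8.
have G2 : 0 < G ^+ 2 by rewrite exprn_gt0.
have NG : N ^+ 2 * G^-1 ^+ 2 * G ^+ 2 = N ^+ 2.
  by rewrite -mulrA -exprMn mulVf ?lt0r_neq0// expr1n mulr1.
rewrite -NG mulrA [leRHS]mulrAC ler_pM2r//.
have := sqr_ge0 `|E l i x - v|.
by lra.
Qed.

Lemma flow_smoothing x t : D x -> 0 < t -> A (T t x) (A0 (T t x)).
Proof.
move=> xD t0; have [v [g vg] _] := (closure_normP _ _).1 xD _ ltr01.
set rho := expR (2 * w * t) * (`|x - v| + t * `|g|).
set Q := 4 * expR (2 * w * t) ^+ 2 * (rho ^+ 2 / 2 + t * (`|g| * rho + w * rho ^+ 2)).
have rho0 : 0 <= rho by rewrite mulr_ge0 ?expR_ge0// addr_ge0// mulr_ge0// ltW.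
have r2 : 0 <= rho ^+ 2 by rewrite sqr_ge0.
have G2 : 0 <= expR (2 * w * t) ^+ 2 by rewrite sqr_ge0.
have gr : 0 <= `|g| * rho by rewrite mulr_ge0.
have wr : 0 <= w * rho ^+ 2 by rewrite mulr_ge0.
have Q0 : 0 <= Q.
  apply: mulr_ge0; first by rewrite mulr_ge0.
  by apply: addr_ge0; [rewrite divr_ge0|rewrite mulr_ge0 ?addr_ge0// ltW].
suff [] : A (T t x) (A0 (T t x)) /\ `|A0 (T t x)| <= Q / (t ^+ 2 / 8) + 1 by [].
apply: minsec_bound => e e0.
have [d d0 h1] := flow_approx xD (ltW t0) e0.
have t4 : 0 < t / 4 by rewrite divr_gt0.
have d10 : 0 < Num.min step_bound (Num.min (t / 4) d).
  by rewrite !lt_min step_bound_gt0 d0 t4.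
have [l [i [l0]]] := flow_pick (ltW t0) d10; rewrite !lt_min.
move=> /and3P[ls lt ld] it /and3P[_ it1 it2]; have lw := lt_step_bound l0 ls.
have ilt : t / 2 <= i%:R * l.
  by move: it1; rewrite ltr_norml => /andP[]; lra.
have i0 : (0 < i)%N.
  by rewrite lt0n; apply/negP => /eqP i0; move: ilt; rewrite i0 mul0r; lra.
have := euler_smoothing l0 lw vg it i0 (erefl rho); rewrite -/Q.
set N := l^-1 *: _ => NQ.
exists (E l i x), N; split.
- by rewrite /N -{1 3}(prednK i0); apply: euler_step_mem => //; lra.
- exact: h1.
- have h2 : t ^+ 2 / 8 <= i%:R * (i%:R - 1) * l ^+ 2.
    have -> : i%:R * (i%:R - 1) * l ^+ 2 = (i%:R * l) * (i%:R * l - l) by ring.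
    have -> : t ^+ 2 / 8 = (t / 2) * (t / 4) by field.
    by apply: ler_pM => //; lra.
  have t2 : 0 < t ^+ 2 / 8 by rewrite divr_gt0// exprn_gt0.
  have h3 : `|N| ^+ 2 <= Q / (t ^+ 2 / 8).
    rewrite ler_pdivlMr// mulrC; apply: le_trans NQ.
    by rewrite ler_wpM2r ?sqr_ge0.
  have : 0 <= (`|N| - 1) ^+ 2 by rewrite sqr_ge0.
  have n0 := normr_ge0 N.
  have [n1|n1] := lerP `|N| 1; last by nra.
  have : 0 <= Q / (t ^+ 2 / 8) by rewrite divr_ge0// ltW.
  by lra.
Qed.

End gradient_flow.

(** * Right derivatives and weak derivatives *)

Section right_derivative.
Context {R : realType}.

Lemma right_dini_nonincreasing (F : R -> R) a b : a <= b ->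
  (forall t e, a < t <= b -> 0 < e -> exists2 d, 0 < d &
    forall s, a <= s < t -> t - d < s -> F t <= F s + e) ->
  (forall t e, a <= t < b -> 0 < e -> exists2 d, 0 < d &
    forall s, 0 < s -> s < d -> F (t + s) - F t <= e * s) ->
  F b <= F a.
Proof.
move=> ab Fleft Fright; apply/ler_addgt0Pr => e e0.
pose q := e / (b - a + 1).
have ba1 : 0 < b - a + 1 by rewrite ltr_wpDl// subr_ge0.
have q0 : 0 < q by rewrite divr_gt0.
have qb : q * (b - a) <= e.
  have : q * (b - a + 1) = e by rewrite /q divfK// lt0r_neq0.
  by lra.
pose S := [set t | a <= t <= b /\ forall r, a <= r <= t -> F r <= F a + q * (r - a)].
have Sa : S a.
  split=> [|r]; first by rewrite lexx ab.
  by rewrite -eq_le => /eqP <-; rewrite subrr mulr0 addr0.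
have hS : has_sup S.
  by split; [exists a|exists b => t [/andP[]]].
set c := sup S.
have ac : a <= c by exact: sup_upper_bound.
have cb : c <= b by apply: ge_sup; [exists a|move=> t [/andP[]]].
have below r : a <= r < c -> F r <= F a + q * (r - a).
  move=> /andP[ar rc]; have d0 : 0 < c - r by rewrite subr_gt0.
  have [t [_ St] rt] := sup_adherent d0 hS.
  by apply: St; rewrite ar ltW//; move: rt; rewrite subKr.
have Fc : F c <= F a + q * (c - a).
  move: ac; rewrite le_eqVlt => /predU1P[<-|ac].
    by rewrite subrr mulr0 addr0.
  apply/ler_addgt0Pr => z z0.
  have [d d0 hd] := Fleft c z (introT andP (conj ac cb)) z0.
  pose s := Num.max a (c - d / 2).
  have sc : s < c by rewrite gt_max ac ltrBlDr ltrDl divr_gt0.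
  have as_ : a <= s by rewrite le_max lexx.
  have ds : c - d < s by rewrite lt_max; apply/orP; right; lra.
  have h1 := hd s (introT andP (conj as_ sc)) ds.
  have h2 := below s (introT andP (conj as_ sc)).
  have : q * (s - a) <= q * (c - a) by rewrite ler_pM2l// lerD2r ltW.
  by lra.
suff cbE : c = b by rewrite -cbE; apply: le_trans Fc _; rewrite lerD2l cbE.
apply/eqP; rewrite eq_le cb /= leNgt; apply/negP => cltb.
have [d d0 hd] := Fright c q (introT andP (conj ac cltb)) q0.
pose s := Num.min (d / 2) (b - c).
have s0 : 0 < s by rewrite lt_min subr_gt0 cltb divr_gt0.
have sd : s <= d / 2 by rewrite ge_min lexx.
have sb : s <= b - c by rewrite ge_min lexx orbT.
suff : S (c + s).
  by move=> /(sup_upper_bound hS); rewrite -/c; lra.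
split=> [|r /andP[ar rcs]]; first by apply/andP; split; lra.
have [rc|cr] := ltP r c; first by apply: below; rewrite ar rc.
move: cr; rewrite le_eqVlt => /predU1P[<-//|cr].
have := hd (r - c); rewrite subr_gt0 addrCA subrr addr0 => /(_ cr) h.
have := h ltac:(lra); lra.
Qed.

Lemma right_derivative_unique (F G W : R -> R) a b : a <= b ->
  (forall t e, a < t <= b -> 0 < e -> exists2 d, 0 < d &
    forall s, a <= s < t -> t - d < s -> `|F t - F s| <= e) ->
  (forall t e, a < t <= b -> 0 < e -> exists2 d, 0 < d &
    forall s, a <= s < t -> t - d < s -> `|G t - G s| <= e) ->
  (forall t e, a <= t < b -> 0 < e -> exists2 d, 0 < d &
    forall s, 0 < s -> s < d -> `|F (t + s) - F t - W t * s| <= e * s) ->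
  (forall t e, a <= t < b -> 0 < e -> exists2 d, 0 < d &
    forall s, 0 < s -> s < d -> `|G (t + s) - G t - W t * s| <= e * s) ->
  F b - F a = G b - G a.
Proof.
move=> ab.
suff le (F1 F2 : R -> R) :
  (forall t e, a < t <= b -> 0 < e -> exists2 d, 0 < d &
    forall s, a <= s < t -> t - d < s -> `|F1 t - F1 s| <= e) ->
  (forall t e, a < t <= b -> 0 < e -> exists2 d, 0 < d &
    forall s, a <= s < t -> t - d < s -> `|F2 t - F2 s| <= e) ->
  (forall t e, a <= t < b -> 0 < e -> exists2 d, 0 < d &
    forall s, 0 < s -> s < d -> `|F1 (t + s) - F1 t - W t * s| <= e * s) ->
  (forall t e, a <= t < b -> 0 < e -> exists2 d, 0 < d &
    forall s, 0 < s -> s < d -> `|F2 (t + s) - F2 t - W t * s| <= e * s) ->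
  F1 b - F1 a <= F2 b - F2 a.
  by move=> Fl Gl Fr Gr; apply/eqP; rewrite eq_le !le.
move=> l1 l2 r1 r2.
suff : F1 b - F2 b <= F1 a - F2 a by lra.
apply: (@right_dini_nonincreasing (fun t => F1 t - F2 t)) => // t e tab e0.
  have e2 : 0 < e / 2 by rewrite divr_gt0.
  have [d1 d10 h1] := l1 t _ tab e2; have [d2 d20 h2] := l2 t _ tab e2.
  exists (Num.min d1 d2) => [|s sat]; first by rewrite lt_min d10.
  rewrite ltrBlDr -ltrBlDl lt_min => /andP[sd1 sd2].
  have := h1 s sat ltac:(lra); have := h2 s sat ltac:(lra).
  by rewrite !ler_norml => /andP[? ?] /andP[? ?]; lra.
have e2 : 0 < e / 2 by rewrite divr_gt0.
have [d1 d10 h1] := r1 t _ tab e2; have [d2 d20 h2] := r2 t _ tab e2.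
exists (Num.min d1 d2) => [|s s0]; first by rewrite lt_min d10.
rewrite lt_min => /andP[sd1 sd2].
have := h1 s s0 sd1; have := h2 s s0 sd2.
by rewrite !ler_norml => /andP[? ?] /andP[? ?]; lra.
Qed.

End right_derivative.

Section smooth_functions.
Context {R : realType}.
Implicit Types f g : R -> R.

Fixpoint nderivable n f : Prop :=
  if n is m.+1 then
    exists2 f' : R -> R, (forall x : R, is_derive x 1 f (f' x)) & nderivable m f'
  else True.

Lemma nderivableD n f g : nderivable n f -> nderivable n g ->
  nderivable n (fun x => f x + g x).
Proof.
elim: n f g => [//|n IH] f g [f' ff' nf] [g' gg' ng].
exists (fun x => f' x + g' x); last exact: IH.
by move=> x; apply: is_deriveD.
Qed.

Lemma nderivableS n f : nderivable n.+1 f -> nderivable n f.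
Proof.
elim: n f => [//|n IH] f [f' ff' nf]; exists f' => //.
exact: IH.
Qed.

Lemma nderivableM n f g : nderivable n f -> nderivable n g ->
  nderivable n (fun x => f x * g x).
Proof.
elim: n f g => [//|n IH] f g nf ng.
have [f' ff' nf'] := nf; have [g' gg' ng'] := ng.
exists (fun x => f x * g' x + g x * f' x).
  by move=> x; apply: is_deriveM.
by apply: nderivableD; apply: IH => //; exact: nderivableS.
Qed.

Lemma nderivable_comp n f g : nderivable n f -> nderivable n g ->
  nderivable n (fun x => f (g x)).
Proof.
elim: n f => [//|n IH] f [f' ff' nf'] ng.
have [g' gg' ng'] := ng; exists (fun x => f' (g x) * g' x).
  by move=> x; apply: (@is_derive1_comp _ f g).
by apply: nderivableM => //; apply: IH => //; exact: nderivableS.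
Qed.

Lemma nderivable_cst n (c : R) : nderivable n (fun=> c).
Proof.
by elim: n c => [//|n IH] c; exists (fun=> 0) => // x; exact: is_derive_cst.
Qed.

Lemma nderivable_affine n (a b : R) : nderivable n (fun x => a * x + b).
Proof.
case: n => [//|n]; exists (fun=> a); last exact: nderivable_cst.
move=> x; rewrite -[X in is_derive _ _ _ X]addr0.
apply: is_deriveD; rewrite -[X in is_derive _ _ _ X]mulr1.
exact: (@is_deriveZ _ _ _ id a x 1 1).
Qed.

Lemma nderivable_derivable f : (forall n, nderivable n f) ->
  forall n t, derivable (derive1n n f) t 1.
Proof.
move=> sf n; elim: n f sf => [|n IH] f sf t.
  by have [f' ff' _] := sf 1%N; exact: ex_derive.
rewrite derive1Sn; apply: IH => m.
have [f' ff' nf] := sf m.+1; suff -> : derive1 f = f' by [].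
by apply/funext => x; rewrite derive1E; exact: derive_val.
Qed.

Definition flat k (x : R) : R := if 0 < x then x^-1 ^+ k * expR (- x^-1) else 0.

Lemma flat_ge0 k x : 0 <= flat k x.
Proof.
by rewrite /flat; case: ifP => // x0; rewrite mulr_ge0 ?expR_ge0// exprn_ge0// invr_ge0 ltW.
Qed.

Lemma flat_le_sqr k x : flat k x <= k.+2%:R ^+ k.+2 * x ^+ 2.
Proof.
rewrite /flat; case: ifP => x0; last by rewrite mulr_ge0 ?sqr_ge0// exprn_ge0.
set y := x^-1; have y0 : 0 < y by rewrite invr_gt0.
have m0 : 0 < k.+2%:R :> R by [].
have h : (y / k.+2%:R) ^+ k.+2 <= expR y.
  have -> : expR y = expR (y / k.+2%:R) ^+ k.+2.
    by rewrite -expRM_natr divfK// lt0r_neq0.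
  rewrite lerXn2r ?nnegrE ?expR_ge0 ?divr_ge0 ?(ltW y0)//.
  by apply: le_trans (expR_ge1Dx _); rewrite lerDr.
rewrite expRN ler_pdivrMr ?expR_gt0//.
have -> : x = y^-1 by rewrite invrK.
have -> : y ^+ k = k.+2%:R ^+ k.+2 * y^-1 ^+ 2 * (y / k.+2%:R) ^+ k.+2.
  rewrite exprMn exprVn [k.+2%:R^-1 ^+ _]exprVn -(addn2 k) (exprD y).
  by field; rewrite !expf_neq0 ?lt0r_neq0.
rewrite ler_wpM2l// mulr_ge0 ?exprn_ge0 ?invr_ge0 ?ltW//.
Qed.

Lemma flat_le0 k x : x <= 0 -> flat k x = 0.
Proof. by move=> x0; rewrite /flat ltNge x0. Qed.

Lemma is_derive_flat k (x : R) : is_derive x 1 (flat k) (flat k.+2 x - k%:R * flat k.+1 x).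
Proof.
have [x0|x0|->] := ltgtP x 0.
- rewrite !flat_le0 ?(ltW x0)// mulr0 subrr.
  apply: (@near_eq_is_derive _ _ _ (fun=> 0 : R)).
  by near=> y; rewrite flat_le0//; apply: ltW; near: y; exact: lt_nbhsl.
- have -> : flat k.+2 x - k%:R * flat k.+1 x =
      x^-1 ^+ k * (expR (- x^-1) * x ^- 2) +
      expR (- x^-1) * (k%:R * x^-1 ^+ k.-1 * - x ^- 2).
    rewrite /flat x0 -exprVn; case: k => [|k]/=; last by rewrite !exprS; ring.
    by rewrite !mul0r mulr0 subr0 addr0 expr0 mul1r mulrC.
  have nE : \near x, x^-1 ^+ k * expR (- x^-1) = flat k x.
    by near=> y; rewrite /flat ifT//; near: y; exact: lt_nbhsr.
  apply: (near_eq_is_derive nE).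
  have dV : is_derive x 1 (fun y : R => y^-1) (- x ^- 2).
    have := @is_deriveV R id x 1 1 (lt0r_neq0 x0) (is_derive_id _ _).
    by rewrite /GRing.scale/= mulr1.
  have dE : is_derive x 1 (fun y : R => expR (- y^-1)) (expR (- x^-1) * x ^- 2).
    apply: (@is_derive1_comp _ expR (fun y => - y^-1)).
    by rewrite -[x ^- 2]opprK; exact: is_deriveN.
  have dX : is_derive x 1 (fun y : R => y^-1 ^+ k) (k%:R * x^-1 ^+ k.-1 * - x ^- 2).
    by have := @is_deriveX _ _ _ k x 1 _ dV; rewrite exprfctE.
  exact: (@is_deriveM _ _ _ _ x 1 _ _ dX dE).
- have f0 j : flat j 0 = 0 by rewrite /flat ltxx.
  rewrite !f0 mulr0 subrr.
  have L : (fun h => h^-1 *: ((flat k \o shift 0) (h *: 1) - flat k 0)) @ 0^' --> 0.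
    apply/cvgrPdist_le => e e0.
    pose c : R := k.+2%:R ^+ k.+2; have c0 : 0 < c by rewrite exprn_gt0.
    near=> h; rewrite /= f0 subr0 addr0 sub0r normrN normrZ.
    rewrite [h *: 1]mulr1 (ger0_norm (flat_ge0 _ _)).
    have h0 : h != 0 by near: h; exact: nbhs_dnbhs_neq.
    have hc : `|h| <= e / c.
      by near: h; apply: dnbhs0_le; rewrite divr_gt0.
    rewrite normfV ler_pdivrMl ?normr_gt0//.
    apply: le_trans (flat_le_sqr k h) _; rewrite -/c -real_normK ?num_real//.
    rewrite expr2 mulrA mulrC ler_wpM2l//.
    by rewrite -ler_pdivlMl// mulrC.
  constructor; first exact: (cvgP _ L).
  by apply: cvg_lim => //; exact: L.
Unshelve. all: by end_near. Qed.

Lemma nderivable_flat n k : nderivable n (flat k).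
Proof.
elim: n k => [//|n IH] k; exists (fun x => flat k.+2 x - k%:R * flat k.+1 x).
  exact: is_derive_flat.
apply: nderivableD; first exact: IH.
have -> : (fun x => - (k%:R * flat k.+1 x)) = fun x => (- k%:R) * flat k.+1 x.
  by apply/funext => x; rewrite mulNr.
by apply: nderivableM; [exact: nderivable_cst|exact: IH].
Qed.

Lemma flat0_nd : {homo flat 0 : x y / x <= y}.
Proof.
move=> x y xy; have [x0|x0] := ltP 0 x; last first.
  by rewrite {1}/flat ltNge x0/= flat_ge0.
have y0 : 0 < y by exact: lt_le_trans xy.
by rewrite /flat x0 y0 !expr0 !mul1r ler_expR lerN2 lef_pV2.
Qed.

Lemma flat0_gt0 x : 0 < x -> 0 < flat 0 x.
Proof. by move=> x0; rewrite /flat x0 expr0 mul1r expR_gt0. Qed.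

Definition smooth_step x := flat 0 (flat 0 1 - flat 0 (1 - x)).

Lemma nderivable_smooth_step n : nderivable n smooth_step.
Proof.
apply: nderivable_comp; first exact: nderivable_flat.
have -> : (fun x => flat 0 1 - flat 0 (1 - x)) =
    fun x => flat 0 1 + (-1) * flat 0 ((-1) * x + 1).
  by apply/funext => x; rewrite !mulN1r (addrC _ 1).
apply: nderivableD; first exact: nderivable_cst.
apply: nderivableM; first exact: nderivable_cst.
by apply: nderivable_comp; [exact: nderivable_flat|exact: nderivable_affine].
Qed.

Lemma smooth_step_nd : {homo smooth_step : x y / x <= y}.
Proof.
move=> x y xy; apply: flat0_nd; rewrite lerD2l lerN2; apply: flat0_nd.
by rewrite lerD2l lerN2.
Qed.

Lemma smooth_step0 x : x <= 0 -> smooth_step x = 0.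
Proof.
move=> x0; rewrite /smooth_step {1}/flat ifF//; apply/negbTE.
by rewrite -leNgt subr_le0; apply: flat0_nd; rewrite lerDl oppr_ge0.
Qed.

Lemma smooth_step1 x : 1 <= x -> smooth_step x = smooth_step 1.
Proof.
move=> x1; rewrite /smooth_step; congr (flat 0 (_ - _)).
by rewrite /flat !ifF//; apply/negbTE; rewrite -leNgt ?subr_le0// subrr.
Qed.

Lemma smooth_step1_gt0 : 0 < smooth_step 1.
Proof.
apply: flat0_gt0; rewrite subrr [X in _ < _ - X]/flat ltxx subr0.
exact: flat0_gt0.
Qed.

End smooth_functions.

Section integral_comparison.
Context {d} {T : measurableType d} {R : realType}.
Variable mu : {measure set T -> \bar R}.
Local Open Scope ereal_scope.

(* The library's [ge0_le_integral] requires measurability; the integral being a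
   supremum over simple functions, comparison holds without it. *)
Lemma ge0_le_integral_nonmeasurable (D : set T) (f g : T -> \bar R) :
  (forall x, D x -> 0 <= f x) -> (forall x, D x -> f x <= g x) ->
  \int[mu]_(x in D) f x <= \int[mu]_(x in D) g x.
Proof.
move=> f0 fg; rewrite !ge0_integralE//; last first.
  by move=> x Dx; exact: le_trans (f0 x Dx) (fg x Dx).
apply: ereal_sup_le => _ [h hf <-]; exists h => // x.
apply: le_trans (hf x) _; rewrite !patchE; case: ifPn => //.
by rewrite inE; exact: fg.
Qed.

Lemma ae_ge0_le_integral_upper (D N : set T) (f k : T -> \bar R) :
  measurable D -> measurable N -> mu N = 0 -> measurable_fun D k ->
  (forall x, D x -> 0 <= f x) -> (forall x, D x -> 0 <= k x) ->
  (forall x, D x -> ~ N x -> f x <= k x) ->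
  \int[mu]_(x in D) f x <= \int[mu]_(x in D) k x.
Proof.
move=> mD mN N0 mk f0 k0 fk.
pose oo_N := (cst +oo : T -> \bar R) \_ N.
have mooN : measurable_fun D oo_N.
  by apply/measurable_restrict => //; exact: measurable_cst.
have ooN0 x : D x -> 0 <= oo_N x.
  by move=> _; rewrite /oo_N patchE; case: ifPn => //= _; exact: le0y.
have -> : \int[mu]_(x in D) k x = \int[mu]_(x in D) (k x + oo_N x).
  have DN : mu (D `&` N) = 0.
    by apply: (subset_measure0 _ _ _ N0) => //; exact: measurableI.
  have mDN : measurable (D `&` N) by exact: measurableI.
  rewrite ge0_integralD// -integral_mkcondr (null_set_integral mDN _ DN) ?adde0//.
apply: ge0_le_integral_nonmeasurable => // x Dx; rewrite /oo_N patchE.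
case: ifPn => [_|xN] /=; first by rewrite addey ?leey// -ltNye (lt_le_trans _ (k0 x Dx)).
by rewrite adde0 fk// => /mem_set; apply/negP.
Qed.

Lemma ae_ge0_le_integral_lower (D N : set T) (f k : T -> \bar R) :
  measurable D -> measurable N -> mu N = 0 -> measurable_fun D k ->
  (forall x, D x -> 0 <= f x) -> (forall x, D x -> 0 <= k x) ->
  (forall x, D x -> ~ N x -> k x <= f x) ->
  \int[mu]_(x in D) k x <= \int[mu]_(x in D) f x.
Proof.
move=> mD mN N0 mk f0 k0 kf; rewrite (ge0_negligible_integral mN)//.
apply: (@le_trans _ _ (\int[mu]_(x in D `\` N) f x)).
  by apply: ge0_le_integral_nonmeasurable => x [Dx Nx]; [exact: k0|exact: kf].
rewrite integral_mkcond [leRHS]integral_mkcond.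
apply: ge0_le_integral_nonmeasurable => x _; rewrite !patchE.
  by case: ifPn => //; rewrite inE => -[Dx _]; exact: f0.
case: ifPn => [|_]; first by rewrite inE => -[Dx _]; rewrite mem_set.
by case: ifPn => //; rewrite inE => Dx; exact: f0.
Qed.

Lemma ae_le_integral_upper (D N : set T) (f k : T -> \bar R) :
  measurable D -> measurable N -> mu N = 0 -> measurable_fun D k ->
  (forall x, D x -> ~ N x -> f x <= k x) ->
  \int[mu]_(x in D) f x <= \int[mu]_(x in D) k x.
Proof.
move=> mD mN N0 mk fk; rewrite integralE [leRHS]integralE leeB//.
- apply: (@ae_ge0_le_integral_upper _ N) => //; first exact: measurable_funepos.
  by move=> x Dx Nx; rewrite !funeposE ge_max !le_max fk// lexx orbT.
- apply: (@ae_ge0_le_integral_lower _ N) => //; first exact: measurable_funeneg.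
  by move=> x Dx Nx; rewrite !funenegE ge_max !le_max leeN2 fk// lexx orbT.
Qed.

Lemma ae_le_integral_lower (D N : set T) (f k : T -> \bar R) :
  measurable D -> measurable N -> mu N = 0 -> measurable_fun D k ->
  (forall x, D x -> ~ N x -> k x <= f x) ->
  \int[mu]_(x in D) k x <= \int[mu]_(x in D) f x.
Proof.
move=> mD mN N0 mk fk; rewrite integralE [leRHS]integralE leeB//.
- apply: (@ae_ge0_le_integral_lower _ N) => //; first exact: measurable_funepos.
  by move=> x Dx Nx; rewrite !funeposE ge_max !le_max fk// lexx orbT.
- apply: (@ae_ge0_le_integral_upper _ N) => //; first exact: measurable_funeneg.
  by move=> x Dx Nx; rewrite !funenegE ge_max !le_max leeN2 fk// lexx orbT.
Qed.

Lemma ae_le_Rintegral (D : set T) (f k : T -> R) (C : R) :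
  measurable D -> mu D < +oo -> mu.-integrable D (EFin \o k) ->
  {ae mu, forall x, D x -> (f x <= k x)%R /\ (`|f x| <= C)%R} ->
  (\int[mu]_(x in D) f x <= \int[mu]_(x in D) k x)%R.
Proof.
move=> mD Dfin ik [N [mN N0 fN]].
have fkN x : D x -> ~ N x -> (f x <= k x)%R /\ (`|f x| <= C)%R.
  by move=> Dx Nx; apply: contrapT => fk; apply: Nx; apply: fN => /= /(_ Dx).
have mk : measurable_fun D (EFin \o k) by exact: (measurable_int mu).
have kfin : \int[mu]_(x in D) (k x)%:E \is a fin_num by exact: integrable_fin_num.
have fk : \int[mu]_(x in D) (f x)%:E <= \int[mu]_(x in D) (k x)%:E.
  by apply: (@ae_le_integral_upper _ N) => // x Dx Nx; rewrite lee_fin; apply fkN.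
have Cf : \int[mu]_(x in D) (cst (- C)%:E) x <= \int[mu]_(x in D) (f x)%:E.
  apply: (@ae_le_integral_lower _ N) => // x Dx Nx; rewrite lee_fin.
  by have [_] := fkN x Dx Nx; rewrite ler_norml => /andP[].
rewrite /Rintegral fine_le// fin_numE; apply/andP; split.
  by rewrite -ltNye (lt_le_trans _ Cf)// integral_cst// ltNye_eq fin_numM// ge0_fin_numE.
by rewrite -ltey (le_lt_trans fk)// ltey_eq kfin.
Qed.

End integral_comparison.

Section plateau.
Context {R : realType}.

Definition step_slope : R -> R := derive1 smooth_step.

Lemma is_derive_smooth_step (x : R) : is_derive x 1 smooth_step (step_slope x).
Proof.
have [f' ff' _] := @nderivable_smooth_step R 1; have := ff' x.
by rewrite /step_slope derive1E => -[xd _]; exact: DeriveDef.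
Qed.

Lemma nderivable_step_slope n : nderivable n step_slope.
Proof.
have [f' ff' nf] := @nderivable_smooth_step R n.+1.
suff -> : step_slope = f' by [].
by apply/funext => x; rewrite /step_slope derive1E; exact: derive_val.
Qed.

Lemma nderivable1_continuous (f : R -> R) : nderivable 1 f -> continuous f.
Proof.
move=> [f' ff' _] x; apply/differentiable_continuous/derivable1_diffP.
exact: ex_derive.
Qed.

Lemma step_slope_ge0 x : 0 <= step_slope x.
Proof.
have [+ <-] := is_derive_smooth_step x => xd.
apply: limr_ge => //; near=> h => /=; rewrite [h *: 1]mulr1.
have [h0|h0] := leP 0 h.
  apply: mulr_ge0; first by rewrite invr_ge0.
  by rewrite subr_ge0 smooth_step_nd// lerDr.
rewrite -[_ *: _]opprK -scaleNr -scalerN; apply: mulr_ge0.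
  by rewrite oppr_ge0 invr_le0 ltW.
by rewrite opprB subr_ge0 smooth_step_nd// gerDr ltW.
Unshelve. all: by end_near. Qed.

Lemma step_slope_out x : x < 0 \/ 1 < x -> step_slope x = 0.
Proof.
have aux (c : R) : (\near x, c = smooth_step x) -> step_slope x = 0.
  move=> cx; have := near_eq_is_derive cx (is_derive_cst c x 1).
  by rewrite /step_slope derive1E => h; exact: derive_val.
case=> x0; [apply: (aux 0)|apply: (aux (smooth_step 1))].
  by near=> y; rewrite smooth_step0// ltW//; near: y; exact: lt_nbhsl.
by near=> y; rewrite [RHS]smooth_step1// ltW//; near: y; exact: lt_nbhsr.
Unshelve. all: by end_near. Qed.

Definition plateau (s t r x : R) : R :=
  smooth_step (r^-1 * (x - s)) - smooth_step (r^-1 * (x - t)).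

Definition plateau_slope (s t r x : R) : R :=
  r^-1 * step_slope (r^-1 * (x - s)) - r^-1 * step_slope (r^-1 * (x - t)).

Variables (s t r : R).
Hypotheses (st : s <= t) (r0 : 0 < r).

Lemma is_derive_scaled_step (c x : R) :
  is_derive x 1 (fun x => smooth_step (r^-1 * (x - c)))
    (r^-1 * step_slope (r^-1 * (x - c))).
Proof.
have dA : is_derive x 1 (fun x => r^-1 * (x - c)) r^-1.
  have [f' ff' _] := @nderivable_affine R 1 r^-1 (- (r^-1 * c)).
  have -> : (fun x => r^-1 * (x - c)) = (fun x => r^-1 * x + - (r^-1 * c)).
    by apply/funext => y; rewrite mulrBr.
  rewrite -[X in is_derive _ _ _ X]addr0; apply: is_deriveD.
  by rewrite -[X in is_derive _ _ _ X]mulr1; exact: (@is_deriveZ _ _ _ id r^-1 x 1 1).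
rewrite mulrC; apply: (@is_derive1_comp _ smooth_step (fun x => r^-1 * (x - c))).
exact: is_derive_smooth_step.
Qed.

Lemma is_derive_plateau (x : R) : is_derive x 1 (plateau s t r) (plateau_slope s t r x).
Proof. by apply: is_deriveB; exact: is_derive_scaled_step. Qed.

Lemma derive1_plateau : derive1 (plateau s t r) = plateau_slope s t r.
Proof.
by apply/funext => x; rewrite derive1E; have [_] := is_derive_plateau x.
Qed.

Lemma nderivable_scaled (f : R -> R) (c : R) n : nderivable n f ->
  nderivable n (fun x => f (r^-1 * (x - c))).
Proof.
move=> nf; have -> : (fun x => f (r^-1 * (x - c))) =
    (fun x => f (r^-1 * x + - (r^-1 * c))).
  by apply/funext => y; rewrite mulrBr.
by apply: nderivable_comp => //; exact: nderivable_affine.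
Qed.

Lemma nderivable_plateau n : nderivable n (plateau s t r).
Proof.
have -> : plateau s t r = fun x => smooth_step (r^-1 * (x - s)) +
    (-1) * smooth_step (r^-1 * (x - t)).
  by apply/funext => x; rewrite mulN1r.
apply: nderivableD; last apply: nderivableM; first exact/nderivable_scaled/nderivable_smooth_step.
  exact: nderivable_cst.
exact/nderivable_scaled/nderivable_smooth_step.
Qed.

Lemma scaled_le0 (c x : R) : (r^-1 * (x - c) <= 0) = (x <= c).
Proof. by rewrite pmulr_rle0 ?invr_gt0// subr_le0. Qed.

Lemma scaled_lt0 (c x : R) : (r^-1 * (x - c) < 0) = (x < c).
Proof. by rewrite pmulr_rlt0 ?invr_gt0// subr_lt0. Qed.

Lemma scaled_ge1 (c x : R) : (1 <= r^-1 * (x - c)) = (c + r <= x).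
Proof. by rewrite ler_pdivlMl// mulr1 lerBrDl. Qed.

Lemma scaled_gt1 (c x : R) : (1 < r^-1 * (x - c)) = (c + r < x).
Proof. by rewrite ltr_pdivlMl// mulr1 ltrBrDl. Qed.

Lemma plateau_ge0 x : 0 <= plateau s t r x.
Proof.
rewrite subr_ge0 smooth_step_nd// ler_pM2l ?invr_gt0//.
by rewrite lerD2l lerN2.
Qed.

Lemma smooth_step_le1 (x : R) : smooth_step x <= smooth_step 1.
Proof.
have [x1|x1] := leP x 1; first exact: smooth_step_nd.
by rewrite smooth_step1// ltW.
Qed.

Lemma plateau_le x : plateau s t r x <= smooth_step 1.
Proof.
rewrite lerBlDr; apply: le_trans (smooth_step_le1 _) _; rewrite lerDl.
have [x0|x0] := leP 0 (r^-1 * (x - t)); last by rewrite smooth_step0// ltW.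
by rewrite -(@smooth_step0 R 0)// smooth_step_nd.
Qed.

Lemma plateau_out x : x <= s \/ t + r <= x -> plateau s t r x = 0.
Proof.
case=> xst; rewrite /plateau.
  by rewrite !smooth_step0 ?scaled_le0 ?subrr// (le_trans xst).
rewrite [X in X - _]smooth_step1 ?scaled_ge1; last first.
  by rewrite (le_trans _ xst)// lerD2r.
by rewrite [X in _ - X]smooth_step1 ?scaled_ge1// subrr.
Qed.

Lemma plateau_slope_out x : x < s \/ t + r < x -> plateau_slope s t r x = 0.
Proof.
case=> xst; rewrite /plateau_slope.
  rewrite !step_slope_out ?mulr0 ?subrr//; left; rewrite scaled_lt0//.
  exact: lt_le_trans st.
rewrite !step_slope_out ?mulr0 ?subrr//; right; rewrite scaled_gt1//.
by rewrite (le_lt_trans _ xst)// lerD2r.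
Qed.

Lemma test_function_plateau : 0 < s -> test_function (plateau s t r).
Proof.
move=> s0; split; first exact/nderivable_derivable/nderivable_plateau.
exists s, (t + r); split=> // x; apply: contraNT => xst.
rewrite plateau_out//; move: xst; rewrite negb_and -!ltNge.
by move=> /orP[/ltW|/ltW]; [left|right].
Qed.

End plateau.

Section lebesgue_integrals.
Context {R : realType}.
Local Notation mu := (@lebesgue_measure R).
Implicit Types f g : R -> R.

Lemma Rintegral_support (D E : set R) f : E `<=` D ->
  (forall x, D x -> ~ E x -> f x = 0) ->
  \int[mu]_(x in D) f x = \int[mu]_(x in E) f x.
Proof.
move=> ED f0; rewrite Rintegral_mkcond [RHS]Rintegral_mkcond.
congr (Rintegral _ _ _); apply/funext => x; rewrite !patchE.
case: ifPn => [/set_mem Dx|xD].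
  by case: ifPn => // /negP xE; apply: f0 => // Ex; apply: xE; rewrite inE.
by rewrite ifN//; apply: contra xD; rewrite !inE; exact: ED.
Qed.

Lemma continuous_itv_integrable f a b : {within `[a, b], continuous f} ->
  mu.-integrable `[a, b] (EFin \o f).
Proof. by apply: continuous_compact_integrable; exact: segment_compact. Qed.

Lemma lebesgue_itv_lty (a b : R) : (mu `[a, b] < +oo)%E.
Proof. by rewrite lebesgue_measure_itv/=; case: ifP => // _; rewrite -EFinB ltry. Qed.

Lemma Rintegral_derivative (G g : R -> R) a b : a < b ->
  (forall x : R, is_derive x 1 G (g x)) -> continuous g ->
  \int[mu]_(x in `[a, b]) g x = G b - G a.
Proof.
move=> ab Gg cg; have cG : continuous G.
  by move=> x; apply/differentiable_continuous/derivable1_diffP; exact: ex_derive.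
rewrite /Rintegral (@continuous_FTC2 _ g G)//.
- exact: continuous_subspaceT.
- split; first by move=> x _; exact: ex_derive.
  + by apply: cvg_at_right_filter; exact: cG.
  + by apply: cvg_at_left_filter; exact: cG.
- by move=> x _; rewrite derive1E; have [_] := Gg x.
Qed.

(* Test against a plateau on [s, t] and compare with the affine function of
   slope [K]. *)
Lemma weak_derivative_increment_le (f g : R -> R) (a b K M s t : R) :
  0 < a -> a <= s -> s < t -> t < b -> {within `[a, b], continuous f} ->
  (forall eta, test_function eta ->
    \int[mu]_(x in `]0, +oo[) (f x * derive1 eta x) =
    - \int[mu]_(x in `]0, +oo[) (g x * eta x)) ->
  {ae mu, forall x, a <= x <= b -> g x <= K /\ `|g x| <= M} ->
  f t - f s <= K * (t - s).
Proof.
move=> a0 as_ st tb cf fg gK; rewrite leNgt; apply/negP => fst.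
pose p x := f x - K * x.
have cp : {within `[a, b], continuous p}.
  move=> x; apply: cvgB; first exact: cf.
  by apply: (@continuous_subspaceT _ _ _ (fun x => K * x)) => y; exact: mulrl_continuous.
pose q := (p t - p s) / 3.
have q0 : 0 < q by rewrite divr_gt0// /p; lra.
have ab : a < b by rewrite (le_lt_trans as_)// (lt_trans st).
have pleft (x : R) : a <= x < b -> exists2 r, 0 < r & forall y, x <= y -> y <= x + r -> y <= b /\ `|p x - p y| <= q.
  move=> /andP[ax xb].
  have xab : x \in `[a, b] by rewrite in_itv/= ax ltW.
  have /cvgrPdist_le/(_ _ q0) := (subspace_continuousP _ _).1 cp x xab.
  case=> /= r r0 hr; pose r' := Num.min (r / 2) (b - x).
  have r'0 : 0 < r' by rewrite lt_min subr_gt0 xb divr_gt0.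
  have r'r : r' <= r / 2 by rewrite ge_min lexx.
  have r'b : r' <= b - x by rewrite ge_min lexx orbT.
  exists r' => // y xy yx; have yb : y <= b by lra.
  split=> //; apply: hr; last by rewrite /= in_itv/= yb (le_trans ax).
  by rewrite /ball/= distrC ger0_norm ?subr_ge0//; lra.
have sb : a <= s < b by rewrite as_ (lt_trans st).
have tb' : a <= t < b by rewrite tb (le_trans as_)// ltW.
have [r1 r10 h1] := pleft s sb; have [r2 r20 h2] := pleft t tb'.
pose r := Num.min r1 r2; have r0 : 0 < r by rewrite lt_min r10.
have trb : t + r <= b by apply: (h2 (t + r) _ _).1; rewrite ?lerDl ?(ltW r0)// lerD2l ge_min lexx orbT.
pose eta := plateau s t r; pose deta := plateau_slope s t r.
have st' := ltW st; have s0 : 0 < s by exact: lt_le_trans as_.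
have ceta : continuous eta by exact/nderivable1_continuous/nderivable_plateau.
have cdeta : continuous deta.
  apply: nderivable1_continuous; have [f' ff' nf'] := nderivable_plateau s t r 2.
  suff -> : deta = f' by [].
  by apply/funext => x; rewrite /deta -derive1_plateau derive1E; exact: derive_val.
have Dsub : `[a, b] `<=` (`]0, +oo[ : set R).
  by move=> x /=; rewrite !in_itv/= andbT => /andP[ax _]; exact: lt_le_trans ax.
have out x : ~ [set` `[a, b]] x -> x < s \/ t + r < x.
  move=> /negP; rewrite /= in_itv/= negb_and -!ltNge => /orP[xa|bx].
    by left; exact: lt_le_trans as_.
  by right; exact: le_lt_trans bx.
have := fg eta (test_function_plateau st' r0 s0).
rewrite derive1_plateau -/deta.
rewrite (Rintegral_support Dsub); last first.
  by move=> x _ /out xo; rewrite /deta plateau_slope_out ?mulr0.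
rewrite (@Rintegral_support _ _ (fun x => g x * eta x) Dsub); last first.
  move=> x _ /out xo; rewrite /eta plateau_out ?mulr0//.
  by case: xo => /ltW; [left|right].
have within_cst (h : R -> R) : continuous h -> {within `[a, b], continuous h}.
  exact: continuous_subspaceT.
have cM (h1' h2' : R -> R) : continuous h1' -> continuous h2' ->
    continuous (fun x => h1' x * h2' x).
  by move=> c1 c2 x; apply: cvgM; [exact: c1|exact: c2].
have cD (h1' h2' : R -> R) : continuous h1' -> continuous h2' ->
    continuous (fun x => h1' x + h2' x).
  by move=> c1 c2 x; apply: cvgD; [exact: c1|exact: c2].
have cK (c : R) : continuous (fun _ : R => c) by exact: cst_continuous.
have cx : continuous (fun x : R => x) by move=> x; exact: cvg_id.
have icont (h : R -> R) : continuous h -> mu.-integrable `[a, b] (EFin \o h).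
  by move=> ch; apply: continuous_itv_integrable; exact: within_cst.
have cKeta : continuous (fun x => K * eta x) by exact: cM.
have cKxdeta : continuous (fun x => K * x * deta x) by apply: (cM _ _) => //; exact: cM.
have geta : \int[mu]_(x in `[a, b]) (g x * eta x) <=
    \int[mu]_(x in `[a, b]) (K * eta x).
  apply: (@ae_le_Rintegral _ _ _ _ _ _ _ (M * smooth_step 1)) => //.
  - exact: lebesgue_itv_lty.
  - exact: icont.
  - have [N [mN N0 gN]] := gK; exists N; split=> // x /= xN; apply: gN => /= gx.
    apply: xN; rewrite in_itv/= => /gx[gxK gxM].
    have e0 := plateau_ge0 st' r0 x.
    split; first by rewrite ler_wpM2r.
    by rewrite normrM ler_pM// ger0_norm// plateau_le.
have byparts : \int[mu]_(x in `[a, b]) (K * eta x) +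
    \int[mu]_(x in `[a, b]) (K * x * deta x) = 0.
  rewrite -RintegralD//; [|exact: icont..].
  have dG (x : R) : is_derive x 1 (fun x => K * x * eta x) (K * eta x + K * x * deta x).
    have dx : is_derive x 1 (fun x : R => K * x) K.
      by rewrite -[X in is_derive _ _ _ X]mulr1; exact: (@is_deriveZ _ _ _ id K x 1 1).
    have h := @is_deriveM _ _ (fun x => K * x) eta x 1 _ _ dx (is_derive_plateau s t r x).
    by apply: is_derive_eq h _; rewrite /GRing.scale/= addrC (mulrC (eta x)).
  rewrite (@Rintegral_derivative _ _ _ _ ab dG); last exact: cD.
  rewrite /eta [plateau _ _ _ b]plateau_out; [|by []|by []|by right].
  by rewrite plateau_out ?mulr0 ?subrr//; left.
have wfdeta : mu.-integrable `[a, b] (EFin \o (fun x => f x * deta x)).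
  apply: continuous_itv_integrable => x; apply: cvgM; first exact: cf.
  exact: (within_cst _ cdeta).
move=> fge.
have pge : 0 <= \int[mu]_(x in `[a, b]) (p x * deta x).
  have -> : \int[mu]_(x in `[a, b]) (p x * deta x) =
      \int[mu]_(x in `[a, b]) (f x * deta x) - \int[mu]_(x in `[a, b]) (K * x * deta x).
    rewrite -RintegralB//; last exact: icont.
    by apply: eq_Rintegral => x _; rewrite /p mulrBl.
  move/eqP: byparts; rewrite addr_eq0 => /eqP byparts.
  by rewrite fge addrC -byparts subr_ge0.
pose ss x := r^-1 * step_slope (r^-1 * (x - s)).
pose sq x := r^-1 * step_slope (r^-1 * (x - t)).
have sl0 c x : 0 <= r^-1 * step_slope (r^-1 * (x - c)).
  by rewrite mulr_ge0 ?step_slope_ge0// invr_ge0 ltW.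
have cslope c : continuous (fun x => r^-1 * step_slope (r^-1 * (x - c))).
  apply: (cM _ _) => //; apply: nderivable1_continuous.
  exact/nderivable_scaled/nderivable_step_slope.
have := pge; apply/negP; rewrite -ltNge.
apply: (@le_lt_trans _ _ (\int[mu]_(x in `[a, b]) ((p s + q) * ss x + - (p t - q) * sq x))).
  apply: le_Rintegral => //.
  - apply: continuous_itv_integrable => x; apply: cvgM; first exact: cp.
    exact: (within_cst _ cdeta).
  - by apply: icont; apply: (cD _ _); apply: (cM _ _) => //; exact: cslope.
  - move=> x xab; rewrite mulNr.
    have -> : p x * deta x = p x * ss x - p x * sq x by rewrite mulrBr.
    apply: lerB.
      have [xs|xs] := boolP ((s <= x) && (x <= s + r)).
        rewrite ler_wpM2r ?sl0//; move/andP: xs => [sx xsr].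
        have xr : x <= s + r1 by apply: le_trans xsr _; rewrite lerD2l ge_min lexx.
        by have [_] := h1 x sx xr; rewrite ler_norml => /andP[]; lra.
      rewrite /ss step_slope_out ?mulr0// scaled_lt0// scaled_gt1//.
      by move: xs; rewrite negb_and -!ltNge => /orP[]; [left|right].
    have [xt|xt] := boolP ((t <= x) && (x <= t + r)).
      rewrite ler_wpM2r ?sl0//; move/andP: xt => [tx xtr].
      have xr : x <= t + r2 by apply: le_trans xtr _; rewrite lerD2l ge_min lexx orbT.
      by have [_] := h2 x tx xr; rewrite ler_norml => /andP[]; lra.
    rewrite /sq step_slope_out ?mulr0// scaled_lt0// scaled_gt1//.
    by move: xt; rewrite negb_and -!ltNge => /orP[]; [left|right].
have dG (x : R) : is_derive x 1
    (fun x => (p s + q) * smooth_step (r^-1 * (x - s)) +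
      - (p t - q) * smooth_step (r^-1 * (x - t)))
    ((p s + q) * ss x + - (p t - q) * sq x).
  apply: is_deriveD.
    exact: (@is_deriveZ _ _ _ _ (p s + q) x 1 _ (is_derive_scaled_step r s x)).
  exact: (@is_deriveZ _ _ _ _ (- (p t - q)) x 1 _ (is_derive_scaled_step r t x)).
rewrite (@Rintegral_derivative _ _ _ _ ab dG); last first.
  by apply: (cD _ _); apply: (cM _ _) => //; exact: cslope.
have srb : s + r <= b by apply: le_trans trb; rewrite lerD2r.
rewrite [smooth_step (_ * (b - s))]smooth_step1 ?scaled_ge1//.
rewrite [smooth_step (_ * (b - t))]smooth_step1 ?scaled_ge1//.
rewrite (@smooth_step0 _ (_ * (a - s))) ?scaled_le0//.
rewrite (@smooth_step0 _ (_ * (a - t))) ?scaled_le0 ?(le_trans as_)//.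
have pq : p t = p s + 3 * q by rewrite /q; field.
have := mulr_gt0 q0 (@smooth_step1_gt0 R); rewrite pq.
by move: (p s) (q) (smooth_step 1) => x y z; lra.
Qed.

End lebesgue_integrals.

Section right_limits.
Context {R : realType} {H : normedModType R}.

Lemma right_cvgP (f : R -> H) (t : R) (l : H) :
  f x @[x --> t^'+] --> l <->
  forall e, 0 < e -> exists2 d, 0 < d &
    forall s, 0 < s -> s < d -> `|f (t + s) - l| <= e.
Proof.
split=> [/cvgrPdist_le fl e e0|fl].
  have [d /= d0 hd] := fl e e0; exists d => // s s0 sd; rewrite distrC.
  by apply: hd => /=; rewrite ?ltrDl// opprD addNKr normrN gtr0_norm.
apply/cvgrPdist_le => e e0; have [d d0 hd] := fl e e0.
exists d => //= x /=; rewrite distrC => xt tx.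
have xt0 : 0 < x - t by rewrite subr_gt0.
rewrite distrC; have := hd (x - t) xt0; rewrite (addrC t) subrK; apply.
by rewrite gtr0_norm in xt.
Qed.

End right_limits.

Section right_continuous.
Context {R : realType}.
Local Notation mu := (@lebesgue_measure R).

Definition right_step n (x : R) : R := (Num.truncn (x * n.+1%:R)).+1%:R / n.+1%:R.

Lemma right_step_itv n x : 0 <= x ->
  x < right_step n x /\ right_step n x <= x + n.+1%:R^-1.
Proof.
move=> x0; have n0 : 0 < n.+1%:R :> R by rewrite ltr0n.
have xn : 0 <= x * n.+1%:R by rewrite mulr_ge0// ltW.
have /andP[k1 k2] := truncn_itv xn.
rewrite /right_step ltr_pdivlMr//; split=> //.
by rewrite -natr1 mulrDl mul1r lerD2r ler_pdivrMr.
Qed.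

Lemma measurable_truncn_eq n k : measurable [set x : R | Num.truncn (x * n.+1%:R) = k].
Proof.
have n0 : 0 < n.+1%:R :> R by rewrite ltr0n.
have le_k m : measurable [set x : R | (Num.truncn (x * n.+1%:R) <= m)%N].
  rewrite (_ : [set x | _] = [set` `]-oo, m.+1%:R / n.+1%:R[]); first exact: measurable_itv.
  by apply/seteqP; split=> x /=; rewrite in_itv/= truncn_le_nat ltr_pdivlMr.
case: k => [|k].
  rewrite (_ : [set x | _] = [set x : R | (Num.truncn (x * n.+1%:R) <= 0)%N]) ?le_k//.
  by apply/seteqP; split=> x /=; rewrite leqn0 => /eqP.
rewrite (_ : [set x | _] = [set x : R | (Num.truncn (x * n.+1%:R) <= k.+1)%N] `\`
    [set x : R | (Num.truncn (x * n.+1%:R) <= k)%N]).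
  by apply: measurableD; exact: le_k.
apply/seteqP; split=> x /=.
  by move=> ->; split=> //; rewrite ltnn.
by move=> [h1 /negP]; rewrite -ltnNge => h2; apply/eqP; rewrite eqn_leq h1.
Qed.

Lemma measurable_right_step n (P : set R) : measurable [set x | P (right_step n x)].
Proof.
rewrite (_ : [set x | _] = \bigcup_k
    ([set x : R | Num.truncn (x * n.+1%:R) = k] `&` [set x | P (k.+1%:R / n.+1%:R)])).
  apply: bigcupT_measurable => k; apply: measurableI.
    exact: measurable_truncn_eq.
  have [Pk|Pk] := pselect (P (k.+1%:R / n.+1%:R)).
    by rewrite (_ : [set x | _] = setT); [exact: measurableT|apply/seteqP; split].
  by rewrite (_ : [set x | _] = set0); [exact: measurable0|apply/seteqP; split].
apply/seteqP; split=> x /=.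
  by move=> Px; exists (Num.truncn (x * n.+1%:R)).
by move=> [k _ [/= <-]].
Qed.

Lemma right_step_cvg {H : normedModType R} (g : R -> H) (x : R) : 0 <= x ->
  g y @[y --> x^'+] --> g x -> g (right_step n x) @[n --> \oo] --> g x.
Proof.
move=> x0 /right_cvgP gx; apply/cvgrPdist_le => e e0.
have [d d0 hd] := gx e e0; near=> n.
have [h1 h2] := right_step_itv n x0; rewrite distrC.
have := hd (right_step n x - x); rewrite (addrC x) subrK subr_gt0; apply=> //.
rewrite ltrBlDl (le_lt_trans h2)// ltrD2l.
by near: n; exact: grid_step_lt.
Unshelve. all: by end_near. Qed.

Lemma right_continuous_measurable (g : R -> R) :
  (forall x : R, 0 < x -> g y @[y --> x^'+] --> g x) ->
  measurable_fun (`]0, +oo[ : set R) g.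
Proof.
move=> gx; apply: (@measurable_fun_cvg _ _ _ _ (fun n x => g (right_step n x))).
  move=> n _ Y mY; apply: measurableI => //.
  exact: (measurable_right_step n (g @^-1` Y)).
move=> x; rewrite /= in_itv/= andbT => x0.
by apply: right_step_cvg; [exact: ltW|exact: gx].
Qed.

Lemma right_continuous_strongly_measurable {H : hilbertType R} (g : R -> H) :
  (forall x : R, 0 < x -> g y @[y --> x^'+] --> g x) -> strongly_measurable g.
Proof.
move=> gx; exists (fun n x => if x < n.+1%:R then g (right_step n x) else 0).
split=> [n|].
  split.
    pose B := ((n.+1 * n.+1)%N.+1).
    apply: (@sub_finite_set _ _ ([set 0] `|`
        ((fun k => g (k.+1%:R / n.+1%:R)) @` `I_B))); last first.
      by rewrite finite_setU; split; [exact: finite_set1|exact/finite_image/finite_II].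
    move=> _ [x _ <-] /=; case: ifPn => [xn|_]; [right|by left].
    exists (Num.truncn (x * n.+1%:R)) => //=; rewrite /B ltnS truncn_le_nat.
    apply: (@lt_trans _ _ (n.+1 * n.+1)%:R); last by rewrite ltr_nat.
    by rewrite natrM ltr_pM2r ?ltr0n.
  move=> y; rewrite (_ : _ @^-1` _ =
      ([set x | x < n.+1%:R] `&` [set x | g (right_step n x) = y]) `|`
      ([set x | n.+1%:R <= x] `&` [set x | 0 = y])).
    apply: measurableU; apply: measurableI.
    - rewrite (_ : [set x | _] = [set` `]-oo, n.+1%:R[]); first exact: measurable_itv.
      by apply/seteqP; split=> x /=; rewrite in_itv.
    - exact: (measurable_right_step n (g @^-1` [set y])).
    - rewrite (_ : [set x | _] = [set` `[n.+1%:R, +oo[]); first exact: measurable_itv.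
      by apply/seteqP; split=> x /=; rewrite in_itv/= andbT.
    - have [y0|y0] := pselect (0 = y).
        by rewrite (_ : [set x | _] = setT); [exact: measurableT|apply/seteqP; split].
      by rewrite (_ : [set x | _] = set0); [exact: measurable0|apply/seteqP; split].
  apply/seteqP; split=> x /=; case: ltP => xn.
  - by left.
  - by right.
  - by case=> [[]//|[]].
  - by case=> [[]//|[]].
exists set0; split; [exact: measurable0|exact: measure0|].
move=> x /= xn; apply: xn => x0.
have := @right_step_cvg _ g x (ltW x0) (gx x x0).
apply: cvg_trans; apply: near_eq_cvg; near=> n; rewrite ifT//.
apply: (@lt_trans _ _ n%:R); last by rewrite ltr_nat.
by near: n; exact: nbhs_infty_gtr.
Unshelve. all: by end_near. Qed.

End right_continuous.

Section right_ftc.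
Context {R : realType}.
Local Notation mu := (@lebesgue_measure R).

Section bounded_integrand.
Variables (W : R -> R) (a b M : R).
Hypothesis mW : measurable_fun (`[a, b] : set R) W.
Hypothesis WM : forall x, a <= x <= b -> `|W x| <= M.

Lemma bounded_integrable : mu.-integrable `[a, b] (EFin \o W).
Proof.
apply: measurable_bounded_integrable => //; first exact: lebesgue_itv_lty.
exists M; split; first exact: num_real.
move=> y My x; rewrite /= in_itv/= => xab.
exact: le_trans (WM xab) (ltW My).
Qed.

Local Notation G := (fun t => \int[mu]_(x in `[a, t]) W x).

Lemma Rintegral_increment s t m1 m2 : a <= s -> s <= t -> t <= b ->
  (forall x, s < x -> x <= t -> m1 <= W x <= m2) ->
  m1 * (t - s) <= G t - G s <= m2 * (t - s).
Proof.
move=> as_ st tb mW12.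
have iat : mu.-integrable `[a, t] (EFin \o W).
  apply: integrableS bounded_integrable => //.
  by move=> x /=; rewrite !in_itv/= => /andP[-> xt]; exact: le_trans tb.
rewrite Rintegral_itvB ?bnd_simp//.
have ist : mu.-integrable `]s, t] (EFin \o W).
  apply: integrableS iat => // x /=; rewrite !in_itv/= => /andP[sx ->].
  by rewrite andbT ltW// (le_lt_trans as_).
have must : mu `]s, t] = (t - s)%:E.
  rewrite lebesgue_measure_itv/= lte_fin; case: ltP => [_|ts]; first by rewrite -EFinB.
  by have -> : t = s; [apply/eqP; rewrite eq_le ts st|rewrite subrr].
have mlt : (mu `]s, t] < +oo)%E by rewrite must ltry.
have icst c : mu.-integrable `]s, t] (EFin \o (fun=> c)).
  apply: measurable_bounded_integrable => //.
  by exists `|c|; split; [exact: num_real|move=> y cy x _; exact: ltW].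
have cE c : \int[mu]_(x in `]s, t]) c = c * (t - s) by rewrite Rintegral_cst//= must.
rewrite -!cE; apply/andP; split; apply: le_Rintegral => // x;
  by rewrite /= in_itv/= => /andP[sx xt]; have /andP[] := mW12 x sx xt.
Qed.

(* The indefinite integral of [W] has the same right derivative as [F]. *)
Lemma right_ftc (F : R -> R) : a < b ->
  (forall t, a < t <= b -> F x @[x --> t^'-] --> F t) ->
  (forall t e, a <= t < b -> 0 < e -> exists2 d, 0 < d &
    forall s, 0 < s -> s < d -> `|F (t + s) - F t - W t * s| <= e * s) ->
  (forall t, a <= t < b -> W x @[x --> t^'+] --> W t) ->
  \int[mu]_(x in `[a, b]) W x = F b - F a.
Proof.
move=> ab cF dF cW; have -> : F b - F a = G b - G a.
  apply: (@right_derivative_unique _ F G W) => //; first exact: ltW.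
  - move=> t e tab e0; have /cvgrPdist_le/(_ _ e0) [d /= d0 hd] := cF t tab.
    exists d => // s /andP[as_ st] ts; apply: hd => //=.
    by rewrite gtr0_norm ?subr_gt0//; lra.
  - move=> t e /andP[at_ tb] e0.
    have Wa : `|W a| <= M by apply: WM; rewrite lexx ltW.
    have M0 : 0 <= M by exact: le_trans (normr_ge0 _) Wa.
    exists (e / (M + 1)) => [|s /andP[as_ st] ts]; first by rewrite divr_gt0// ltr_wpDl.
    have : - M * (t - s) <= G t - G s <= M * (t - s).
      apply: Rintegral_increment => //; first exact: ltW.
      move=> x sx xt; rewrite -ler_norml WM// (le_trans as_ (ltW sx)).
      exact: le_trans tb.
    have h : t - s < e / (M + 1) by lra.
    move: h; rewrite ltr_pdivlMr ?ltr_wpDl// => h.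
    rewrite mulNr -ler_norml => /le_trans; apply.
    have : 0 < t - s by rewrite subr_gt0.
    by lra.
  - move=> t e /andP[at_ tb] e0.
    have tab : a <= t < b by rewrite at_.
    have [d d0 hd] := (right_cvgP _ _ _).1 (cW t tab) e e0.
    exists (Num.min d (b - t)) => [|s s0]; first by rewrite lt_min d0 subr_gt0.
    rewrite lt_min => /andP[sd sb].
    have : (W t - e) * (t + s - t) <= G (t + s) - G t <= (W t + e) * (t + s - t).
      apply: Rintegral_increment => //; [lra|lra|].
      move=> x tx xts; have [xts'|xts'] := eqVneq x (t + s).
        by have := hd s s0 sd; rewrite -xts' ler_norml => /andP[? ?]; apply/andP; split; lra.
      have := hd (x - t); rewrite subr_gt0 (addrC t) subrK => /(_ tx) h.
      have := h ltac:(lra); rewrite ler_norml => /andP[? ?]; apply/andP; split; lra.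
    rewrite (addrC t) addrK => /andP[? ?].
    by rewrite ler_norml; apply/andP; split; lra.
by rewrite set_itv1 Rintegral_set1 subr0.
Qed.

End bounded_integrand.

Lemma right_derivative_weak (u g : R -> R) :
  (forall t, 0 < t -> {for t, continuous u}) ->
  (forall t, 0 < t -> g x @[x --> t^'+] --> g t) ->
  (forall t e, 0 < t -> 0 < e -> exists2 d, 0 < d &
    forall s, 0 < s -> s < d -> `|u (t + s) - u t - g t * s| <= e * s) ->
  (forall a b, 0 < a -> a <= b -> exists M, forall x, a <= x <= b -> `|g x| <= M) ->
  forall eta, test_function eta ->
    \int[mu]_(x in `]0, +oo[) (u x * derive1 eta x) =
    - \int[mu]_(x in `]0, +oo[) (g x * eta x).
Proof.
move=> cu cg dg bg eta [seta [a0 [b0 [a00 supp]]]].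
pose a := a0 / 2; pose b := Num.max a0 b0 + 1.
have a_gt0 : 0 < a by rewrite divr_gt0.
have ab : a < b.
  have : a0 <= Num.max a0 b0 by rewrite le_max lexx.
  by rewrite /a /b; lra.
have eta0 x : x < a0 \/ b0 < x -> eta x = 0.
  move=> h; apply/eqP; apply: contraT => /supp /andP[h1 h2].
  by case: h; rewrite ltNge ?h1 ?h2.
have aa0 : a < a0 by rewrite /a; lra.
have b0b : b0 < b.
  have : b0 <= Num.max a0 b0 by rewrite le_max lexx orbT.
  by rewrite /b; lra.
have deta (x : R) : is_derive x 1 eta (derive1 eta x).
  by rewrite derive1E; apply: derivableP; exact: (seta 0%N).
have ceta : continuous eta.
  by move=> x; apply/differentiable_continuous/derivable1_diffP; exact: (seta 0%N).
have cdeta : continuous (derive1 eta).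
  by move=> x; apply/differentiable_continuous/derivable1_diffP; exact: (seta 1%N).
have deta0 x : x < a0 \/ b0 < x -> derive1 eta x = 0.
  move=> h; have xE : \near x, 0 = eta x.
    case: h => h; near=> y; rewrite eta0//; [left|right]; near: y.
      exact: lt_nbhsl.
    exact: lt_nbhsr.
  have := near_eq_is_derive xE (is_derive_cst (0 : R) x 1).
  by rewrite derive1E => h'; exact: derive_val.
have Dsub : `[a, b] `<=` (`]0, +oo[ : set R).
  by move=> x /=; rewrite !in_itv/= andbT => /andP[ax _]; exact: lt_le_trans ax.
have out x : ~ [set` `[a, b]] x -> x < a0 \/ b0 < x.
  move=> /negP; rewrite /= in_itv/= negb_and -!ltNge => /orP[xa|bx].
    by left; exact: lt_trans aa0.
  by right; exact: lt_trans bx.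
rewrite (Rintegral_support Dsub); last by move=> x _ /out xo; rewrite deta0 ?mulr0.
rewrite (@Rintegral_support _ _ _ (fun x => g x * eta x) Dsub); last first.
  by move=> x _ /out xo; rewrite eta0 ?mulr0.
have [Mg gM] := bg a b a_gt0 (ltW ab).
have bounded (h : R -> R) : (forall x : R, 0 < x -> {for x, continuous h}) ->
    exists M, forall x, a <= x <= b -> `|h x| <= M.
  move=> ch; have ch' : {within `[a, b], continuous h}.
    apply: continuous_in_subspaceT => x; rewrite inE/= in_itv/= => /andP[ax _].
    by apply: ch; exact: lt_le_trans ax.
  have /compact_bounded[M [_ hM]] := continuous_compact ch' (@segment_compact _ a b).
  exists (M + 1) => x xab; apply: (hM (M + 1)); first by rewrite ltrDl.
  by exists x => //=; rewrite in_itv.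
have [Mu uM] := bounded u cu.
have [Me eM] := bounded eta (fun x _ => ceta x).
have [Md dM] := bounded (derive1 eta) (fun x _ => cdeta x).
have rc (h : R -> R) : (forall x : R, 0 < x -> {for x, continuous h}) ->
    forall x, 0 < x -> h y @[y --> x^'+] --> h x.
  by move=> ch x x0; apply: cvg_at_right_filter; exact: ch.
have rceta := rc eta (fun x _ => ceta x); have rcdeta := rc _ (fun x _ => cdeta x).
have rcu := rc u cu.
have rcge x : 0 < x -> g y * eta y @[y --> x^'+] --> g x * eta x.
  by move=> x0; apply: cvgM; [exact: cg|exact: rceta].
have rcud x : 0 < x -> u y * derive1 eta y @[y --> x^'+] --> u x * derive1 eta x.
  by move=> x0; apply: cvgM; [exact: rcu|exact: rcdeta].
pose W x := g x * eta x + u x * derive1 eta x.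
have rcW x : 0 < x -> W y @[y --> x^'+] --> W x.
  by move=> x0; apply: cvgD; [exact: rcge|exact: rcud].
have meas (h : R -> R) : (forall x, 0 < x -> h y @[y --> x^'+] --> h x) ->
    measurable_fun (`[a, b] : set R) h.
  by move=> /right_continuous_measurable; exact: measurable_funS.
have geM x : a <= x <= b -> `|g x * eta x| <= Mg * Me.
  by move=> xab; rewrite normrM ler_pM// ?gM ?eM.
have udM x : a <= x <= b -> `|u x * derive1 eta x| <= Mu * Md.
  by move=> xab; rewrite normrM ler_pM// ?uM ?dM.
have WM x : a <= x <= b -> `|W x| <= Mg * Me + Mu * Md.
  by move=> xab; apply: le_trans (ler_normD _ _) _; rewrite lerD ?geM ?udM.
have ige := bounded_integrable (meas _ rcge) geM.
have iud := bounded_integrable (meas _ rcud) udM.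
have pos t : a <= t -> 0 < t by exact: lt_le_trans.
have : \int[mu]_(x in `[a, b]) W x = u b * eta b - u a * eta a.
  apply: (@right_ftc W a b _ (meas _ rcW) WM (fun x => u x * eta x)) => //.
  - move=> t /andP[at_ _]; have t0 := pos _ (ltW at_).
    by apply: cvg_at_left_filter; apply: cvgM; [exact: cu|exact: ceta].
  - move=> t e /andP[at_ _] e0; have t0 := pos _ at_.
    pose c := `|eta t| + 1 + `|g t| + `|u t|.
    have c0 : 0 < c by rewrite /c -!addrA ltr_wpDl// ltr_pwDl// addr_ge0.
    have q0 : 0 < e / c by rewrite divr_gt0.
    have [d1 d10 h1] := dg t _ t0 q0.
    have q1 : 0 < Num.min 1 (e / c) by rewrite lt_min ltr01.
    have [d2 d20 h2] := (right_cvgP _ _ _).1 (rceta t t0) _ q1.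
    have [d3 d30 h3] : exists2 d, 0 < d & forall s, 0 < s -> s < d ->
        `|eta (t + s) - eta t - derive1 eta t * s| <= e / c * s.
      have [ed eE] := deta t.
      have /cvgrPdist_le/(_ _ q0) : (fun h => h^-1 *: ((eta \o shift t) (h *: 1) - eta t))
          @ 0^' --> derive1 eta t by rewrite -eE.
      move=> [d /= d0 hd]; exists d => // s s0 sd.
      have := hd s; rewrite /ball/= sub0r normrN gtr0_norm// => /(_ sd (lt0r_neq0 s0)).
      rewrite [s *: 1]mulr1 (addrC s) => hs.
      have -> : eta (t + s) - eta t - derive1 eta t * s =
          - (derive1 eta t - s^-1 * (eta (t + s) - eta t)) * s.
        by field; rewrite lt0r_neq0.
      by rewrite normrM normrN (gtr0_norm s0) ler_pM2r.
    exists (Num.min d1 (Num.min d2 d3)) => [|s s0]; first by rewrite !lt_min d10 d20.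
    rewrite !lt_min => /and3P[sd1 sd2 sd3].
    have {}h1 := h1 s s0 sd1; have {}h3 := h3 s s0 sd3.
    have {}h2 := h2 s s0 sd2.
    have h21 : `|eta (t + s)| <= `|eta t| + 1.
      have : `|eta (t + s) - eta t| <= 1 by apply: le_trans h2 _; rewrite ge_min lexx.
      have := ler_normD (eta (t + s) - eta t) (eta t); rewrite subrK.
      by lra.
    have h22 : `|eta (t + s) - eta t| <= e / c.
      by apply: le_trans h2 _; rewrite ge_min lexx orbT.
    have -> : u (t + s) * eta (t + s) - u t * eta t - W t * s =
        (u (t + s) - u t - g t * s) * eta (t + s) +
        (g t * s * (eta (t + s) - eta t) +
         u t * (eta (t + s) - eta t - derive1 eta t * s)) by rewrite /W; ring.
    have -> : e * s = e / c * s * (`|eta t| + 1) + (`|g t| * s * (e / c) +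
        `|u t| * (e / c * s)).
      by rewrite /c; field; rewrite lt0r_neq0.
    apply: le_trans (ler_normD _ _) _; apply: lerD; first by rewrite normrM ler_pM.
    apply: le_trans (ler_normD _ _) _; apply: lerD.
      by rewrite !normrM (gtr0_norm s0) ler_wpM2l// mulr_ge0// ltW.
    by rewrite normrM ler_wpM2l.
  - by move=> t /andP[at_ _]; apply: rcW; exact: pos.
rewrite [eta b]eta0; last by right.
rewrite [eta a]eta0; last by left.
rewrite !mulr0 subrr RintegralD// => /eqP.
by rewrite addrC addr_eq0 => /eqP.
Unshelve. all: by end_near. Qed.

End right_ftc.

(** * Separation of closed convex sets *)

Section hahn_banach.
Context {R : realType} {E : lmodType R}.
Implicit Types p q : E -> R.

Definition sublinear p :=
  (forall x y, p (x + y) <= p x + p y) /\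
  (forall t x, 0 < t -> p (t *: x) <= t * p x).

Lemma sublinear0 p : sublinear p -> p 0 = 0.
Proof.
move=> [_ pZ]; have := pZ 2 0 ltac:(lra); have := pZ (1 / 2) 0 ltac:(lra).
by rewrite !scaler0; lra.
Qed.

Lemma sublinearN p x : sublinear p -> - p (- x) <= p x.
Proof.
move=> sp; have := sp.1 x (- x); rewrite subrr sublinear0//.
by lra.
Qed.

(* The greatest sublinear minorant of [q] whose value at [- y] is at most
   [- q y]. *)
Definition tilt q y x := inf [set q (x + t *: y) - t * q y | t in [set t | 0 <= t]].

Lemma tilt_lbound q y x : sublinear q ->
  lbound [set q (x + t *: y) - t * q y | t in [set t | 0 <= t]] (- q (- x)).
Proof.
move=> sq _ [t /= t0 <-].
have h : q (t *: y) <= q (x + t *: y) + q (- x).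
  by apply: le_trans (sq.1 _ _); rewrite addrAC subrr add0r.
suff : t * q y <= q (t *: y) by lra.
move: t0; rewrite le_eqVlt => /predU1P[<-|t0]; first by rewrite mul0r scale0r sublinear0.
have it0 : 0 < t^-1 by rewrite invr_gt0.
have := sq.2 _ (t *: y) it0; rewrite scalerA mulVf ?lt0r_neq0// scale1r.
by rewrite ler_pdivlMl.
Qed.

Lemma tilt_le_gen q y x t : sublinear q -> 0 <= t -> tilt q y x <= q (x + t *: y) - t * q y.
Proof.
move=> sq t0; apply: ge_inf; last by exists t.
by exists (- q (- x)); exact: tilt_lbound.
Qed.

Lemma tilt_le q y x : sublinear q -> tilt q y x <= q x.
Proof.
by move=> sq; have := tilt_le_gen y x sq (lexx 0); rewrite scale0r addr0 mul0r subr0.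
Qed.

Lemma tilt_ge q y x c :
  (forall t, 0 <= t -> c <= q (x + t *: y) - t * q y) -> c <= tilt q y x.
Proof.
move=> h; apply: lb_le_inf; last by move=> _ [t t0 <-]; exact: h.
by exists (q (x + 0 *: y) - 0 * q y); exists 0 => //=.
Qed.

Lemma tilt_sublinear q y : sublinear q -> sublinear (tilt q y).
Proof.
move=> sq; split=> [x1 x2|s x s0].
  rewrite -lerBlDr; apply: tilt_ge => t1 t10.
  rewrite lerBlDr -lerBlDl; apply: tilt_ge => t2 t20; rewrite lerBlDl.
  apply: le_trans (tilt_le_gen y _ sq (addr_ge0 t10 t20)) _.
  have := sq.1 (x1 + t1 *: y) (x2 + t2 *: y).
  by rewrite addrACA -scalerDl; lra.
rewrite mulrC -ler_pdivrMr//; apply: tilt_ge => t t0.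
rewrite ler_pdivrMr//; have st0 : 0 <= s * t by rewrite mulr_ge0// ltW.
apply: le_trans (tilt_le_gen y _ sq st0) _.
have := sq.2 s (x + t *: y) s0; rewrite scalerDr scalerA.
by lra.
Qed.

Lemma tiltN q y : sublinear q -> tilt q y (- y) <= - q y.
Proof.
move=> sq; have := tilt_le_gen y (- y) sq ler01.
by rewrite scale1r addNr sublinear0// sub0r mul1r.
Qed.

(* A minimal sublinear functional is linear, since it equals its tilts. *)
Lemma minimal_sublinear p : sublinear p -> exists q, [/\ sublinear q,
  forall x, q x <= p x & forall q', sublinear q' -> (forall x, q' x <= q x) ->
    forall x, q x <= q' x].
Proof.
move=> sp; pose T := {q | sublinear q /\ forall x, q x <= p x}.
pose leT (q1 q2 : T) := `[< forall x, sval q2 x <= sval q1 x >].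
have Tp : sublinear p /\ forall x, p x <= p x by split.
have [||| [q [sq qp]] qmin] := @ZL_preorder T (exist _ p Tp) leT.
- by move=> q; apply/asboolP => x.
- move=> q1 q2 q3 /asboolP h1 /asboolP h2; apply/asboolP => x.
  exact: le_trans (h2 x) (h1 x).
- move=> S Stot; have [[q0 Sq0]|S0] := pselect (S !=set0); last first.
    by exists (exist _ p Tp) => q Sq; exfalso; apply: S0; exists q.
  pose V x := [set sval q x | q in S].
  have lbV x : lbound (V x) (- p (- x)).
    move=> _ [q Sq <-]; have [sq qp] := svalP q.
    by apply: le_trans (sublinearN x sq); rewrite lerN2.
  have hV x : has_inf (V x) by split; [exists (sval q0 x), q0|exists (- p (- x))].
  pose m x := inf (V x).
  have mle (k : T) x : S k -> m x <= sval k x.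
    by move=> Sk; apply: ge_inf; [exact: (hV x).2|exists k].
  have sm : sublinear m.
    split=> [x y|t x t0].
      apply/ler_addgt0Pr => e e0; have e2 : 0 < e / 2 by rewrite divr_gt0.
      have [_ [q1 Sq1 <-] h1] := inf_adherent e2 (hV x).
      have [_ [q2 Sq2 <-] h2] := inf_adherent e2 (hV y).
      rewrite -/(m x) in h1; rewrite -/(m y) in h2.
      have [/asboolP l|/asboolP l] := Stot _ _ Sq1 Sq2.
        have := mle q2 (x + y) Sq2; have := (svalP q2).1.1 x y; have := l x.
        by lra.
      have := mle q1 (x + y) Sq1; have := (svalP q1).1.1 x y; have := l y.
      by lra.
    rewrite mulrC -ler_pdivrMr//; apply: lb_le_inf; first exact: (hV x).1.
    move=> _ [q Sq <-]; rewrite ler_pdivrMr// mulrC.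
    by apply: le_trans (mle q _ Sq) _; exact: (svalP q).1.2.
  have mp : sublinear m /\ forall x, m x <= p x.
    split=> // x; apply: le_trans (mle q0 x Sq0) _.
    by have [_] := svalP q0.
  by exists (exist _ m mp) => q Sq; apply/asboolP => x; exact: mle.
exists q; split=> // q' sq' q'q x.
have Tq' : sublinear q' /\ forall x, q' x <= p x.
  by split=> // y; exact: le_trans (q'q y) (qp y).
have /asboolP := qmin (exist _ q' Tq') (introT (asboolP _) q'q).
exact.
Qed.

Theorem hahn_banach p z : sublinear p -> exists f : {linear E -> R^o},
  (forall x, f x <= p x) /\ f z = p z.
Proof.
move=> sp; have [q [sq qp qmin]] := minimal_sublinear (tilt_sublinear z sp).
have qD x y : q (x + y) = q x + q y.
  apply/eqP; rewrite eq_le sq.1/=.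
  have := qmin _ (tilt_sublinear y sq) (fun x => tilt_le y x sq) x.
  have := tilt_le_gen y x sq ler01; rewrite scale1r mul1r.
  by lra.
have qN x : q (- x) = - q x.
  by have := qD x (- x); rewrite subrr sublinear0//; lra.
have qP t x : 0 < t -> q (t *: x) = t * q x.
  move=> t0; apply/eqP; rewrite eq_le sq.2//=.
  have it0 : 0 < t^-1 by rewrite invr_gt0.
  have := sq.2 _ (t *: x) it0; rewrite scalerA mulVf ?lt0r_neq0// scale1r.
  by rewrite ler_pdivlMl.
have qZ t x : q (t *: x) = t * q x.
  have [t0|t0|->] := ltgtP t 0; [|exact: qP|by rewrite scale0r mul0r sublinear0].
  by have := qP (- t) x; rewrite oppr_gt0 scaleNr qN => /(_ t0); lra.
have lq : linear (q : E -> R^o) by move=> t x y; rewrite qD qZ.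
pose f : {linear E -> R^o} := HB.pack (q : E -> R^o) (GRing.isLinear.Build R E R^o *:%R q lq).
have fE x : f x = q x :> R by [].
exists f; split=> [x|]; first by rewrite fE (le_trans (qp x))// tilt_le.
apply/eqP; rewrite fE eq_le (le_trans (qp z)) ?tilt_le//=.
by rewrite -lerN2 -qN (le_trans (qp _))// tiltN.
Qed.

End hahn_banach.

Definition convex_subset (R : realType) (E : lmodType R) (C : set E) :=
  forall u v (t : R), C u -> C v -> 0 < t < 1 -> C (t *: u + (1 - t) *: v).

Section separation.
Context {R : realType} {E : tvsType R}.
Implicit Types (x y z : E) (C W : set E).

Lemma scale_nbhs0 W x : nbhs (0 : E) W -> exists2 e : R, 0 < e &
  forall t : R, `|t| < e -> W (t *: x).
Proof.
move=> W0; have /= := @scale_continuous R E (0, x) W.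
rewrite scale0r => /(_ W0)[]/= B [[e /= e0 B1] B2] BW.
exists e => // t te; apply: (BW (t, x)); split; last exact: nbhs_singleton.
by apply: B1; rewrite /ball/= sub0r normrN.
Qed.

Lemma affine_nbhs W (a : R) x y : nbhs (a *: x + y) W ->
  nbhs x [set z | W (a *: z + y)].
Proof.
move=> aW; have /= := @add_continuous E (a *: x, y) W.
move=> /(_ aW)[]/= B [B1 B2] BW.
have /= := @scale_continuous R E (a, x) B.1 => /(_ B1)[]/= C [C1 C2] CB.
apply: filterS C2 => z Cz /=; apply: (BW (a *: z, y)); split; last exact: nbhs_singleton.
by apply: (CB (a, z)); split=> //; exact: nbhs_singleton.
Qed.

Lemma locally_convex_nbhs0 U : nbhs (0 : E) U ->
  exists W : set E, [/\ W `<=` U, nbhs (0 : E) W, W 0 & convex_subset W].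
Proof.
move=> U0; have [B Bconv [Bopen Bbasis]] := @locally_convex R E.
have [W [BW W0] WU] := Bbasis 0 _ U0.
exists W; split=> //; first by apply: open_nbhs_nbhs; split=> //; exact: Bopen.
move=> u v t uW vW /andP[t0 t1].
have BW' : W \in B by rewrite inE.
have := (convex_setW W).1 (Bconv W BW') u v.
rewrite !inE => /(_ uW vW).
have ti : Itv.spec (@Itv.num_sem R) (Itv.Real `[0%Z, 1%Z]) t.
  by rewrite /= /Itv.num_sem/= num_real/= in_itv/= !ltW.
move=> /(_ (Itv.mk ti) t0 t1).
by rewrite inE.
Qed.

Definition gauge_set (U : set E) x := [set t : R | 0 < t /\ U (t^-1 *: x)].
Definition gauge (U : set E) x := inf (gauge_set U x).

Lemma gauge_sublinear U : convex_subset U -> nbhs (0 : E) U -> sublinear (gauge U).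
Proof.
move=> cU U0.
have lb x : has_lbound (gauge_set U x) by exists 0 => t [/ltW].
have ne x : gauge_set U x !=set0.
  have [e e0 he] := scale_nbhs0 x U0; exists (2 / e).
  split; first by rewrite divr_gt0.
  apply: he; rewrite invf_div gtr0_norm ?divr_gt0//.
  by rewrite ltr_pdivrMr//; lra.
split=> [x y|t x t0].
  apply/ler_addgt0Pr => e e0; have e2 : 0 < e / 2 by rewrite divr_gt0.
  have [s1 [s10 U1] h1] := inf_adherent e2 (conj (ne x) (lb x)).
  have [s2 [s20 U2] h2] := inf_adherent e2 (conj (ne y) (lb y)).
  have s0 : 0 < s1 + s2 by rewrite addr_gt0.
  apply: (@le_trans _ _ (s1 + s2)); last by rewrite /gauge; lra.
  apply: ge_inf => //; split=> //.
  have := cU _ _ (s1 / (s1 + s2)) U1 U2.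
  rewrite divr_gt0// ltr_pdivrMr// mul1r ltrDl s20 => /(_ isT).
  have -> : 1 - s1 / (s1 + s2) = s2 / (s1 + s2) by field; rewrite lt0r_neq0.
  rewrite !scalerA mulrAC mulfV ?lt0r_neq0// [s2 / _ / _]mulrAC mulfV ?lt0r_neq0//.
  by rewrite !mul1r scalerDr.
rewrite mulrC -ler_pdivrMr//; apply: lb_le_inf; first exact: ne.
move=> s [s0 Us]; rewrite ler_pdivrMr//; apply: ge_inf => //; split.
  by rewrite mulr_gt0.
by rewrite invfM scalerA -mulrA mulVf ?lt0r_neq0// mulr1.
Qed.

Lemma gauge_le1 U x : U x -> gauge U x <= 1.
Proof.
move=> Ux; apply: ge_inf; first by exists 0 => t [/ltW].
by split=> //; rewrite invr1 scale1r.
Qed.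

Lemma bounded_above_continuous (f : {linear E -> R^o}) W :
  nbhs (0 : E) W -> (forall x, W x -> f x <= 1) -> continuous f.
Proof.
move=> W0 fW x; apply/cvgrPdist_le => e e0.
have n1 : nbhs x [set z | W (e^-1 *: z + - (e^-1 *: x))].
  by apply: affine_nbhs; rewrite subrr.
have n2 : nbhs x [set z | W (- e^-1 *: z + - (- e^-1 *: x))].
  by apply: affine_nbhs; rewrite subrr.
have fZ a u : f (a *: u) = a * f u :> R by rewrite linearZ.
have fB u v : f (u - v) = f u - f v :> R by rewrite linearB.
apply: filterS2 n1 n2 => z /= /fW h1 /fW h2.
have {}h1 : e^-1 * (f z - f x) <= 1 by move: h1; rewrite fB !fZ mulrBr.
have {}h2 : e^-1 * (f x - f z) <= 1.
  by move: h2; rewrite fB !fZ !mulNr -opprD -mulrBr -mulrN opprB.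
move: h1 h2; rewrite !ler_pdivrMl// !mulr1 => h1 h2.
by rewrite ler_norml; apply/andP; split; lra.
Qed.

Theorem separation C (x0 : E) : closed C -> convex_subset C -> ~ C x0 ->
  exists (f : topdual E) (d : R), 0 < d /\ forall c, C c -> sval f c <= sval f x0 - d.
Proof.
move=> clC cC Cx0; have [[c0 Cc0]|C0] := pselect (C !=set0); last first.
  have lin0 : linear ((fun=> 0) : E -> R^o) by move=> a u v; rewrite scaler0 addr0.
  pose f0 : {linear E -> R^o} :=
    HB.pack ((fun=> 0) : E -> R^o) (GRing.isLinear.Build R E R^o *:%R _ lin0).
  have cf0 : continuous f0 by exact: cst_continuous.
  by exists (exist _ f0 cf0), 1; split=> // c Cc; exfalso; apply: C0; exists c.
have n0 : nbhs (0 : E) [set w | (~` C) ((-1) *: w + x0)].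
  apply: affine_nbhs; rewrite scaler0 add0r; apply: open_nbhs_nbhs.
  by split=> //; exact: closed_openC.
have [W [WC W0 W00 cW]] := locally_convex_nbhs0 n0.
pose U := [set u | exists c w, [/\ C c, W w & u = c - c0 + w]].
have UW w : W w -> U w by move=> Ww; exists c0, w; split=> //; rewrite subrr add0r.
have U0 : nbhs (0 : E) U by apply: filterS W0.
have cU : convex_subset U.
  move=> _ _ t [c1 [w1 [Cc1 Ww1 ->]]] [c2 [w2 [Cc2 Ww2 ->]]] t01.
  exists (t *: c1 + (1 - t) *: c2), (t *: w1 + (1 - t) *: w2).
  split; [exact: cC|exact: cW|].
  rewrite !scalerDr !scalerN addrACA; congr (_ + _).
  rewrite addrACA -opprD -scalerDl (_ : t + (1 - t) = 1) ?scale1r//.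
  by rewrite addrC subrK.
pose z := x0 - c0.
have pz : 1 <= gauge U z.
  apply: lb_le_inf.
    have [e e0 he] := scale_nbhs0 z U0; exists (2 / e); split; first by rewrite divr_gt0.
    by apply: he; rewrite invf_div gtr0_norm ?divr_gt0// ltr_pdivrMr//; lra.
  move=> t [t0 Ut]; rewrite leNgt; apply/negP => t1.
  have U00 : U 0 by exact: UW.
  have := cU _ _ t Ut U00; rewrite t0 t1 => /(_ isT).
  rewrite scaler0 addr0 scalerA mulfV ?lt0r_neq0// scale1r => -[c [w [Cc Ww zE]]].
  apply: (WC w Ww); rewrite scaleN1r.
  suff -> : - w + x0 = c by [].
  have -> : x0 = c + w.
    by apply: (addIr (- c0)); rewrite -/z zE addrAC.
  by rewrite addrCA addNr addr0.
have [f [fp fz]] := hahn_banach z (gauge_sublinear cU U0).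
have fU u : U u -> f u <= 1 by move=> Uu; exact: le_trans (fp u) (gauge_le1 Uu).
have cf : continuous f by apply: (bounded_above_continuous W0) => w /UW; exact: fU.
have [e e0 he] := scale_nbhs0 z W0.
exists (exist _ f cf), (e / 2); split; first by rewrite divr_gt0.
move=> c Cc /=.
have Wz : W ((e / 2) *: z) by apply: he; rewrite gtr0_norm ?divr_gt0//; lra.
have : f (c - c0 + (e / 2) *: z) <= 1 by apply: fU; exists c, ((e / 2) *: z).
have fz1 : 1 <= f z :> R by rewrite fz.
have -> : f (c - c0 + (e / 2) *: z) = (f c - f c0 + e / 2 * f z)%R :> R.
  by rewrite linearD linearB linearZ.
have : f z = (f x0 - f c0)%R :> R by rewrite linearB.
have : e / 2 * 1 <= e / 2 * f z by rewrite ler_pM2l// divr_gt0.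
move: fz1; move: (f z : R) (f c : R) (f c0 : R) (f x0 : R) => a1 a2 a3 a4.
by lra.
Qed.

End separation.

(** * Functionals elliptic with respect to j *)

Section weak_topology.
Context {R : realType} {E : tvsType R}.

Lemma weak_functional_continuous (f : topdual E) :
  continuous (sval f : weak E -> R^o).
Proof.
move=> x; have wx : (fun y : weak E => y) y @[y --> x] --> x by exact: cvg_id.
have := (@cvg_sup _ _ _ (nbhs x) x _).1 wx f.
move=> h B fB; apply: h.
exact: (@initial_continuous E R^o (sval f : E -> R^o) x B fB).
Qed.

Lemma nbhs_weak_nbhs (x : E) (B : set E) : nbhs (x : weak E) B -> nbhs x B.
Proof.
have : (nbhs x : set_system (weak E)) --> (x : weak E).
  apply/cvg_sup => f B' xB'.
  have : @nbhs _ (initial_topology (sval f)) x B' by [].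
  rewrite nbhsE => -[N [[U oU UN] Nx] NB].
  have xU : nbhs x (sval f @^-1` U).
    apply: (svalP f); apply: open_nbhs_nbhs; split=> //.
    by move: Nx; rewrite -UN.
  by rewrite nbhs_simpl; apply: filterS xU => y Uy; apply: NB; rewrite -UN.
exact.
Qed.

End weak_topology.

Section lower_limit.
Context {R : realType}.
Implicit Types (f : R -> \bar R).
Local Open Scope ereal_scope.

Lemma limf_einf_geP f (a : R) : a%:E <= limf_einf f (0%R : R)^'+ <->
  forall e : R, (0 < e)%R -> exists2 d : R, (0 < d)%R &
    forall t : R, (0 < t)%R -> (t < d)%R -> (a - e)%:E <= f t.
Proof.
rewrite limf_einfE; split=> [af e e0|af].
  have : (a - e)%:E < ereal_sup [set ereal_inf (f @` V) | V in (0%R : R)^'+].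
    by apply: lt_le_trans af; rewrite lte_fin ltrBlDr ltrDl.
  move=> /ereal_sup_gt[_ [V [/= d d0 dV] <-]] aV.
  exists d => // t t0 td; apply: le_trans (ltW aV) _; apply: ereal_inf_lbound.
  exists t => //; apply: dV => //=.
  by rewrite sub0r normrN gtr0_norm.
apply/lee_subgt0Pr => e e0; have [d d0 hd] := af e e0.
apply: le_ereal_sup_tmp; exists (ereal_inf (f @` [set t : R | (0 < t < d)%R])).
  exists [set t : R | (0 < t < d)%R] => //.
  exists d => //= t /=; rewrite sub0r normrN => td t0.
  by rewrite t0 -(gtr0_norm t0).
rewrite -EFinB; apply: le_ereal_inf_tmp => _ [t /andP[t0 td] <-].
exact: hd.
Qed.

End lower_limit.

Section j_elliptic.
Context {R : realType} {V : tvsType R} {H : hilbertType R}.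
Variables (j : {linear V -> H}) (phi : V -> \bar R) (w : R).
Hypothesis j_continuous : continuous (j : weak V -> weak H).
Hypothesis phi_proper : proper_fun phi.
Hypothesis phi_lsc : lower_semicontinuous phi.
Hypothesis w_ge0 : 0 <= w.
Hypothesis phi_convex : econvex (jshift j phi w).
Hypothesis phi_coercive : coercive (jshift j phi w).

Let D : set V := effdom phi.
Let fr v : R := fine (phi v).

Lemma effdomE v : D v -> phi v = (fr v)%:E.
Proof.
move=> Dv; rewrite /fr fineK// fin_numE phi_proper.1/=.
by rewrite lt_eqF.
Qed.

Lemma effdom_semiconvex u v (t : R) : D u -> D v -> 0 < t < 1 ->
  D (t *: u + (1 - t) *: v) /\
  fr (t *: u + (1 - t) *: v) <= t * fr u + (1 - t) * fr v +
    w / 2 * (t * (1 - t)) * `|j u - j v| ^+ 2.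
Proof.
move=> Du Dv t01; have := phi_convex u v t01; rewrite /jshift (effdomE Du) (effdomE Dv).
set z := t *: u + _ => h.
have Dz : D z.
  rewrite /D /effdom/= ltNge; apply/negP => zy; move: h.
  by have -> : phi z = +oo%E by apply/eqP; rewrite -leye_eq.
split=> //; move: h; rewrite (effdomE Dz) -!EFinD lee_fin.
have -> : j z = t *: j u + (1 - t) *: j v by rewrite /z linearD !linearZ.
rewrite sqnormB sqnormD !normrZ !exprMn !real_normK ?num_real// !dotpZl !dotpZr.
by lra.
Qed.

Lemma j_dotp_continuous h : continuous (fun v : V => dotp (j v) h : R).
Proof.
have lh : linear ((fun x => dotp x h) : H -> R^o).
  by move=> a x y; rewrite dotpDl dotpZl.
pose fh : {linear H -> R^o} := HB.pack ((fun x => dotp x h) : H -> R^o)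
  (GRing.isLinear.Build R H R^o *:%R _ lh).
have cfh : continuous fh by exact: dotpl_continuous.
pose f : topdual H := exist _ fh cfh.
move=> v B vB; apply: nbhs_weak_nbhs.
exact: (j_continuous (weak_functional_continuous (f := f) vB)).
Qed.

Section penalised.
Variables (kappa : R) (g : H).
Hypothesis kappa_gt : w / 2 < kappa.

Let Psi v := fr v + kappa * `|j v - g| ^+ 2.
Let K c : set V := [set v | D v /\ Psi v <= c].

Lemma penalised_sublevel_closed c : closed (K c).
Proof.
have k0 : 0 < kappa by apply: le_lt_trans kappa_gt; rewrite divr_ge0.
rewrite -[K c]setCK; apply: open_closedC; rewrite openE => x Kx.
pose N := `|j x - g| ^+ 2.
have [al alx alc] : exists2 al : R, (al%:E < phi x)%E & c < al + kappa * N.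
  have [Dx|Dx] := pselect (D x).
    have cx : c < Psi x by rewrite ltNge; apply/negP => xc; apply: Kx.
    exists ((fr x + (c - kappa * N)) / 2); last first.
      by move: cx; rewrite /Psi -/N; lra.
    by rewrite (effdomE Dx) lte_fin; move: cx; rewrite /Psi -/N; lra.
  exists (c + 1).
    by apply: (@lt_le_trans _ _ +oo%E); [rewrite ltry|rewrite leNgt; apply/negP].
  have : 0 <= kappa * N by rewrite mulr_ge0 ?sqr_ge0// ltW.
  by lra.
have [B xB hB] := phi_lsc alx.
pose e := (al + kappa * N - c) / (2 * kappa).
have e0 : 0 < e by rewrite divr_gt0 ?subr_gt0// mulr_gt0.
have cJ : (dotp (j v) (j x - g) : R) @[v --> x] --> dotp (j x) (j x - g).
  exact: j_dotp_continuous.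
have /cvgrPdist_lt/(_ _ e0) xJ := cJ.
apply: filterS2 xB xJ => y /hB al_y; rewrite ltr_norml => /andP[_ jy] [Dy yc].
have al_fr : al < fr y by move: al_y; rewrite (effdomE Dy) lte_fin.
have Ny : N - 2 * e < `|j y - g| ^+ 2.
  have := sqr_ge0 `|(j y - g) - (j x - g)|; rewrite sqnormB -/N dotpDl dotpNl.
  have NE : N = dotp (j x) (j x - g) - dotp g (j x - g).
    by rewrite /N -dotpp {1}dotpDl dotpNl.
  by move: jy NE; lra.
have ek : kappa * (2 * e) = al + kappa * N - c.
  by rewrite /e; field; rewrite lt0r_neq0.
have : kappa * (N - 2 * e) < kappa * `|j y - g| ^+ 2 by rewrite ltr_pM2l.
by move: yc; rewrite /Psi; lra.
Qed.

Lemma penalised_sublevel_convex c : convex_subset (K c).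
Proof.
move=> u v t [Du uc] [Dv vc] t01; have [Dz hz] := effdom_semiconvex Du Dv t01.
split=> //; move: t01 => /andP[t0 t1]; rewrite /Psi.
have -> : j (t *: u + (1 - t) *: v) - g = t *: (j u - g) + (1 - t) *: (j v - g).
  rewrite linearD !linearZ/= !scalerBr addrACA -opprD -scalerDl.
  by rewrite (_ : t + (1 - t) = 1) ?scale1r//; ring.
move: hz uc vc; rewrite /Psi.
have -> : j u - j v = (j u - g) - (j v - g) by rewrite opprB addrA subrK.
move: (j u - g) (j v - g) (fr _) (fr u) (fr v) => a b fz fu fv hz uc vc.
have id : `|t *: a + (1 - t) *: b| ^+ 2 =
    t * `|a| ^+ 2 + (1 - t) * `|b| ^+ 2 - t * (1 - t) * `|a - b| ^+ 2.
  rewrite sqnormB sqnormD !normrZ !exprMn !real_normK ?num_real// !dotpZl !dotpZr.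
  by ring.
rewrite id; have t1' : 0 < 1 - t by rewrite subr_gt0.
have : 0 <= (kappa - w / 2) * (t * (1 - t) * `|a - b| ^+ 2).
  by rewrite !mulr_ge0 ?sqr_ge0// ?subr_ge0// ltW.
have := ler_wpM2l (ltW t0) uc; have := ler_wpM2l (ltW t1') vc.
by lra.
Qed.

Lemma penalised_sublevel_bounded c : exists c' : R,
  K c `<=` [set v | (jshift j phi w v <= c'%:E)%E].
Proof.
have k0 : 0 < kappa by apply: le_lt_trans kappa_gt; rewrite divr_ge0.
have q0 : 0 < kappa - w / 2 by rewrite subr_gt0.
exists (c + kappa ^+ 2 * `|g| ^+ 2 / (kappa - w / 2)) => v [Dv vc].
rewrite /= /jshift (effdomE Dv) -EFinD lee_fin; move: vc; rewrite /Psi.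
rewrite sqnormB; have := dotp_le (j v) g.
set a := `|j v|; set b := `|g| => dab.
have h : 2 * kappa * (a * b) <= (kappa - w / 2) * a ^+ 2 + kappa ^+ 2 * b ^+ 2 / (kappa - w / 2).
  move: q0; generalize (kappa - w / 2) => q q0.
  rewrite -subr_ge0 (_ : _ - _ = (q * a - kappa * b) ^+ 2 / q).
    by rewrite divr_ge0 ?sqr_ge0// ltW.
  by field; rewrite lt0r_neq0.
have := ler_wpM2l (ltW k0) dab.
have : 0 <= kappa * b ^+ 2 by rewrite mulr_ge0 ?sqr_ge0// ltW.
by lra.
Qed.

(* A weak cluster point of the filter generated by the sublevels lies in all of
   them, these being weakly closed. *)
Lemma penalised_minimizer : exists2 u, D u & forall v, D v -> Psi u <= Psi v.
Proof.
have [v0 Dv0] := phi_proper.2.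
pose F : set_system (weak V) := filter_from D (fun v => K (Psi v)).
have FF : ProperFilter F.
  apply: filter_from_proper; last by move=> v Dv; exists v; split.
  apply: filter_from_filter; first by exists v0.
  move=> v1 v2 Dv1 Dv2; have [h|h] := leP (Psi v1) (Psi v2).
    by exists v1 => // y [Dy y1]; split; split=> //; exact: le_trans h.
  by exists v2 => // y [Dy y2]; split; split=> //; exact: le_trans (ltW h).
have [c Kc] := penalised_sublevel_bounded (Psi v0).
have [U cU [Ucompact _]] := phi_coercive c.
have FU : F U by exists v0 => // y /Kc; exact: cU.
have [p [_ clp]] := Ucompact F FF FU.
have Kp v : D v -> K (Psi v) p.
  move=> Dv; apply: contrapT => Kp.
  have [f [d [d0 hf]]] :=
    separation (penalised_sublevel_closed (c := _)) (penalised_sublevel_convex (c := _)) Kp.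
  have FK : F (K (Psi v)) by exists v.
  have np : @nbhs _ (weak V) p [set y | sval f p - d < sval f y].
    have cf : sval f y @[y --> (p : weak V)] --> (sval f p : R^o).
      exact: weak_functional_continuous.
    have /cvgrPdist_lt/(_ _ d0) := cf; apply: filterS => y.
    by rewrite ltr_norml /= => /andP[_]; rewrite ltrBlDr -ltrBlDl addrC.
  have [y [Ky /= fy]] := clp _ _ FK np.
  by have := hf y Ky; rewrite leNgt fy.
by exists p; [exact: (Kp v0 Dv0).1|move=> v /Kp[]].
Qed.

End penalised.

Let A := jsubgradient j phi.

Lemma elliptic_resolvent (l : R) y : 0 < l -> l * w < 1 -> exists u,
  [/\ D u, A (j u) (l^-1 *: (y - j u)) & forall v, D v ->
    fr u + (2 * l)^-1 * `|j u - y| ^+ 2 <= fr v + (2 * l)^-1 * `|j v - y| ^+ 2].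
Proof.
move=> l0 lw; pose k := (2 * l)^-1.
have k0 : 0 < k by rewrite invr_gt0 mulr_gt0.
have wk : w / 2 < k.
  by rewrite /k invfM mulrC ltr_pM2l ?invr_gt0// -(ltr_pM2l l0) mulfV ?lt0r_neq0.
have [u Du umin] := penalised_minimizer y wk.
exists u; split=> //; exists u => //; split=> // v.
apply/limf_einf_geP => e e0.
pose N := `|j v| ^+ 2; have N0 : 0 <= N by exact: sqr_ge0.
have kN0 : 0 < k * N + 1 by rewrite ltr_wpDl// mulr_ge0// ltW.
exists (e / (k * N + 1)); first by rewrite divr_gt0.
move=> t t0; rewrite ltr_pdivlMr// => te.
have [Dt|Dt] := pselect (D (u + t *: v)); last first.
  have -> : phi (u + t *: v) = +oo%E.
    by apply/eqP; rewrite -leye_eq leNgt; apply/negP.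
  by rewrite (effdomE Du) addye// gt0_mulye ?leey// lte_fin invr_gt0.
rewrite (effdomE Dt) (effdomE Du) -EFinB -EFinM lee_fin ler_pdivlMr//.
have := umin _ Dt.
have -> : j (u + t *: v) - y = (j u - y) + t *: j v by rewrite linearD linearZ/= addrAC.
rewrite -/k (sqnormD (j u - y)) normrZ exprMn real_normK ?num_real// dotpZr -/N dotpZl.
have -> : l^-1 = 2 * k by rewrite /k; field; rewrite lt0r_neq0.
rewrite -[y - j u]opprB dotpNl; move: (dotp _ _) => p h.
have : t * (t * (k * N + 1)) < t * e by rewrite ltr_pM2l.
by have := mulr_gt0 t0 t0; nra.
Qed.

(* The difference quotient in the direction [v - u] is bounded above by
   semiconvexity. *)
Lemma jsubgradient_ineq x f : A x f -> exists u, [/\ D u, j u = x &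
  forall v, D v -> fr u + dotp f (j v - x) - w / 2 * `|j v - x| ^+ 2 <= fr v].
Proof.
move=> [u Du [jux hu]]; exists u; split=> // v Dv.
apply/ler_addgt0Pr => e e0.
have [d d0 hd] := (limf_einf_geP _ _).1 (hu (v - u)) e e0.
pose t := Num.min (d / 2) (1 / 2).
have t0 : 0 < t by rewrite lt_min !divr_gt0.
have td : t < d.
  by apply: (@le_lt_trans _ _ (d / 2)); [by rewrite ge_min lexx|lra].
have t1 : t < 1.
  by apply: (@le_lt_trans _ _ (1 / 2)); [by rewrite ge_min lexx orbT|lra].
have t01 : 0 < t < 1 by apply/andP.
have := hd t t0 td.
have -> : u + t *: (v - u) = t *: v + (1 - t) *: u.
  by rewrite scalerBr scalerBl scale1r addrCA.
have [Dz hz] := effdom_semiconvex Dv Du t01.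
rewrite (effdomE Dz) (effdomE Du) -EFinB -EFinM lee_fin ler_pdivlMr// linearB/= jux.
move: hz; rewrite jux; move: (dotp _ _) (fr (_ + _)) (`|_| ^+ 2) (sqr_ge0 `|j v - x|) => p z N N0 hz h.
have : t * (p - e) <= t * (fr v - fr u + w / 2 * N).
  have : 0 <= w / 2 * (t * t) * N by rewrite !mulr_ge0// ltW.
  by lra.
rewrite ler_pM2l//; by lra.
Qed.

Lemma jsubgradient_potential : exists psi : H -> R, forall x f y g,
  A x f -> A y g ->
  psi x + dotp f (y - x) - w / 2 * `|y - x| ^+ 2 <= psi y.
Proof.
have ch x : exists u, A x !=set0 -> [/\ D u, j u = x &
    forall v, D v -> j v = x -> fr u <= fr v].
  have [[f Af]|nA] := pselect (A x !=set0); last by exists 0.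
  have [u [Du ju uP]] := jsubgradient_ineq Af.
  exists u => _; split=> // v Dv jv; have := uP v Dv.
  by rewrite jv subrr dotp0r normr0 expr0n/= mulr0 subr0 addr0.
have [s sP] := choice ch.
exists (fr \o s) => x f y g Af Ag /=.
have [_ _ xmin] := sP x (ex_intro _ f Af).
have [Dy jy _] := sP y (ex_intro _ g Ag).
have [u [Du ju uP]] := jsubgradient_ineq Af.
have := uP _ Dy; rewrite jy; apply: le_trans.
by rewrite !lerD2r; exact: xmin.
Qed.

Lemma jsubgradient_range (l : R) : 0 < l -> l * w < 1 ->
  forall y, exists x, A x (l^-1 *: (y - x)).
Proof. by move=> l0 lw y; have [u [_ Au _]] := elliptic_resolvent y l0 lw; exists (j u). Qed.

Lemma closure_reldom_jsubgradient : closure (reldom A) = closure (j @` D).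
Proof.
apply/seteqP; split=> [|x].
  apply: closureS => x [f [u Du [ju _]]]; by exists u.
move=> /closure_normP jDx; apply/closure_normP => e e0.
have e20 : 0 < e / 2 by rewrite divr_gt0.
have [_ [v Dv <-] xv] := jDx _ e20.
have wk0 : w / 2 < w / 2 + 1 by rewrite ltrDl.
have [u1 Du1 u1min] := penalised_minimizer (j v) wk0.
pose c := fr v - (fr u1 + (w / 2 + 1) * `|j u1 - j v| ^+ 2).
have c0 : 0 <= c.
  by have := u1min v Dv; rewrite subrr normr0 expr0n/= mulr0 addr0 subr_ge0.
pose k := w / 2 + 1 + (c + 1) / (e / 2) ^+ 2.
have ck : 0 < (c + 1) / (e / 2) ^+ 2 by rewrite divr_gt0 ?exprn_gt0// ltr_wpDl.
have k0 : 0 < k by rewrite /k; have := w_ge0; lra.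
have l0 : 0 < (2 * k)^-1 by rewrite invr_gt0 mulr_gt0.
have lw : (2 * k)^-1 * w < 1.
  by rewrite mulrC ltr_pdivrMr ?mulr_gt0// mul1r /k; move: w_ge0 ck; lra.
have [u [Du Au umin]] := elliptic_resolvent (j v) l0 lw.
have klE : (2 * (2 * k)^-1)^-1 = k by field; rewrite lt0r_neq0.
have := umin v Dv; have := u1min u Du.
rewrite klE subrr normr0 expr0n/= mulr0 addr0 => h1 h2.
have : (c + 1) / (e / 2) ^+ 2 * `|j u - j v| ^+ 2 <= c.
  have cE : fr u1 + (w / 2 + 1) * `|j u1 - j v| ^+ 2 = fr v - c by rewrite /c; ring.
  move: h1 h2; rewrite cE /k; move: ((c + 1) / _) => q; lra.
rewrite mulrAC ler_pdivrMr ?exprn_gt0// => h3.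
have : `|j u - j v| ^+ 2 < (e / 2) ^+ 2.
  have c10 : 0 < c + 1 by rewrite ltr_wpDl.
  rewrite -(ltr_pM2l c10); apply: le_lt_trans h3 _.
  by rewrite ltr_pM2r ?exprn_gt0// ltrDl.
rewrite ltr_pXn2r// ?nnegrE ?(ltW e20)// => uv.
exists (j u); first by eexists; exact: Au.
rewrite -(subrK (j v) x) -addrA (le_lt_trans (ler_normD _ _))//.
by rewrite (splitr e) ltrD// distrC.
Qed.

End j_elliptic.

(** * Existence and uniqueness of solutions *)

Section inclusion.
Context {R : realType} {H : hilbertType R}.
Variables (A : H -> set H) (psi : H -> R) (w : R).
Hypothesis w_ge0 : 0 <= w.
Hypothesis subgradP : forall x f y g, A x f -> A y g ->
  psi x + dotp f (y - x) - w / 2 * `|y - x| ^+ 2 <= psi y.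
Hypothesis range_condition : forall l : R, 0 < l -> l * w < 1 ->
  forall y, exists x, A x (l^-1 *: (y - x)).

Local Notation D := (closure (reldom A)).
Local Notation T := (flow A).
Local Notation A0 := (minsec A w).
Local Notation mu := (@lebesgue_measure R).

Definition inclusion_solution u0 (u : R -> H) :=
  [/\ {within `[0, +oo[, continuous u}, u 0 = u0 &
      exists2 du : R -> H, W1oo_loc u du &
        {ae mu, forall t, 0 < t -> [set du t + f | f in A (u t)] 0}].

Lemma continuous_half_lineP (u : R -> H) : {within `[0, +oo[, continuous u} <->
  forall t e : R, 0 <= t -> 0 < e -> exists2 d : R, 0 < d &
    forall s : R, 0 <= s -> `|t - s| < d -> `|u t - u s| < e.
Proof.
split=> [/subspace_continuousP cu t e t0 e0|cu].
  have tI : [set` `[0, +oo[] t by rewrite /= in_itv/= andbT.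
  have /cvgrPdist_lt/(_ _ e0) := cu t tI.
  rewrite near_withinE => -[d /= d0 hd]; exists d => // s s0 ts.
  by apply: hd => //=; rewrite in_itv/= andbT.
apply/subspace_continuousP => t /=; rewrite in_itv/= andbT => t0.
apply/cvgrPdist_lt => e e0; have [d d0 hd] := cu t e t0 e0.
rewrite near_withinE; exists d => //= s ts.
by rewrite in_itv/= andbT => s0; exact: hd.
Qed.

Lemma continuous_half_line_gt0 (u : R -> H) t : {within `[0, +oo[, continuous u} ->
  0 < t -> {for t, continuous u}.
Proof.
move=> /continuous_half_lineP cu t0; apply/cvgrPdist_lt => e e0.
have [d d0 hd] := cu t e (ltW t0) e0.
exists (Num.min d t); first by rewrite /= lt_min d0.
move=> s /=; rewrite lt_min => /andP[sd st]; apply: hd => //.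
by move: st; rewrite ltr_norml => /andP[]; lra.
Qed.

Lemma flow_continuous x : D x -> {within `[0, +oo[, continuous (T ^~ x)}.
Proof.
move=> Dx; apply/continuous_half_lineP => t e t0 e0.
pose K := expR (2 * w * (t + 1)).
have K0 : 0 < K by exact: expR_gt0.
have eK : 0 < e / 3 / K by rewrite !divr_gt0.
have [y [f Ayf] xy] := (closure_normP _ _).1 Dx _ eK.
have Dy : D y by apply: subset_closure; exists f.
have Kxy s : 0 <= s -> s <= t + 1 -> `|T s x - T s y| < e / 3.
  move=> s0 st; apply: le_lt_trans (flow_lipschitz w_ge0 subgradP range_condition s0 Dx Dy) _.
  apply: (@le_lt_trans _ _ (K * `|x - y|)); last by rewrite mulrC -ltr_pdivlMr.
  by rewrite ler_wpM2r// ler_expR ler_wpM2l// mulr_ge0.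
pose L := expR (4 * w * (t + 1)) * `|f| + 1.
have L0 : 0 < L by rewrite ltr_wpDl// mulr_ge0// expR_ge0.
exists (Num.min 1 (e / 3 / L)); first by rewrite lt_min ltr01 !divr_gt0.
move=> s s0; rewrite lt_min => /andP[ts1]; rewrite ltr_pdivlMr// => tsL.
have st : s <= t + 1 by move: ts1; rewrite ltr_norml => /andP[]; lra.
have tt : t <= t + 1 by rewrite lerDl.
apply: le_lt_trans (ler_dist3 _ (T t y) (T s y) _) _.
have h1 := Kxy _ t0 tt; have := Kxy _ s0 st; rewrite distrC => h2.
have h3 : `|T t y - T s y| < e / 3.
  apply: le_lt_trans tsL; rewrite mulrC /L mulrDl mul1r ler_wpDr//.
  by apply: (flow_time w_ge0 subgradP range_condition) => //; rewrite ?t0 ?s0.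
by move: h1 h2 h3; lra.
Qed.

Section solution.
Variable u0 : H.
Hypothesis Du0 : D u0.
Let u t := T t u0.

Lemma flow_in_domain t : 0 < t -> A (u t) (A0 (u t)).
Proof. by move=> t0; exact: (flow_smoothing w_ge0 subgradP range_condition Du0 t0). Qed.

Lemma flow_restart t s : 0 <= t -> 0 <= s -> u (t + s) = T s (u t).
Proof.
by move=> t0 s0; rewrite /u addrC (flow_add w_ge0 subgradP range_condition s0 t0 Du0).
Qed.

Lemma flow_right_derivative t e : 0 < t -> 0 < e -> exists2 d : R, 0 < d &
  forall s, 0 < s -> s < d -> `|u (t + s) - u t + s *: A0 (u t)| <= e * s.
Proof.
move=> t0 e0; have [d d0 hd] :=
  flow_derivative0 w_ge0 subgradP range_condition (flow_in_domain t0) e0.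
by exists d => // s s0 sd; rewrite flow_restart ?(ltW t0) ?(ltW s0)//; exact: hd.
Qed.

Lemma minsec_flow_right_continuous t : 0 < t ->
  A0 (u s) @[s --> t^'+] --> A0 (u t).
Proof.
move=> t0; apply/right_cvgP => e e0; have [d d0 hd] :=
  minsec_right_continuous0 w_ge0 subgradP range_condition (flow_in_domain t0) e0.
by exists d => // s s0 sd; rewrite flow_restart ?(ltW t0) ?(ltW s0)//; exact: hd (ltW s0) sd.
Qed.

Lemma minsec_flow_bounded a b : 0 < a -> a <= b -> exists M : R,
  forall t, a <= t <= b -> `|A0 (u t)| <= M.
Proof.
move=> a0 ab; exists (expR (2 * w * (b - a)) * `|A0 (u a)|) => t /andP[a_t tb].
have ta0 : 0 <= t - a by rewrite subr_ge0.
have -> : u t = T (t - a) (u a) by rewrite -flow_restart ?(ltW a0)// addrC subrK.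
apply: le_trans (minsec_flow w_ge0 subgradP range_condition (flow_in_domain a0) ta0).2 _.
by rewrite ler_wpM2r// ler_expR ler_wpM2l ?mulr_ge0// lerD2r.
Qed.

Lemma flow_solution : inclusion_solution u0 u.
Proof.
split; [exact: flow_continuous|exact: (flow0 w_ge0 subgradP range_condition)|].
exists (fun t => - A0 (u t)); last first.
  apply: aeW => t t0; exists (A0 (u t)); first exact: flow_in_domain.
  by rewrite addNr.
have rN t : 0 < t -> - A0 (u s) @[s --> t^'+] --> - A0 (u t).
  by move=> t0; apply: cvgN; exact: minsec_flow_right_continuous.
split.
- split.
    apply: right_continuous_strongly_measurable => t t0.
    by apply: cvg_at_right_filter; exact: (continuous_half_line_gt0 (flow_continuous Du0)).
  move=> a b a0 ab; have b0 : 0 <= b by rewrite ltW// (lt_le_trans a0).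
  pose K := expR (4 * w * b) * `|A0 (u a)| * b.
  exists (`|u a| + K); apply: aeW => t /andP[a_t tb].
  have ta0 : 0 <= t - a by rewrite subr_ge0.
  have -> : u t = T (t - a) (u a) by rewrite -flow_restart ?(ltW a0)// addrC subrK.
  have Dua : D (u a) by apply: subset_closure; exists (A0 (u a)); exact: flow_in_domain.
  rewrite -[X in `|X|](subrK (u a)) addrC (le_trans (ler_normD _ _))// lerD2l.
  rewrite -{2}(flow0 w_ge0 subgradP range_condition Dua).
  have tab : 0 <= t - a <= b by rewrite ta0/=; move: a0 tb; lra.
  have b00 : 0 <= (0 : R) <= b by rewrite lexx.
  apply: le_trans (flow_time w_ge0 subgradP range_condition (flow_in_domain a0) tab b00) _.
  by rewrite subr0 ger0_norm// ler_wpM2l ?mulr_ge0 ?expR_ge0//; case/andP: tab.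
- split; first exact: right_continuous_strongly_measurable.
  move=> a b a0 ab; have [M hM] := minsec_flow_bounded a0 ab.
  by exists M; apply: aeW => t /hM; rewrite normrN.
move=> eta h etaP; apply: right_derivative_weak => // [t t0|t t0|t e t0 e0|a b a0 ab].
- by apply: (@cvg_comp _ _ _ u (fun y => dotp y h)); [exact: (continuous_half_line_gt0 (flow_continuous Du0))|exact: dotpl_continuous].
- apply: (@cvg_comp _ _ _ (fun s => - A0 (u s)) (fun y => dotp y h)); first exact: rN.
  exact: dotpl_continuous.
- have h1 : 0 < `|h| + 1 by rewrite ltr_wpDl.
  have e1 : 0 < e / (`|h| + 1) by rewrite divr_gt0.
  have [d d0 hd] := flow_right_derivative t0 e1.
  exists d => // s s0 sd; have := hd s s0 sd.
  set r := u (t + s) - u t + _ => hr.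
  have -> : dotp (u (t + s)) h - dotp (u t) h - dotp (- A0 (u t)) h * s = dotp r h.
    by rewrite /r !dotpDl !dotpNl dotpZl; ring.
  apply: le_trans (dotp_norm _ _) _; apply: le_trans (ler_wpM2r (normr_ge0 _) hr) _.
  rewrite mulrAC ler_wpM2r ?(ltW s0)// mulrAC ler_pdivrMr// ler_pM2l//.
  by rewrite lerDl.
have [M hM] := minsec_flow_bounded a0 ab; exists (M * `|h|) => t /hM tM.
by rewrite dotpNl normrN (le_trans (dotp_norm _ _))// ler_wpM2r.
Qed.

End solution.

End inclusion.

Section uniqueness.
Context {R : realType} {H : hilbertType R}.
Variables (A : H -> set H) (psi : H -> R) (w : R).
Hypothesis w_ge0 : 0 <= w.
Hypothesis subgradP : forall x f y g, A x f -> A y g ->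
  psi x + dotp f (y - x) - w / 2 * `|y - x| ^+ 2 <= psi y.
Hypothesis range_condition : forall l : R, 0 < l -> l * w < 1 ->
  forall y, exists x, A x (l^-1 *: (y - x)).

Local Notation D := (closure (reldom A)).
Local Notation T := (flow A).
Local Notation A0 := (minsec A w).
Local Notation mu := (@lebesgue_measure R).

Variables (u0 : H) (v dv : R -> H).
Hypothesis Du0 : D u0.
Hypothesis v_continuous : {within `[0, +oo[, continuous v}.
Hypothesis v0 : v 0 = u0.
Hypothesis v_sobolev : W1oo_loc v dv.
Hypothesis v_inclusion : {ae mu, forall t, 0 < t ->
  [set dv t + f | f in A (v t)] 0}.

Let u t := T t u0.

Lemma dotp_increment_le h (a b K M s t : R) : 0 < a -> a <= s -> s < t -> t < b ->
  {ae mu, forall x, a <= x <= b -> dotp (dv x) h <= K /\ `|dv x| <= M} ->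
  dotp (v t) h - dotp (v s) h <= K * (t - s).
Proof.
move=> a0 a_s st tb [N [mN N0 hN]].
apply: (@weak_derivative_increment_le _ (fun r => dotp (v r) h)
  (fun r => dotp (dv r) h) a b K (M * `|h|)) => //.
- apply: continuous_in_subspaceT => x /set_mem/=; rewrite in_itv/= => /andP[ax _].
  apply: (@cvg_comp _ _ _ v (fun y => dotp y h)); last exact: dotpl_continuous.
  exact: (continuous_half_line_gt0 v_continuous (lt_le_trans a0 ax)).
- by move=> eta etaP; case: v_sobolev => _ _; exact.
exists N; split=> // x xN; apply: hN => hx; apply: xN => ab.
have [? xM] := hx ab; split=> //.
by rewrite (le_trans (dotp_norm _ _))// ler_wpM2r.
Qed.

Lemma solution_lipschitz (a b : R) : 0 < a -> a <= b -> exists2 M : R, 0 <= M &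
  {ae mu, forall x, a <= x <= b -> `|dv x| <= M} /\
  forall s t, a <= s -> s <= t -> t < b -> `|v t - v s| <= M * (t - s).
Proof.
move=> a0 ab; have [_ [_ /(_ a b a0 ab)[M hM]] _] := v_sobolev.
have {}hM : {ae mu, forall x, a <= x <= b -> `|dv x| <= Num.max 0 M}.
  have [N [mN N0 hN]] := hM; exists N; split=> // x xN; apply: hN => hx; apply: xN => /hx.
  by rewrite le_max => ->; rewrite orbT.
exists (Num.max 0 M); first by rewrite le_max lexx.
split=> // s t a_s; rewrite le_eqVlt => /predU1P[->|st tb].
  by rewrite !subrr normr0 mulr0.
set h := v t - v s; set M' := Num.max 0 M in hM *.
have : `|h| * `|h| <= `|h| * (M' * (t - s)).
  rewrite -expr2 -dotpp mulrA {1}/h dotpDl dotpNl [`|h| * M']mulrC.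
  apply: (dotp_increment_le (a := a) (b := b) (M := M')) => //.
  have [N [mN N0 hN]] := hM; exists N; split=> // x xN; apply: hN => hx; apply: xN => /hx xM.
  by split=> //; rewrite (le_trans (dotp_le _ _))// ler_wpM2r.
have [->|h0] := eqVneq h 0; last by rewrite ler_pM2l// normr_gt0.
by rewrite normr0 mulr_ge0 ?le_max ?lexx// subr_ge0 ltW.
Qed.

(* [A (v x) (- dv x)] holds only for almost every [x], so the monotonicity
   inequality against the fixed element [A0 (u s)] is integrated over x. *)
Lemma solution_increment (s e : R) : 0 < s -> 0 < e ->
  exists2 d : R, 0 < d & forall r, 0 < r -> r < d ->
  dotp (v (s + r) - v s) (v s - u s) <=
    (w * `|v s - u s| ^+ 2 - dotp (A0 (u s)) (v s - u s) + e) * r.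
Proof.
move=> s0 e0; set h := v s - u s.
have s2 : s <= s + 2 by rewrite lerDl.
have [M M0 [aeM lipM]] := solution_lipschitz s0 s2.
have Aus : A (u s) (A0 (u s)) by exact: (flow_in_domain w_ge0 subgradP range_condition Du0).
pose c := `|A0 (u s)| + w * (2 * `|h| + 1) + M.
have c0 : 0 <= c by rewrite !addr_ge0 ?mulr_ge0 ?addr_ge0 ?mulr_ge0.
pose q := M * c + M + 1.
have q0 : 0 < q by rewrite ltr_wpDl// addr_ge0 ?mulr_ge0.
exists (Num.min (1 / 2) (Num.min 1 e / q / 2)).
  by rewrite lt_min !divr_gt0// lt_min ltr01.
move=> r r0; rewrite lt_min => /andP[r1 re].
have q2 : q * (2 * r) < Num.min 1 e.
  by move: re; rewrite ltr_pdivlMr// ltr_pdivlMr//; lra.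
have [q21 q2e] : q * (2 * r) < 1 /\ q * (2 * r) < e.
  by move: q2; rewrite lt_min => /andP[].
rewrite dotpDl dotpNl (_ : r = s + r - s); last by ring.
rewrite [in leLHS](_ : s + (s + r - s) = s + r); last by ring.
apply: (dotp_increment_le (a := s) (b := s + 2 * r) (M := M)) => //.
- by rewrite ltrDl.
- by rewrite ltrD2l; lra.
have [N1 [mN1 N10 hN1]] := aeM; have [N2 [mN2 N20 hN2]] := v_inclusion.
exists (N1 `|` N2); split; [exact: measurableU|exact: null_set_setU|].
move=> x xN; apply: contrapT => /not_orP[xN1 xN2]; apply: xN => /andP[sx xr].
have x0 : 0 < x by exact: lt_le_trans sx.
have hM : `|dv x| <= M.
  apply: contrapT => xM; apply: xN1; apply: hN1 => /(_ _)/xM; apply.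
  by rewrite sx; move: xr r1; lra.
split=> //; have [f Af fdv] : [set dv x + f | f in A (v x)] 0.
  by apply: contrapT => xA; apply: xN2; apply: hN2 => /(_ x0)/xA.
have {}fdv : f = - dv x by apply/eqP; rewrite -addr_eq0 addrC; apply/eqP.
have := quasi_monotone subgradP Af Aus; rewrite {}fdv.
pose delta := v x - v s.
have -> : v x - u s = h + delta by rewrite [h + delta]addrC subrKA.
have dM : `|delta| <= 2 * r * M.
  apply: le_trans (lipM _ _ (lexx s) sx _) _; first by move: xr r1; lra.
  by rewrite mulrC ler_wpM2r//; move: xr; lra.
have hd := dotp_le h delta.
have Ad := dotp_le (- A0 (u s)) delta; rewrite dotpNl normrN in Ad.
have dvd : dotp (- dv x) delta <= M * `|delta|.
  by rewrite (le_trans (dotp_le _ _))// normrN ler_wpM2r.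
rewrite dotpNl in dvd.
have dc : `|delta| * c <= 2 * r * M * c by exact: ler_wpM2r.
have d1 : `|delta| * `|delta| <= `|delta|.
  have Mc : 0 <= M * c * (2 * r) by rewrite !mulr_ge0// ltW.
  by rewrite ler_piMr//; move: Mc dM q21; rewrite /q; lra.
have : 2 * r * M * c < e.
  have : 0 <= M * (2 * r) by rewrite !mulr_ge0// ltW.
  by move: q2e; rewrite /q; lra.
have := ler_wpM2l w_ge0 hd; have := ler_wpM2l w_ge0 d1.
move: dc hd Ad dvd; rewrite /c dotpDl !dotpNl !(dotpDr h delta) sqnormD.
by lra.
Qed.

Lemma solution_distance_right (s e : R) : 0 < s -> 0 < e ->
  exists2 d : R, 0 < d & forall r, 0 < r -> r < d ->
  `|v (s + r) - u (s + r)| ^+ 2 - `|v s - u s| ^+ 2 <=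
    (2 * w * `|v s - u s| ^+ 2 + e) * r.
Proof.
move=> s0 e0; have e80 : 0 < e / 8 by rewrite divr_gt0.
have [d1 d10 hd1] := solution_increment s0 e80.
set h := v s - u s in hd1 *.
have h1 : 0 < `|h| + 1 by rewrite ltr_wpDl.
have eh : 0 < e / 8 / (`|h| + 1) by rewrite divr_gt0.
have [d2 d20 hd2] :=
  flow_right_derivative w_ge0 subgradP range_condition Du0 s0 eh.
have s2 : s <= s + 2 by rewrite lerDl.
have [M M0 [_ lipM]] := solution_lipschitz s0 s2.
pose L := M + e / 8 / (`|h| + 1) + `|A0 (u s)|.
have L0 : 0 <= L by rewrite !addr_ge0// ltW.
have L1 : 0 < L ^+ 2 + 1 by rewrite ltr_wpDl// sqr_ge0.
exists (Num.min (Num.min d1 d2) (Num.min 1 (e / 8 / (L ^+ 2 + 1)))).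
  by rewrite !lt_min d10 d20 ltr01 divr_gt0.
move=> r r0; rewrite !lt_min => /andP[/andP[rd1 rd2] /andP[r1]].
rewrite ltr_pdivlMr// => rL.
have rge0 := ltW r0.
have := hd1 r r0 rd1; set a := v (s + r) - v s.
have := hd2 r r0 rd2; rewrite -/(u (s + r)) -/(u s).
set b := u (s + r) - u s => hb ha.
have -> : v (s + r) - u (s + r) = h + (a - b).
  by rewrite /h /a /b opprB [X in _ = _ + X]addrC addrA subrKA [RHS]addrC subrKA.
have aM : `|a| <= M * r.
  apply: le_trans (lipM s (s + r) (lexx _) _ _) _; rewrite ?lerDl//.
    by move: r1; lra.
  by rewrite addrAC subrr add0r.
have bA : `|b| <= (e / 8 / (`|h| + 1) + `|A0 (u s)|) * r.
  rewrite -[b](addrK (r *: A0 (u s))) (le_trans (ler_normB _ _))//.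
  by rewrite mulrDl lerD// normrZ gtr0_norm// mulrC.
have abL : `|a - b| ^+ 2 <= (L ^+ 2 * r) * r.
  rewrite -mulrA -expr2 -exprMn lerXn2r ?nnegrE ?mulr_ge0//.
  by rewrite (le_trans (ler_normB _ _))// /L -addrA mulrDl lerD.
have bh : - dotp b h <= r * dotp (A0 (u s)) h + e / 8 * r.
  have -> : - dotp b h = dotp (- (b + r *: A0 (u s))) h + r * dotp (A0 (u s)) h.
    by rewrite dotpNl dotpDl dotpZl; ring.
  rewrite addrC lerD2l (le_trans (dotp_le _ _))// normrN.
  apply: le_trans (ler_wpM2r (normr_ge0 _) hb) _.
  rewrite mulrAC ler_wpM2r// mulrAC ler_pdivrMr// ler_pM2l//.
  by rewrite lerDl.
have : L ^+ 2 * r <= e / 8 by move: rL r0; lra.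
move=> /(ler_wpM2r rge0) LL.
rewrite sqnormD (dotpDr a (- b)) dotpNr !(dotpC h).
have er : 0 <= e * r by rewrite mulr_ge0// ltW.
by move: ha bh abL LL; lra.
Qed.

Lemma solution_eq_flow t : 0 <= t -> v t = u t.
Proof.
rewrite le_eqVlt => /predU1P[<-|t0].
  by rewrite v0 /u (flow0 w_ge0 subgradP range_condition).
pose F s := expR (- (2 * w * s)) * `|v s - u s| ^+ 2.
have e1 s : 0 <= s -> expR (- (2 * w * s)) <= 1.
  by move=> s0; rewrite -expR0 ler_expR oppr_le0 !mulr_ge0.
have Fcts s : 0 < s -> {for s, continuous F}.
  move=> s0; apply: cvgM.
    apply: continuous_comp; last exact: continuous_expR.
    by apply: cvgN; apply: cvgM; [exact: cvg_cst|exact: cvg_id].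
  apply: cvg_sqnorm; apply: cvgB; first exact: continuous_half_line_gt0.
  apply: continuous_half_line_gt0 => //.
  exact: (flow_continuous w_ge0 subgradP range_condition).
have Fdecr a : 0 < a -> a <= t -> F t <= F a.
  move=> a0 a_t; apply: right_dini_nonincreasing => // s e /andP[a_s st] e0.
    have s0 : 0 < s by exact: lt_trans a_s.
    have /cvgrPdist_lt/(_ _ e0)[d /= d0 hd] := Fcts s s0.
    exists d => // r /andP[ar rs] dr.
    have /hd : `|s - r| < d by rewrite gtr0_norm ?subr_gt0//; move: dr; lra.
    by rewrite ltr_norml => /andP[_]; lra.
  have s0 : 0 < s by exact: lt_le_trans a_s.
  have [d d0 hd] := solution_distance_right s0 e0.
  exists d => // r r0 rd; have := hd r r0 rd; rewrite /F.
  set N := `|v s - u s| ^+ 2; set N' := `|_| ^+ 2 => hN.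
  have -> : - (2 * w * (s + r)) = - (2 * w * s) + - (2 * w * r) by ring.
  rewrite expRD -mulrA -mulrBr.
  have E0 : 0 < expR (- (2 * w * s)) by exact: expR_gt0.
  have h1 : expR (- (2 * w * r)) * N' - N <= e * r.
    have q0 : 0 < expR (- (2 * w * r)) by exact: expR_gt0.
    have q1 := e1 r (ltW r0).
    have q2 : expR (- (2 * w * r)) * (1 + 2 * w * r) <= 1.
      have := expR_ge1Dx (2 * w * r) => /(ler_wpM2l (ltW q0)).
      by rewrite -expRD addNr expR0.
    have := ler_wpM2r (sqr_ge0 `|v s - u s|) q2; rewrite -/N.
    have er : 0 <= e * r by rewrite mulr_ge0 ?ltW.
    have := ler_wpM2r er q1.
    have : expR (- (2 * w * r)) * N' <=
        expR (- (2 * w * r)) * (N + (2 * w * N + e) * r).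
      by rewrite ler_wpM2l ?(ltW q0)//; move: hN; lra.
    by lra.
  apply: le_trans (ler_wpM2l (ltW E0) h1) _.
  by rewrite ler_piMl ?e1 ?(ltW s0)// mulr_ge0// ltW.
have small e : 0 < e -> F t <= e.
  move=> e0; pose c := Num.min 1 e / 2.
  have c0 : 0 < c by rewrite divr_gt0// lt_min ltr01.
  have [d1 d10 hd1] := (continuous_half_lineP _).1 v_continuous 0 c (lexx _) c0.
  have [d2 d20 hd2] := (continuous_half_lineP _).1
    (flow_continuous w_ge0 subgradP range_condition Du0) 0 c (lexx _) c0.
  pose a := Num.min t (Num.min (d1 / 2) (d2 / 2)).
  have a0 : 0 < a by rewrite !lt_min t0 !divr_gt0.
  have a_t : a <= t by rewrite ge_min lexx.
  have ad1 : a <= d1 / 2 by rewrite !ge_min lexx orbT.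
  have ad2 : a <= d2 / 2 by rewrite !ge_min lexx !orbT.
  apply: le_trans (Fdecr a a0 a_t) _; rewrite /F.
  have /hd1 : 0 <= a by exact: ltW.
  have /hd2 : 0 <= a by exact: ltW.
  rewrite sub0r normrN (gtr0_norm a0) v0 (flow0 w_ge0 subgradP range_condition Du0).
  move=> h2 h1.
  have va : `|v a - u a| < 2 * c.
    have l1 : `|u0 - v a| < c by apply: h1; lra.
    have l2 : `|u0 - u a| < c by apply: h2; lra.
    have := ler_dist3 (v a) u0 u0 (u a).
    by rewrite subrr normr0 addr0 [`|v a - u0|]distrC; lra.
  have ce : 2 * c <= 1 /\ 2 * c <= e.
    rewrite /c mulrC divfK ?pnatr_eq0//.
    by rewrite !ge_min !lexx orbT.
  apply: le_trans (_ : 1 * `|v a - u a| ^+ 2 <= _).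
    by rewrite ler_wpM2r ?sqr_ge0// e1// ltW.
  have n0 := normr_ge0 (v a - u a).
  by rewrite mul1r; nra.
have F0 : F t <= 0 by apply/ler_addgt0Pr => e e0; rewrite add0r; exact: small.
have : `|v t - u t| ^+ 2 <= 0.
  by rewrite -(pmulr_rle0 _ (expR_gt0 (- (2 * w * t)))).
by rewrite exprn_even_le0//= normr_eq0 subr_eq0 => /eqP.
Qed.

End uniqueness.

Lemma closure_effdom_elliptic (R : realType) (H : hilbertType R)
    (phiH : H -> \bar R) : proper_fun phiH -> lower_semicontinuous phiH ->
  elliptic phiH -> closure (effdom phiH) = closure (reldom (subgradient phiH)).
Proof.
move=> pH lH [w [w0 cH coH]].
have idc : continuous ((idfun : {linear H -> H}) : weak H -> weak H).
  by move=> x; exact: cvg_id.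
by rewrite [RHS](closure_reldom_jsubgradient idc pH lH w0 cH coH) image_id.
Qed.

Theorem theorem3p1 (R : realType) (V : tvsType R) (H : hilbertType R)
    (j : {linear V -> H})
    (j_continuous : continuous (j : weak V -> weak H))
    (phi : V -> \bar R)
    (phi_proper : proper_fun phi)
    (phi_lsc : lower_semicontinuous phi)
    (phi_elliptic : jelliptic j phi) :
  let C : set H := closure (j @` effdom phi) in
  [/\ forall phiH : H -> \bar R,
        proper_fun phiH -> lower_semicontinuous phiH -> elliptic phiH ->
        jsubgradient j phi = subgradient phiH ->
        closure (effdom phiH) = C,
      forall u0 : H, C u0 ->
        exists u : R -> H,
          [/\ gradient_solution j phi u0 u,
              forall v : R -> H, gradient_solution j phi u0 v ->
                forall t, 0 <= t -> v t = u t &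
              {ae (@lebesgue_measure R), forall t, 0 < t ->
                reldom (jsubgradient j phi) (u t)}] &
      forall S : R -> H -> H,
        (forall u0, C u0 -> gradient_solution j phi u0 (S ^~ u0)) ->
        sc_semigroup C S /\
        forall t, 0 <= t -> [lipschitz S t u | u in C]].
Proof.
move=> C; have [w [w0 cphi cophi]] := phi_elliptic.
pose A := jsubgradient j phi.
have [psi subgradP] : exists psi : H -> R, forall x f y g, A x f -> A y g ->
    psi x + dotp f (y - x) - w / 2 * `|y - x| ^+ 2 <= psi y.
  exact: jsubgradient_potential.
have rangeP : forall l : R, 0 < l -> l * w < 1 ->
    forall y, exists x, A x (l^-1 *: (y - x)).
  exact: jsubgradient_range.
have CE : closure (reldom A) = C.
  exact: (closure_reldom_jsubgradient j_continuous phi_proper phi_lsc w0 cphi cophi).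
have sol u0 : C u0 -> inclusion_solution A u0 (flow A ^~ u0).
  by rewrite -CE => Cu0; exact: (flow_solution w0 subgradP rangeP Cu0).
have uniq u0 v : C u0 -> inclusion_solution A u0 v ->
    forall t, 0 <= t -> v t = flow A t u0.
  rewrite -CE => Cu0 [cv v0 [dv sv iv]] t t0.
  exact: (solution_eq_flow w0 subgradP rangeP Cu0 cv v0 sv iv t0).
split.
- move=> phiH pH lH eH e; rewrite closure_effdom_elliptic// -e; exact: CE.
- move=> u0 Cu0; exists (flow A ^~ u0); split.
  + exact: sol.
  + by move=> v; exact: uniq.
  + apply: aeW => t t0; exists (minsec A w (flow A t u0)).
    by apply: (flow_smoothing w0 subgradP rangeP) => //; rewrite CE.
- move=> S solS.
  have SE t u0 : 0 <= t -> C u0 -> S t u0 = flow A t u0.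
    by move=> t0 Cu0; exact: (uniq u0 (S ^~ u0) Cu0 (solS u0 Cu0) t t0).
  have Cflow t u0 : 0 <= t -> C u0 -> C (flow A t u0).
    by rewrite -CE; exact: (flow_mem w0 subgradP rangeP).
  split; first split.
  + by move=> t u0 t0 Cu0; rewrite SE//; exact: Cflow.
  + by move=> u0 /solS[].
  + move=> t s u0 t0 s0 Cu0; rewrite !SE ?addr_ge0//; last exact: Cflow.
    by apply: (flow_add w0 subgradP rangeP) => //; rewrite CE.
  + by move=> u0 /solS[].
  + move=> t t0; rewrite /lipschitz_on; near=> k; move=> [x y] /= [/= Cx Cy].
    change (`|S t x - S t y| <= k * `|x - y|); rewrite !SE//.
    rewrite -CE in Cx Cy.
    apply: le_trans (flow_lipschitz w0 subgradP rangeP t0 Cx Cy) _.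
    by rewrite ler_wpM2r//; near: k; exact: nbhs_pinfty_ge.
Unshelve. all: by end_near.
Qed.
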